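(* Let $H$ be a Hopf algebra over a field $k$ with bijective antipode, $A$ a right coideal subalgebra of $H$, and $C=H/HA^+$. If $H$ is left flat over $A$, then: (i) $\mathcal T_A$ and $\mathcal T_A^H$ are localizing subcategories, respectively, of $\mathcal M_A$ and $\mathcal M_A^H$; (ii) there are category equivalences $\mathcal M_A^H/\mathcal T_A^H\approx\mathcal M^C$ and $\mathcal M_A/\mathcal T_A\approx{}_H\mathcal M^C$. If $H$ is right flat over $A$, then: (iii) ${}_A\mathcal T$ and ${}_A\mathcal T^H$ are localizing subcategories, respectively, of ${}_A\mathcal M$ and ${}_A\mathcal M^H$; (iv) there are category equivalences ${}_A\mathcal M^H/{}_A\mathcal T^H\approx{}^C\mathcal M$ and ${}_A\mathcal M/{}_A\mathcal T\approx{}_H^C\mathcal M$.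
   Context: $\Delta,\varepsilon$ are the comultiplication and counit of $H$, $\Delta(x)=\sum x_{(1)}\otimes x_{(2)}$. A right coideal subalgebra is a subalgebra $A\subset H$ with $\Delta(A)\subset A\otimes H$; $A^+=A\cap\ker\varepsilon$; $HA^+$ is a left ideal and coideal of $H$, so $C=H/HA^+$ is a coalgebra and a left $H$-module. $H$ is left (right) flat over $A$ if it is flat as a left (right) $A$-module. $\mathcal M_A$, ${}_A\mathcal M$ are the categories of right and left $A$-modules; $\mathcal M^C$, ${}^C\mathcal M$ the categories of right and left $C$-comodules. Categories of relative Hopf modules: $\mathcal M_A^H$: right $A$-modules $M$ with a right $H$-comodule structure $\rho$ such that $\rho(ma)=\sum m_{(0)}a_{(1)}\otimes m_{(1)}a_{(2)}$; ${}_A\mathcal M^H$: left $A$-modules $M$ with a right $H$-comodule structure $\rho$ such that $\rho(am)=\sum a_{(1)}m_{(0)}\otimes a_{(2)}m_{(1)}$; ${}_H^C\mathcal M$: left $H$-modules $M$ with a left $C$-comodule structure $\lambda$ such that $\lambda(hm)=\sum h_{(1)}m_{(-1)}\otimes h_{(2)}m_{(0)}$; ${}_H\mathcal M^C$: left $H$-modules $M$ with a right $C$-comodule structure $\rho$ such that $\rho(hm)=\sum h_{(1)}m_{(0)}\otimes h_{(2)}m_{(1)}$. A right or left ideal $I$ of $A$ is $H$-costable if $\Delta(I)\subset I\otimes H$. $\mathcal T_A\subset\mathcal M_A$ and $\mathcal T_A^H\subset\mathcal M_A^H$ are the full subcategories of modules each of whose elements is annihilated by some nonzero $H$-costable right ideal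 of $A$; ${}_A\mathcal T\subset{}_A\mathcal M$ and ${}_A\mathcal T^H\subset{}_A\mathcal M^H$ are defined similarly using nonzero $H$-costable left ideals. A Serre subcategory $\mathcal S$ of an abelian category $\mathcal A$ is a full subcategory such that for each short exact sequence $0\to X'\to X\to X''\to0$ one has $X\in\mathcal S$ if and only if $X',X''\in\mathcal S$; $\mathcal A/\mathcal S$ is the quotient category, and $\mathcal S$ is localizing if the canonical functor $\mathcal A\to\mathcal A/\mathcal S$ has a right adjoint. *)

(* Defs.v *)
From HB Require Import structures.
From mathcomp Require Import all_boot all_algebra ring_quotient.
From mathcomp Require Import boolp classical_sets.
From mathcomp Require Import freeg.

Set Implicit Arguments.
Unset Strict Implicit.
Unset Printing Implicit Defensive.

Import GRing.Theory.
Local Open Scope ring_scope.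

Section Span.
Context (k : fieldType) (V : lmodType k).

Definition span (N : set V) : {pred V} := fun v =>
  `[< exists s : seq (k * V),
        (forall c, c \in s -> N c.2) /\ v = \sum_(c <- s) c.1 *: c.2 >].

Lemma mem_span (N : set V) v : N v -> v \in span N.
Proof.
move=> Nv; apply/asboolP; exists [:: (1, v)]; split.
  by move=> c; rewrite inE => /eqP ->.
by rewrite big_seq1 scale1r.
Qed.

Lemma span_submod (N : set V) : submod_closed (span N).
Proof.
split=> [|a u v /asboolP[s [sN ->]] /asboolP[t [tN ->]]]; apply/asboolP.
  by exists [::]; split=> //; rewrite big_nil.
exists ([seq (a * c.1, c.2) | c <- s] ++ t); split.
  by move=> c; rewrite mem_cat => /orP[/mapP[d /sN Nd ->]|/tN].
rewrite big_cat big_map scaler_sumr; congr (_ + _).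
by apply: eq_bigr => c _; rewrite scalerA.
Qed.

HB.instance Definition _ (N : set V) :=
  GRing.isSubmodClosed.Build k V (span N) (span_submod N).

Lemma span_ind (N : set V) (P : V -> Prop) :
  P 0 -> (forall a u v, N u -> P v -> P (a *: u + v)) ->
  forall v, v \in span N -> P v.
Proof.
move=> P0 PD v /asboolP[s [sN ->]]; elim: s sN => [|c s IH] sN.
  by rewrite big_nil.
rewrite big_cons; apply: PD; first by apply: sN; rewrite inE eqxx.
by apply: IH => d ds; apply: sN; rewrite inE ds orbT.
Qed.

End Span.

Definition modquot (k : fieldType) (V : lmodType k) (N : set V) : Type :=
  Quotient.quot (span N).

Section ModQuot.
Context (k : fieldType) (V : lmodType k) (N : set V).
Local Notation Q := (modquot N).

HB.instance Definition _ := Choice.on Q.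
HB.instance Definition _ := GRing.Zmodule.on Q.

Definition qproj (v : V) : Q := (\pi_(Quotient.quot (span N)) v)%qT.
Definition qrepr (q : Q) : V := repr (q : Quotient.quot (span N)).

Lemma qreprK : cancel qrepr qproj.
Proof. by move=> q; rewrite /qproj /qrepr reprK. Qed.

Lemma qproj_eq u v : qproj u = qproj v <-> u - v \in span N.
Proof.
rewrite /qproj Quotient.idealrBE; split; first by move=> ->.
by move/eqP.
Qed.

Lemma qprojD u v : qproj (u + v) = qproj u + qproj v.
Proof. by rewrite /qproj !piE. Qed.

Definition qscale (a : k) (q : Q) : Q := qproj (a *: qrepr q).

Lemma qscaleE a v : qscale a (qproj v) = qproj (a *: v).
Proof.
apply/qproj_eq; rewrite -scalerBr; apply: rpredZ.
by apply/qproj_eq; rewrite qreprK.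
Qed.

Fact qscaleA a b q : qscale a (qscale b q) = qscale (a * b) q.
Proof. by rewrite -[q]qreprK !qscaleE scalerA. Qed.
Fact qscale1 : left_id 1 qscale.
Proof. by move=> q; rewrite -[q]qreprK qscaleE scale1r. Qed.
Fact qscaleDr : right_distributive qscale +%R.
Proof.
move=> a p q; rewrite -[p]qreprK -[q]qreprK !qscaleE -!qprojD qscaleE.
by rewrite scalerDr.
Qed.
Fact qscaleDl q : {morph qscale^~ q : a b / a + b}.
Proof. by move=> a b; rewrite -[q]qreprK !qscaleE -qprojD scalerDl. Qed.

HB.instance Definition _ :=
  GRing.Zmodule_isLmodule.Build k Q qscaleA qscale1 qscaleDr qscaleDl.

Lemma qproj_linear : linear qproj.
Proof. by move=> a u v; rewrite qprojD -qscaleE. Qed.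

HB.instance Definition _ :=
  GRing.isLinear.Build k V Q *:%R qproj qproj_linear.

End ModQuot.
Arguments qproj {k V} N v.

Inductive tens_rel (k : fieldType) (V W : lmodType k) :
    set {freeg (V * W) / k} :=
| TensAddl v v' w : tens_rel (<< (v + v', w) >> - << (v, w) >> - << (v', w) >>)
| TensAddr v w w' : tens_rel (<< (v, w + w') >> - << (v, w) >> - << (v, w') >>)
| TensScalel a v w : tens_rel (<< (a *: v, w) >> - a *: << (v, w) >>)
| TensScaler a v w : tens_rel (<< (v, a *: w) >> - a *: << (v, w) >>).

Definition tens (k : fieldType) (V W : lmodType k) : lmodType k :=
  modquot (@tens_rel k V W).

Definition tpure (k : fieldType) (V W : lmodType k) (v : V) (w : W)
  : tens V W := qproj (@tens_rel k V W) << (v, w) >>.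

Notation "v ⊗ w" := (tpure v w) (at level 40, left associativity) : ring_scope.

Definition bilinear_fun (k : fieldType) (V W U : lmodType k)
    (f : V -> W -> U) : Prop :=
  (forall w, linear (f^~ w)) /\ (forall v, linear (f v)).

(* For a bilinear [f], [tlift f] is the linear map with v ⊗ w |-> f v w; it
   depends on the choice of representatives when [f] is not bilinear. *)
Definition tlift (k : fieldType) (V W U : lmodType k) (f : V -> W -> U)
    (t : tens V W) : U := fglift (fun p => f p.1 p.2) (qrepr t).

(* Sweedler notation: [\tsum_(x, y <- t) F] is the sum of the F x_i y_i for
   any decomposition t = sum_i x_i ⊗ y_i, where F is bilinear in x, y. *)
Notation "\tsum_ ( x , y <- t ) F" := (tlift (fun x y => F) t)
  (at level 41, x name, y name, t at level 200, F at level 41,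
   format "\tsum_ ( x ,  y  <-  t )  F") : ring_scope.

Section TensorTheory.
Context (k : fieldType).
Implicit Types (V W U : lmodType k).

Lemma linear_fun0 V W (f : V -> W) : linear f -> f 0 = 0.
Proof.
by move=> lf; have := lf (-1) 0 0; rewrite scaler0 addr0 scaleN1r addNr.
Qed.

Lemma linear_funD V W (f : V -> W) : linear f -> {morph f : u v / u + v}.
Proof. by move=> lf u v; have := lf 1 u v; rewrite !scale1r. Qed.

Lemma linear_funZ V W (f : V -> W) a v : linear f -> f (a *: v) = a *: f v.
Proof.
by move=> lf; have := lf a v 0; rewrite (linear_fun0 lf) !addr0.
Qed.

Lemma linear_funB V W (f : V -> W) : linear f -> {morph f : u v / u - v}.
Proof.
move=> lf u v; rewrite -!scaleN1r (linear_funD lf).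
by rewrite (linear_funZ _ _ lf).
Qed.

Lemma linear_comp V W U (f : V -> W) (g : W -> U) :
  linear f -> linear g -> linear (fun v => g (f v)).
Proof. by move=> lf lg a u v; rewrite lf lg. Qed.

Lemma fglift_linear (K : choiceType) U (f : K -> U) :
  linear (fglift f : {freeg K / k} -> U).
Proof.
have fB := lift_is_additive f.
have f0 : fglift f 0 = 0 by rewrite -(subrr 0) fB subrr.
have fN x : fglift f (- x) = - fglift f x by rewrite -sub0r fB f0 sub0r.
have fD x y : fglift f (x + y) = fglift f x + fglift f y.
  by rewrite -[y in LHS]opprK fB fN opprK.
move=> a x y; rewrite fD; congr (_ + _).
rewrite -[in RHS](freeg_sumE x) -[a *: x]/(fgscale a x) /fgscale.
rewrite !(big_morph _ fD f0) scaler_sumr; apply: eq_bigr => z _.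
by rewrite !liftU scalerA.
Qed.

Lemma tpure_bilinear V W : bilinear_fun (@tpure k V W).
Proof.
have N := mem_span.
have D : forall x y z : {freeg (V * W) / k}, tens_rel (x - y - z) ->
    qproj (@tens_rel k V W) x = qproj _ (y + z).
  by move=> x y z xyz; apply/qproj_eq/N; rewrite opprD addrA.
split=> [w|v] a x y; rewrite /tpure (D _ _ _ (TensAddl _ _ _))
  || rewrite /tpure (D _ _ _ (TensAddr _ _ _)).
- rewrite qprojD; congr (_ + _); rewrite -linearZ; apply/qproj_eq/N.
  exact: TensScalel.
- rewrite qprojD; congr (_ + _); rewrite -linearZ; apply/qproj_eq/N.
  exact: TensScaler.
Qed.

Lemma tlift_qproj V W U (f : V -> W -> U) x : bilinear_fun f ->
  tlift f (qproj _ x) = fglift (fun p => f p.1 p.2) x.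
Proof.
move=> [fl fr]; set F := fglift _.
have lF : linear F := fglift_linear _.
apply/eqP; rewrite -subr_eq0 -(linear_funB lF); apply/eqP.
have: qrepr (qproj (@tens_rel k V W) x) - x \in span (@tens_rel k V W).
  by apply/qproj_eq; rewrite qreprK.
move: (_ - x) => y; apply: (span_ind (P := fun y => F y = 0)).
  exact: linear_fun0.
move=> a u v relu Fv; rewrite lF Fv addr0.
suff -> : F u = 0 by rewrite scaler0.
case: u / relu => [v1 v2 w|v1 w1 w2|b v1 w1|b v1 w1];
  rewrite !(linear_funB lF) ?(linear_funZ _ _ lF) /F !liftU !scale1r /=.
- by rewrite (linear_funD (fl w)) addrAC addrK subrr.
- by rewrite (linear_funD (fr v1)) addrAC addrK subrr.
- by rewrite (linear_funZ _ _ (fl w1)) subrr.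
- by rewrite (linear_funZ _ _ (fr v1)) subrr.
Qed.

Lemma tliftE V W U (f : V -> W -> U) v w : bilinear_fun f ->
  tlift f (v ⊗ w) = f v w.
Proof. by move=> bf; rewrite /tpure tlift_qproj // liftU scale1r. Qed.

Lemma tlift_linear V W U (f : V -> W -> U) :
  bilinear_fun f -> linear (tlift f).
Proof.
move=> bf a s t; rewrite -[s]qreprK -[t]qreprK -linearP !tlift_qproj //.
exact: fglift_linear.
Qed.

Lemma linear_tlift V W U U' (f : V -> W -> U) (g : U -> U') t : linear g ->
  g (tlift f t) = tlift (fun v w => g (f v w)) t.
Proof.
move=> lg; rewrite /tlift; move: (qrepr t) => x.
rewrite -[x]freeg_repr !fglift_Freeg /prelift.
elim: {x}(repr x : seq _) => [|c s IH]; first by rewrite !big_nil linear_fun0.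
by rewrite !big_cons lg IH.
Qed.

Lemma tlift_linear_arg V W U U' (f : V -> W -> U' -> U) t :
  (forall v w, linear (f v w)) -> linear (fun u => tlift (fun v w => f v w u) t).
Proof.
move=> lf a u u'; rewrite /tlift; move: (qrepr t) => x.
rewrite -[x]freeg_repr !fglift_Freeg /prelift scaler_sumr -big_split /=.
by apply: eq_bigr => c _; rewrite lf scalerDr !scalerA mulrC.
Qed.

Lemma tlift0 V W U t : tlift (fun (_ : V) (_ : W) => 0 : U) t = 0.
Proof.
rewrite /tlift; move: (qrepr t) => x; rewrite -[x]freeg_repr fglift_Freeg.
by rewrite /prelift big1 // => c _; rewrite scaler0.
Qed.

Lemma eq_tlift V W U (f g : V -> W -> U) t : (forall v w, f v w = g v w) ->
  tlift f t = tlift g t.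
Proof. by move=> fg; congr tlift; apply/funext => v; apply/funext. Qed.

Lemma tlift_id V W (t : tens V W) : \tsum_(v, w <- t) v ⊗ w = t.
Proof.
rewrite -[RHS]qreprK /tlift; move: (qrepr t) => x.
rewrite -[x]freeg_repr; elim: {x}(repr x : seq _) => [|[a p] s IH].
  rewrite fglift_Freeg /prelift big_nil.
  suff -> : Freeg [::] = 0 :> {freeg (V * W) / k} by rewrite linear0.
  by apply/eqP/freeg_eqP => z; rewrite coeff_Freeg.
move: IH; rewrite !fglift_Freeg /prelift big_cons => ->.
have -> : Freeg ((a, p) :: s) = a *: << p >> + Freeg s.
  apply/eqP/freeg_eqP => z; rewrite coeffD coeffZ coeffU !coeff_Freeg.
  by rewrite precoeff_cons mul1r mulrC.
by rewrite linearP /tpure; case: p.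
Qed.

Lemma tlift_pure V W U (f : tens V W -> U) (t : tens V W) :
  linear f -> f t = \tsum_(v, w <- t) f (v ⊗ w).
Proof. by move=> lf; rewrite -[in LHS](tlift_id t) linear_tlift. Qed.

End TensorTheory.

(* Coassociativity is written through the identification
   (C ⊗ C) ⊗ C = C ⊗ (C ⊗ C). *)
Record is_coalgebra (k : fieldType) (C : lmodType k)
    (Delta : C -> tens C C) (eps : C -> k) : Prop := IsCoalgebra {
  comul_linear : linear Delta;
  counit_linear : scalar eps;
  comulA : forall x,
    \tsum_(y, z <- Delta x) \tsum_(y1, y2 <- Delta y) y1 ⊗ (y2 ⊗ z)
    = \tsum_(y, z <- Delta x) y ⊗ Delta z;
  comul_counitl : forall x, \tsum_(y, z <- Delta x) (eps y *: z) = x;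
  comul_counitr : forall x, \tsum_(y, z <- Delta x) (eps z *: y) = x
}.

Record coalgebra (k : fieldType) := Coalgebra {
  coalg_sort :> lmodType k;
  comul : coalg_sort -> tens coalg_sort coalg_sort;
  counit : coalg_sort -> k;
  coalgP : is_coalgebra comul counit
}.

Record is_hopf (k : fieldType) (H : algType k)
    (Delta : H -> tens H H) (eps : H -> k) (S : H -> H) : Prop := IsHopf {
  hopf_coalgP : is_coalgebra Delta eps;
  hopf_comulM : forall x y, Delta (x * y) =
    \tsum_(x1, x2 <- Delta x) \tsum_(y1, y2 <- Delta y) (x1 * y1) ⊗ (x2 * y2);
  hopf_comul1 : Delta 1 = 1 ⊗ 1;
  hopf_counitM : forall x y, eps (x * y) = eps x * eps y;
  hopf_counit1 : eps 1 = 1;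
  hopf_antipode_linear : linear S;
  hopf_antipodel : forall x, \tsum_(y, z <- Delta x) (S y * z) = eps x *: 1;
  hopf_antipoder : forall x, \tsum_(y, z <- Delta x) (y * S z) = eps x *: 1
}.

Record hopf (k : fieldType) := Hopf {
  hopf_sort :> algType k;
  hcomul : hopf_sort -> tens hopf_sort hopf_sort;
  hcounit : hopf_sort -> k;
  antipode : hopf_sort -> hopf_sort;
  hopfP : is_hopf hcomul hcounit antipode
}.

Definition hopf_coalg (k : fieldType) (H : hopf k) : coalgebra k :=
  Coalgebra (hopf_coalgP (hopfP H)).

(* The inclusion A ⊗ H -> H ⊗ H. *)
Definition tens_val (k : fieldType) (H : algType k) (P : {pred H})
    (A : subAlgType P) (t : tens A H) : tens H H :=
  \tsum_(a, h <- t) (val a : H) ⊗ h.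

Record rcoideal_subalg (k : fieldType) (H : hopf k) := RcoidealSubalg {
  rcs_pred : {pred H};
  rcs_sort :> subAlgType rcs_pred;
  rcs_coideal : forall a : rcs_sort,
    exists t : tens rcs_sort H, tens_val t = hcomul (val a)
}.

(* The corestriction A -> A ⊗ H of the comultiplication; it is the unique
   such map since A ⊗ H -> H ⊗ H is injective. *)
Definition rcomul (k : fieldType) (H : hopf k) (A : rcoideal_subalg H)
    (a : A) : tens A H := sval (cid (rcs_coideal a)).

Lemma rcomulE (k : fieldType) (H : hopf k) (A : rcoideal_subalg H) (a : A) :
  tens_val (rcomul a) = hcomul (val a).
Proof. exact: svalP (cid (rcs_coideal a)). Qed.

Section QuotientCoalgebra.
Context (k : fieldType) (H : hopf k) (A : rcoideal_subalg H).

(* HA^+ is the k-linear span of this set of products. *)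
Inductive HAplus_gen : set H :=
  HAplusGen (h : H) (a : A) :
    hcounit (val a : H) = 0 -> HAplus_gen (h * (val a : H)).

Definition HA_quot : lmodType k := modquot HAplus_gen.

Local Notation C := HA_quot.
Local Notation pi := (qproj HAplus_gen : H -> C).

Definition qcomul (c : C) : tens C C :=
  \tsum_(x, y <- hcomul (qrepr c)) pi x ⊗ pi y.
Definition qcounit (c : C) : k := hcounit (qrepr c).
Definition qact (h : H) (c : C) : C := pi (h * qrepr c).

Let Hc := hopf_coalgP (hopfP H).

Lemma linear_mulr (a : H) : linear (fun x : H => x * a).
Proof. by move=> c x y; rewrite mulrDl scalerAl. Qed.
Lemma linear_mull (a : H) : linear (fun x : H => a * x).
Proof. by move=> c x y; rewrite mulrDr scalerAr. Qed.

Lemma hcounitZ c (x : H) : hcounit (c *: x) = c * hcounit x.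
Proof.
have l := counit_linear Hc; have e0 : hcounit (0 : H) = 0.
  by have := l (-1) 0 0; rewrite scaler0 addr0 mulN1r addNr.
by have := l c x 0; rewrite e0 !addr0.
Qed.

Lemma hcounitD (x y : H) : hcounit (x + y) = hcounit x + hcounit y.
Proof. by have := counit_linear Hc 1 x y; rewrite scale1r mul1r. Qed.

Lemma piM_linear (V : lmodType k) (f : V -> H) : linear f -> linear (fun v : V => pi (f v)).
Proof. by move=> lf; apply: linear_comp lf _; exact: linearP. Qed.

Lemma tens2_bilinear (V W V' W' : lmodType k) (f : V -> V') (g : W -> W') :
  linear f -> linear g -> bilinear_fun (fun v w => f v ⊗ g w).
Proof.
move=> lf lg; split=> [w|v] a x y /=.
  by rewrite lf (tpure_bilinear V' W').1.
by rewrite lg (tpure_bilinear V' W').2.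
Qed.

Lemma pi2_bilinear (V W : lmodType k) (f : V -> H) (g : W -> H) :
  linear f -> linear g -> bilinear_fun (fun v w => pi (f v) ⊗ pi (g w)).
Proof. by move=> lf lg; apply: tens2_bilinear; exact: piM_linear. Qed.

Lemma linear_idfun (V : lmodType k) : linear (fun v : V => v).
Proof. by []. Qed.
Hint Resolve linear_mull linear_mulr linear_idfun : core.

Lemma val_aug (b : A) (e : k) : (val (b - e *: 1) : H) = val b - e *: 1.
Proof.
by rewrite linearB /= linearZ /= (rmorph1 (val : A -> H)).
Qed.

Lemma pi_aug (h : H) (b : A) : pi (h * val b) = hcounit (val b : H) *: pi h.
Proof.
rewrite -linearZ; apply/qproj_eq.
set e := hcounit _; have -> : h * val b - e *: h = h * val (b - e *: 1).
  by rewrite val_aug mulrBr -scalerAr mulr1.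
apply: mem_span; apply: HAplusGen.
rewrite val_aug -scaleN1r hcounitD !hcounitZ.
by rewrite (hopf_counit1 (hopfP H)) mulr1 mulN1r subrr.
Qed.

Lemma qcomulE (x : H) : qcomul (pi x) = \tsum_(y, z <- hcomul x) pi y ⊗ pi z.
Proof.
rewrite /qcomul; set F := tlift _.
have lF : linear F by apply/tlift_linear/pi2_bilinear.
have lFD : linear (fun u => F (hcomul u)).
  by apply: linear_comp lF; exact: comul_linear Hc.
apply/eqP; rewrite -subr_eq0 -(linear_funB lFD); apply/eqP.
have: qrepr (pi x) - x \in span HAplus_gen by apply/qproj_eq; rewrite qreprK.
move: (_ - x) => y; apply: (span_ind (P := fun y => F (hcomul y) = 0)).
  exact: linear_fun0 lFD.
move=> c u v Iu Fv; rewrite lFD Fv addr0.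
suff -> : F (hcomul u) = 0 by rewrite scaler0.
case: u / Iu => h a ea; rewrite (hopf_comulM (hopfP H)) linear_tlift //.
have step (h1 h2 : H) :
    F (\tsum_(y1, y2 <- hcomul (val a : H)) (h1 * y1) ⊗ (h2 * y2)) = 0.
  rewrite linear_tlift //.
  pose B (y1 y2 : H) := pi (h1 * y1) ⊗ pi (h2 * y2).
  have bB : bilinear_fun B by exact: pi2_bilinear.
  rewrite (eq_tlift (g := B)); last first.
    by move=> y1 y2; rewrite /F tliftE //; exact: pi2_bilinear.
  rewrite -(rcomulE a) /tens_val linear_tlift; last exact: tlift_linear.
  pose G (z : H) := pi h1 ⊗ pi (h2 * z).
  have lG : linear G.
    apply: (linear_comp (f := fun z => pi (h2 * z))); first exact: piM_linear.
    exact: (tpure_bilinear _ _).2.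
  pose E (y z : H) := hcounit y *: z.
  have bE : bilinear_fun E.
    split=> [w|v'] c' u w'; rewrite /E.
      by rewrite (counit_linear Hc) scalerDl scalerA.
    by rewrite scalerDr !scalerA mulrC.
  have lE : linear (tlift E) by exact: tlift_linear.
  transitivity (G (tlift E (hcomul (val a : H)))).
    rewrite -(rcomulE a) /tens_val (linear_tlift _ _ lE) (linear_tlift _ _ lG).
    apply: eq_tlift => b z; rewrite !tliftE // /B pi_aug /E.
    rewrite (linear_funZ _ _ lG) /G.
    by rewrite (linear_funZ _ _ ((tpure_bilinear _ _).1 _)).
  rewrite (comul_counitl Hc) /G pi_aug ea scale0r.
  exact: (linear_fun0 ((tpure_bilinear _ _).2 _)).
rewrite (eq_tlift (g := fun _ _ => 0)) //.
exact: tlift0.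
Qed.

Lemma qcounitE (x : H) : qcounit (pi x) = hcounit x.
Proof.
apply/eqP; rewrite -subr_eq0 /qcounit -mulN1r -hcounitZ -hcounitD scaleN1r.
have: qrepr (pi x) - x \in span HAplus_gen by apply/qproj_eq; rewrite qreprK.
move: (_ - x) => y yI; apply/eqP; move: y yI; apply: span_ind.
  by rewrite -(scale0r 0) hcounitZ mul0r.
move=> c u v Iu ev; rewrite hcounitD hcounitZ ev addr0.
case: u / Iu => h a ea.
by rewrite (hopf_counitM (hopfP H)) ea !mulr0.
Qed.

Lemma qactE (h x : H) : qact h (pi x) = pi (h * x).
Proof.
rewrite /qact; apply/qproj_eq; rewrite -mulrBr.
have: qrepr (pi x) - x \in span HAplus_gen by apply/qproj_eq; rewrite qreprK.
move: (_ - x) => y; apply: (span_ind (P := fun y => h * y \in span _)).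
  by rewrite mulr0 rpred0.
move=> c u v Iu vI; rewrite mulrDr -scalerAr rpredD // rpredZ //.
by case: u / Iu => h' a ea; rewrite mulrA; apply/mem_span/HAplusGen.
Qed.

Lemma qcomul_linear : linear qcomul.
Proof.
move=> c x y; rewrite -[x]qreprK -[y]qreprK -linearP !qcomulE.
rewrite (comul_linear Hc); apply: tlift_linear; exact: pi2_bilinear.
Qed.

Lemma qcounit_linear : scalar qcounit.
Proof.
move=> c x y; rewrite -[x]qreprK -[y]qreprK -linearP !qcounitE.
by rewrite hcounitD hcounitZ.
Qed.

Lemma tlift_qcomul (U : lmodType k) (f : C -> C -> U) (x : H) :
  bilinear_fun f ->
  tlift f (qcomul (pi x)) = \tsum_(y, z <- hcomul x) f (pi y) (pi z).
Proof.
move=> bf; rewrite qcomulE linear_tlift; last exact: tlift_linear.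
by apply: eq_tlift => y z; rewrite tliftE.
Qed.

Lemma qcoalgP : is_coalgebra qcomul qcounit.
Proof.
have bpi : bilinear_fun (fun y z : H => pi y ⊗ pi z) by exact: pi2_bilinear.
split.
- exact: qcomul_linear.
- exact: qcounit_linear.
- move=> c; rewrite -[c]qreprK; move: (qrepr c) => {c} x.
  rewrite !tlift_qcomul; last first.
    split=> [z|y].
      apply: linear_comp qcomul_linear _; apply: tlift_linear.
      apply: tens2_bilinear => //; exact: (tpure_bilinear _ _).1.
    apply: tlift_linear_arg => y1 y2.
    apply: (linear_comp (f := fun z => y2 ⊗ z)); exact: (tpure_bilinear _ _).2.
    by apply: tens2_bilinear => //; exact: qcomul_linear.
  pose G2 (a : H) (t : tens H H) :=
    pi a ⊗ (\tsum_(b, d <- t) pi b ⊗ pi d).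
  have bG2 : bilinear_fun G2.
    by apply: tens2_bilinear; [exact: linearP | exact: tlift_linear].
  have lG := tlift_linear bG2.
  transitivity (tlift G2 (\tsum_(y, z <- hcomul x)
      \tsum_(y1, y2 <- hcomul y) y1 ⊗ (y2 ⊗ z))).
    rewrite linear_tlift //; apply: eq_tlift => y z.
    rewrite linear_tlift // tlift_qcomul.
      by apply: eq_tlift => y1 y2; rewrite tliftE // /G2 tliftE.
    by apply: tens2_bilinear => //; exact: (tpure_bilinear _ _).1.
  rewrite (comulA Hc) linear_tlift //; apply: eq_tlift => y z.
  by rewrite tliftE // qcomulE.
- move=> c; rewrite -[c]qreprK; move: (qrepr c) => {c} x.
  rewrite tlift_qcomul; last first.
    split=> [z|y] a u v; first by rewrite qcounit_linear scalerDl scalerA.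
    by rewrite scalerDr !scalerA mulrC.
  rewrite -[in RHS](comul_counitl Hc x) linear_tlift; last exact: linearP.
  by apply: eq_tlift => y z; rewrite qcounitE linearZ.
- move=> c; rewrite -[c]qreprK; move: (qrepr c) => {c} x.
  rewrite tlift_qcomul; last first.
    split=> [z|y] a u v; last by rewrite qcounit_linear scalerDl scalerA.
    by rewrite scalerDr !scalerA mulrC.
  rewrite -[in RHS](comul_counitr Hc x) linear_tlift; last exact: linearP.
  by apply: eq_tlift => y z; rewrite qcounitE linearZ.
Qed.

(* C = H / HA^+ *)
Definition HA_coalg : coalgebra k := Coalgebra qcoalgP.

End QuotientCoalgebra.

Record category := Category {
  ob :> Type;
  hom : ob -> ob -> Type;
  idm : forall X, hom X X;
  comp : forall X Y Z, hom Y Z -> hom X Y -> hom X Z;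
  compA : forall X Y Z T (h : hom Z T) (g : hom Y Z) (f : hom X Y),
    comp h (comp g f) = comp (comp h g) f;
  comp1m : forall X Y (f : hom X Y), comp (idm Y) f = f;
  compm1 : forall X Y (f : hom X Y), comp f (idm X) = f
}.
Arguments hom {c} X Y.
Arguments idm {c} X.
Arguments comp {c X Y Z} g f.

Notation "g '∘m' f" := (comp g f) (at level 40, left associativity).

Record functor (C D : category) := Functor {
  fob :> C -> D;
  fmap : forall X Y, hom X Y -> hom (fob X) (fob Y);
  fmap1 : forall X, fmap (idm X) = idm (fob X);
  fmapM : forall X Y Z (g : hom Y Z) (f : hom X Y),
    fmap (g ∘m f) = fmap g ∘m fmap f
}.
Arguments fmap {C D} _ {X Y} _.

Definition functor_id (C : category) : functor C C :=
  @Functor C C (fun X => X) (fun X Y f => f)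
    (fun=> erefl) (fun _ _ _ _ _ => erefl).

Program Definition functor_comp (C D E : category)
    (G : functor D E) (F : functor C D) : functor C E :=
  @Functor C E (fun X => G (F X)) (fun X Y f => fmap G (fmap F f)) _ _.
Next Obligation. by rewrite !fmap1. Qed.
Next Obligation. by rewrite !fmapM. Qed.

Section CategoryTheory.
Context (C : category).
Implicit Types (X Y Z : C).

Definition isomorphism X Y (f : hom X Y) : Prop :=
  exists g : hom Y X, g ∘m f = idm X /\ f ∘m g = idm Y.

Definition monomorphism X Y (f : hom X Y) : Prop :=
  forall T (g h : hom T X), f ∘m g = f ∘m h -> g = h.

Definition epimorphism X Y (f : hom X Y) : Prop :=
  forall T (g h : hom Y T), g ∘m f = h ∘m f -> g = h.

Definition zero_object Z : Prop :=
  (forall X, exists! f : hom X Z, True) /\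
  (forall X, exists! f : hom Z X, True).

Definition zero_morphism X Y (f : hom X Y) : Prop :=
  exists Z (g : hom X Z) (h : hom Z Y), zero_object Z /\ f = h ∘m g.

Definition is_kernel K X Y (i : hom K X) (f : hom X Y) : Prop :=
  zero_morphism (f ∘m i) /\
  forall T (g : hom T X), zero_morphism (f ∘m g) ->
    exists! u : hom T K, i ∘m u = g.

Definition is_cokernel X Y Q (p : hom Y Q) (f : hom X Y) : Prop :=
  zero_morphism (p ∘m f) /\
  forall T (g : hom Y T), zero_morphism (g ∘m f) ->
    exists! u : hom Q T, u ∘m p = g.

Definition is_product X Y P (p : hom P X) (q : hom P Y) : Prop :=
  forall T (f : hom T X) (g : hom T Y),
    exists! u : hom T P, p ∘m u = f /\ q ∘m u = g.

Definition is_coproduct X Y S (i : hom X S) (j : hom Y S) : Prop :=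
  forall T (f : hom X T) (g : hom Y T),
    exists! u : hom S T, u ∘m i = f /\ u ∘m j = g.

(* The additive structure of an abelian category is determined by these
   conditions, so it is not part of the data. *)
Record abelian : Prop := Abelian {
  ab_zero : exists Z : C, zero_object Z;
  ab_product : forall X Y, exists P (p : hom P X) (q : hom P Y),
    is_product p q;
  ab_coproduct : forall X Y, exists S (i : hom X S) (j : hom Y S),
    is_coproduct i j;
  ab_kernel : forall X Y (f : hom X Y), exists K (i : hom K X), is_kernel i f;
  ab_cokernel : forall X Y (f : hom X Y),
    exists Q (p : hom Y Q), is_cokernel p f;
  ab_mono : forall X Y (f : hom X Y), monomorphism f ->
    exists Z (g : hom Y Z), is_kernel f g;
  ab_epi : forall X Y (f : hom X Y), epimorphism f ->
    exists Z (g : hom Z X), is_cokernel f g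
}.

Definition short_exact X' X X'' (f : hom X' X) (g : hom X X'') : Prop :=
  is_kernel f g /\ is_cokernel g f.

(* A full subcategory is given by the predicate on its objects. *)
Definition serre_subcategory (S : C -> Prop) : Prop :=
  abelian /\
  forall X' X X'' (f : hom X' X) (g : hom X X''), short_exact f g ->
    (S X <-> S X' /\ S X'').

End CategoryTheory.

Definition natural_iso (C D : category) (F G : functor C D) : Prop :=
  exists a : forall X, hom (F X) (G X),
    (forall X, isomorphism (a X)) /\
    (forall X Y (f : hom X Y), a Y ∘m fmap F f = fmap G f ∘m a X).

Definition equivalent_cat (C D : category) : Prop :=
  exists (F : functor C D) (G : functor D C),
    natural_iso (functor_comp G F) (functor_id C) /\
    natural_iso (functor_comp F G) (functor_id D).

Definition has_right_adjoint (C D : category) (F : functor C D) : Prop :=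
  exists (G : functor D C) (phi : forall X Y, hom (F X) Y -> hom X (G Y)),
    (forall X Y, bijective (phi X Y)) /\
    (forall X' X Y Y' (f : hom X' X) (h : hom (F X) Y) (g : hom Y Y'),
      phi X' Y' (g ∘m h ∘m fmap F f) = fmap G g ∘m phi X Y h ∘m f).

(* The localization C[W^-1]: morphisms are finite paths made of morphisms of
   C and formal inverses of elements of W, modulo the congruence generated by
   the identities and compositions of C and by w w^-1 = 1, w^-1 w = 1. *)
Section Localization.
Context (C : category) (W : forall X Y : C, hom X Y -> Prop).

Inductive zigzag : C -> C -> Type :=
| ZNil X : zigzag X X
| ZFwd X Y Z (f : hom X Y) (p : zigzag Y Z) : zigzag X Z
| ZBwd X Y Z (w : hom Y X) (Ww : W w) (p : zigzag Y Z) : zigzag X Z.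

Inductive zeq : forall X Y, zigzag X Y -> zigzag X Y -> Prop :=
| ZRefl X Y (p : zigzag X Y) : zeq p p
| ZSym X Y (p q : zigzag X Y) : zeq p q -> zeq q p
| ZTrans X Y (p q r : zigzag X Y) : zeq p q -> zeq q r -> zeq p r
| ZFwdCong X Y Z (f : hom X Y) (p q : zigzag Y Z) :
    zeq p q -> zeq (ZFwd f p) (ZFwd f q)
| ZBwdCong X Y Z (w : hom Y X) (Ww : W w) (p q : zigzag Y Z) :
    zeq p q -> zeq (ZBwd Ww p) (ZBwd Ww q)
| ZId X Y (p : zigzag X Y) : zeq (ZFwd (idm X) p) p
| ZComp X Y Z T (f : hom X Y) (g : hom Y Z) (p : zigzag Z T) :
    zeq (ZFwd f (ZFwd g p)) (ZFwd (g ∘m f) p)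
| ZFwdBwd X Y Z (w : hom X Y) (Ww : W w) (p : zigzag X Z) :
    zeq (ZFwd w (ZBwd Ww p)) p
| ZBwdFwd X Y Z (w : hom Y X) (Ww : W w) (p : zigzag X Z) :
    zeq (ZBwd Ww (ZFwd w p)) p.

Fixpoint zcat X Y Z (p : zigzag X Y) : zigzag Y Z -> zigzag X Z :=
  match p with
  | ZNil _ => fun q => q
  | ZFwd _ _ _ f p' => fun q => ZFwd f (zcat p' q)
  | ZBwd _ _ _ _ Ww p' => fun q => ZBwd Ww (zcat p' q)
  end.

Lemma zcatA X Y Z T (p : zigzag X Y) (q : zigzag Y Z) (r : zigzag Z T) :
  zcat p (zcat q r) = zcat (zcat p q) r.
Proof.
elim: p q r => //= {}X {}Y Y' => [f|w Ww] p IH q r; congr (_ _);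
  exact: IH.
Qed.

Lemma zcat0 X Y (p : zigzag X Y) : zcat p (ZNil Y) = p.
Proof. by elim: p => //= X' Y' Z' => [f|w Ww] p ->. Qed.

Lemma zeq_cat X Y Z (p p' : zigzag X Y) (q q' : zigzag Y Z) :
  zeq p p' -> zeq q q' -> zeq (zcat p q) (zcat p' q').
Proof.
move=> pp' qq'; apply: (@ZTrans _ _ _ (zcat p q')).
  elim: p q q' qq' {p' pp'} => //= X' Y' Z' => [f|w Ww] p IH q q' qq'.
    exact/ZFwdCong/IH.
  exact/ZBwdCong/IH.
move=> {qq'}; move: q' {q}; elim: pp' => /=.
- by move=> *; exact: ZRefl.
- by move=> *; exact: ZSym.
- by move=> X' Y' p1 p2 p3 _ IH1 _ IH2 q; exact: ZTrans (IH1 q) (IH2 q).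
- by move=> *; exact: ZFwdCong.
- by move=> *; exact: ZBwdCong.
- by move=> *; exact: ZId.
- by move=> *; exact: ZComp.
- by move=> *; exact: ZFwdBwd.
- by move=> *; exact: ZBwdFwd.
Qed.

Definition loc_hom (X Y : C) : Type :=
  {c : zigzag X Y -> Prop | exists p, c = zeq p}.

Definition zclass X Y (p : zigzag X Y) : loc_hom X Y :=
  exist _ (zeq p) (ex_intro _ p erefl).
Definition zrepr X Y (c : loc_hom X Y) : zigzag X Y := sval (cid (svalP c)).

Lemma zreprK X Y (c : loc_hom X Y) : zclass (zrepr c) = c.
Proof.
rewrite /zrepr; case: c => c cP /=; case: cid => p /= pc.
by subst c; congr exist; exact: Prop_irrelevance.
Qed.

Lemma zclass_eq X Y (p q : zigzag X Y) : zeq p q <-> zclass p = zclass q.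
Proof.
split=> [pq|/(congr1 sval) /= ->]; last exact: ZRefl.
apply: eq_exist; apply/funext => r; apply/propext; split.
  exact: ZTrans (ZSym pq).
exact: ZTrans pq.
Qed.

Definition loc_comp X Y Z (d : loc_hom Y Z) (c : loc_hom X Y) : loc_hom X Z :=
  zclass (zcat (zrepr c) (zrepr d)).

Lemma loc_compE X Y Z (q : zigzag Y Z) (p : zigzag X Y) :
  loc_comp (zclass q) (zclass p) = zclass (zcat p q).
Proof. by apply/zclass_eq; apply: zeq_cat; apply/zclass_eq/zreprK. Qed.

Fact loc_compA X Y Z T (h : loc_hom Z T) (g : loc_hom Y Z) (f : loc_hom X Y) :
  loc_comp h (loc_comp g f) = loc_comp (loc_comp h g) f.
Proof.
by rewrite -[h]zreprK -[g]zreprK -[f]zreprK !loc_compE zcatA.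
Qed.

Fact loc_comp1m X Y (f : loc_hom X Y) : loc_comp (zclass (ZNil Y)) f = f.
Proof. by rewrite -[f]zreprK loc_compE zcat0. Qed.

Fact loc_compm1 X Y (f : loc_hom X Y) : loc_comp f (zclass (ZNil X)) = f.
Proof. by rewrite -[f]zreprK loc_compE. Qed.

Definition localization : category :=
  @Category C loc_hom (fun X => zclass (ZNil X)) loc_comp
    loc_compA loc_comp1m loc_compm1.

Program Definition loc_functor : functor C localization :=
  @Functor C localization (fun X => X) (fun X Y f => zclass (ZFwd f (ZNil Y)))
    _ _.
Next Obligation. by apply/zclass_eq/ZId. Qed.
Next Obligation.
by rewrite /= loc_compE /=; apply/zclass_eq/ZSym/ZComp.
Qed.

Lemma loc_functor_inverts X Y (w : hom X Y) :
  W w -> isomorphism (fmap loc_functor w).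
Proof.
move=> Ww; exists (zclass (ZBwd Ww (ZNil X))); split; rewrite /= loc_compE /=.
  by apply/zclass_eq/ZFwdBwd.
by apply/zclass_eq/ZBwdFwd.
Qed.

End Localization.

Section SerreQuotient.
Context (C : category) (S : C -> Prop).

Definition serre_iso (X Y : C) (f : hom X Y) : Prop :=
  (exists K (i : hom K X), is_kernel i f /\ S K) /\
  (exists Q (p : hom Y Q), is_cokernel p f /\ S Q).

(* C/S is the localization of C at the morphisms with kernel and cokernel
   in S. *)
Definition serre_quotient : category := localization serre_iso.

Definition quotient_functor : functor C serre_quotient := loc_functor serre_iso.

Definition localizing : Prop :=
  serre_subcategory S /\ has_right_adjoint quotient_functor.

End SerreQuotient.

Section ConcreteCat.
Context (O : Type) (U : O -> Type).
Context (P : forall X Y : O, (U X -> U Y) -> Prop).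
Context (P1 : forall X, @P X X (fun x => x)).
Context (PM : forall X Y Z (f : U X -> U Y) (g : U Y -> U Z),
  P f -> P g -> @P X Z (fun x => g (f x))).

Definition concrete_cat : category.
Proof.
apply: (@Category O (fun X Y => {f : U X -> U Y | P f})
  (fun X => exist _ _ (P1 X))
  (fun X Y Z g f => exist _ _ (PM (svalP f) (svalP g)))).
- by move=> *; exact: eq_exist.
- by move=> X Y [f Pf]; exact: eq_exist.
- by move=> X Y [f Pf]; exact: eq_exist.
Defined.

End ConcreteCat.

(* Modules over a k-algebra carry their underlying k-vector space structure,
   since tensor products over k are needed for the coactions. *)
Record is_ract (k : fieldType) (A : algType k) (V : lmodType k)
    (act : V -> A -> V) : Prop := IsRact {
  ract_bilinear : bilinear_fun act;
  ractm1 : forall v, act v 1 = v;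
  ractA : forall v a b, act v (a * b) = act (act v a) b
}.

Record is_lact (k : fieldType) (A : algType k) (V : lmodType k)
    (act : A -> V -> V) : Prop := IsLact {
  lact_bilinear : bilinear_fun act;
  lact1m : forall v, act 1 v = v;
  lactA : forall v a b, act (a * b) v = act a (act b v)
}.

(* Coassociativity is written in V ⊗ (C ⊗ C), resp. C ⊗ (C ⊗ V). *)
Record is_rcoact (k : fieldType) (C : coalgebra k) (V : lmodType k)
    (rho : V -> tens V C) : Prop := IsRcoact {
  rcoact_linear : linear rho;
  rcoactA : forall v,
    \tsum_(v0, v1 <- rho v) \tsum_(w0, w1 <- rho v0) w0 ⊗ (w1 ⊗ v1)
    = \tsum_(v0, v1 <- rho v) v0 ⊗ comul v1;
  rcoact1 : forall v, \tsum_(v0, v1 <- rho v) (counit v1 *: v0) = v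
}.

Record is_lcoact (k : fieldType) (C : coalgebra k) (V : lmodType k)
    (lambda : V -> tens C V) : Prop := IsLcoact {
  lcoact_linear : linear lambda;
  lcoactA : forall v,
    \tsum_(v1, v0 <- lambda v) \tsum_(c, d <- comul v1) c ⊗ (d ⊗ v0)
    = \tsum_(v1, v0 <- lambda v) v1 ⊗ lambda v0;
  lcoact1 : forall v, \tsum_(v1, v0 <- lambda v) (counit v1 *: v0) = v
}.

Record rmodule (k : fieldType) (A : algType k) := Rmodule {
  rmod_sort :> lmodType k;
  ract : rmod_sort -> A -> rmod_sort;
  ractP : is_ract ract
}.

Record lmodule (k : fieldType) (A : algType k) := Lmodule {
  lmod_sort :> lmodType k;
  lact : A -> lmod_sort -> lmod_sort;
  lactP : is_lact lact
}.

Record rcomodule (k : fieldType) (C : coalgebra k) := Rcomodule {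
  rcomod_sort :> lmodType k;
  rcoact : rcomod_sort -> tens rcomod_sort C;
  rcoactP : is_rcoact rcoact
}.

Record lcomodule (k : fieldType) (C : coalgebra k) := Lcomodule {
  lcomod_sort :> lmodType k;
  lcoact : lcomod_sort -> tens C lcomod_sort;
  lcoactP : is_lcoact lcoact
}.

Section Morphisms.
Context (k : fieldType).

Definition ract_mor (A : algType k) (V W : lmodType k) (actV : V -> A -> V)
  (actW : W -> A -> W) (f : V -> W) : Prop :=
  forall v a, f (actV v a) = actW (f v) a.

Definition lact_mor (A : algType k) (V W : lmodType k) (actV : A -> V -> V)
  (actW : A -> W -> W) (f : V -> W) : Prop :=
  forall a v, f (actV a v) = actW a (f v).

Definition rcoact_mor (C V W : lmodType k) (rhoV : V -> tens V C)
  (rhoW : W -> tens W C) (f : V -> W) : Prop :=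
  forall v, rhoW (f v) = \tsum_(v0, v1 <- rhoV v) f v0 ⊗ v1.

Definition lcoact_mor (C V W : lmodType k) (lamV : V -> tens C V)
  (lamW : W -> tens C W) (f : V -> W) : Prop :=
  forall v, lamW (f v) = \tsum_(v1, v0 <- lamV v) v1 ⊗ f v0.

Lemma rcoact_mor_id (C V : lmodType k) (rho : V -> tens V C) :
  rcoact_mor rho rho (fun v => v).
Proof. by move=> v; rewrite tlift_id. Qed.

Lemma lcoact_mor_id (C V : lmodType k) (lam : V -> tens C V) :
  lcoact_mor lam lam (fun v => v).
Proof. by move=> v; rewrite tlift_id. Qed.

Lemma rcoact_mor_comp (C U V W : lmodType k) (rhoU : U -> tens U C)
    (rhoV : V -> tens V C) (rhoW : W -> tens W C) (f : U -> V) (g : V -> W) :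
  linear g -> rcoact_mor rhoU rhoV f -> rcoact_mor rhoV rhoW g ->
  rcoact_mor rhoU rhoW (fun u => g (f u)).
Proof.
move=> lg ff fg u; have b := tens2_bilinear lg (@linear_idfun k C).
rewrite fg ff linear_tlift; last exact: tlift_linear b.
by apply: eq_tlift => v0 v1; rewrite (tliftE _ _ b).
Qed.

Lemma lcoact_mor_comp (C U V W : lmodType k) (lamU : U -> tens C U)
    (lamV : V -> tens C V) (lamW : W -> tens C W) (f : U -> V) (g : V -> W) :
  linear g -> lcoact_mor lamU lamV f -> lcoact_mor lamV lamW g ->
  lcoact_mor lamU lamW (fun u => g (f u)).
Proof.
move=> lg ff fg u; have b := tens2_bilinear (@linear_idfun k C) lg.
rewrite fg ff linear_tlift; last exact: tlift_linear b.
by apply: eq_tlift => v1 v0; rewrite (tliftE _ _ b).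
Qed.

End Morphisms.

Definition Mod_r (k : fieldType) (A : algType k) : category.
Proof.
apply: (@concrete_cat (rmodule A) (fun M => M : Type)
  (fun M N f => linear f /\ ract_mor (@ract _ _ M) (@ract _ _ N) f)).
- by move=> M; split.
- move=> L M N f g [lf af] [lg ag]; split; first exact: linear_comp.
  by move=> v a; rewrite af ag.
Defined.

Definition Mod_l (k : fieldType) (A : algType k) : category.
Proof.
apply: (@concrete_cat (lmodule A) (fun M => M : Type)
  (fun M N f => linear f /\ lact_mor (@lact _ _ M) (@lact _ _ N) f)).
- by move=> M; split.
- move=> L M N f g [lf af] [lg ag]; split; first exact: linear_comp.
  by move=> a v; rewrite af ag.
Defined.

Definition Comod_r (k : fieldType) (C : coalgebra k) : category.
Proof.
apply: (@concrete_cat (rcomodule C) (fun M => M : Type)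
  (fun M N f => linear f /\ rcoact_mor (@rcoact _ _ M) (@rcoact _ _ N) f)).
- by move=> M; split; last exact: rcoact_mor_id.
- move=> L M N f g [lf af] [lg ag]; split; first exact: linear_comp.
  exact: rcoact_mor_comp af ag.
Defined.

Definition Comod_l (k : fieldType) (C : coalgebra k) : category.
Proof.
apply: (@concrete_cat (lcomodule C) (fun M => M : Type)
  (fun M N f => linear f /\ lcoact_mor (@lcoact _ _ M) (@lcoact _ _ N) f)).
- by move=> M; split; last exact: lcoact_mor_id.
- move=> L M N f g [lf af] [lg ag]; split; first exact: linear_comp.
  exact: lcoact_mor_comp af ag.
Defined.

(* Notation of relative Hopf modules: [HopfMod_r] is M_A^H, [HopfMod_l] is
   _A M^H, [HMod_Comod_r] is _H M^C and [HMod_Comod_l] is ^C_H M; [T_r],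
   [T_r_H], [T_l], [T_l_H] are T_A, T_A^H, _A T, _A T^H. *)
Section HopfModules.
Context (k : fieldType) (H : hopf k) (A : rcoideal_subalg H).
Local Notation C := (HA_coalg A).

Record rhopfmod := Rhopfmod {
  rhm_mod :> rmodule A;
  rhm_coact : rhm_mod -> tens rhm_mod (hopf_coalg H);
  rhm_coactP : is_rcoact rhm_coact;
  rhm_compat : forall (m : rhm_mod) (a : A), rhm_coact (ract m a) =
    \tsum_(m0, m1 <- rhm_coact m) \tsum_(a1, a2 <- rcomul a)
      ract m0 a1 ⊗ ((m1 : H) * a2)
}.

Record lhopfmod := Lhopfmod {
  lhm_mod :> lmodule A;
  lhm_coact : lhm_mod -> tens lhm_mod (hopf_coalg H);
  lhm_coactP : is_rcoact lhm_coact;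
  lhm_compat : forall (a : A) (m : lhm_mod), lhm_coact (lact a m) =
    \tsum_(a1, a2 <- rcomul a) \tsum_(m0, m1 <- lhm_coact m)
      lact a1 m0 ⊗ (a2 * (m1 : H))
}.

Record hmod_rcomod := HmodRcomod {
  hrc_mod :> lmodule H;
  hrc_coact : hrc_mod -> tens hrc_mod C;
  hrc_coactP : is_rcoact hrc_coact;
  hrc_compat : forall (h : H) (m : hrc_mod), hrc_coact (lact h m) =
    \tsum_(h1, h2 <- hcomul h) \tsum_(m0, m1 <- hrc_coact m)
      lact h1 m0 ⊗ qact h2 m1
}.

Record hmod_lcomod := HmodLcomod {
  hlc_mod :> lmodule H;
  hlc_coact : hlc_mod -> tens C hlc_mod;
  hlc_coactP : is_lcoact hlc_coact;
  hlc_compat : forall (h : H) (m : hlc_mod), hlc_coact (lact h m) =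
    \tsum_(h1, h2 <- hcomul h) \tsum_(m1, m0 <- hlc_coact m)
      qact h1 m1 ⊗ lact h2 m0
}.

Definition HopfMod_r : category.
Proof.
apply: (@concrete_cat rhopfmod (fun M => M : Type)
  (fun M N f => [/\ linear f, ract_mor (@ract _ _ M) (@ract _ _ N) f &
     rcoact_mor (@rhm_coact M) (@rhm_coact N) f])).
- by move=> M; split; last exact: rcoact_mor_id.
- move=> L M N f g [lf af cf] [lg ag cg]; split; first exact: linear_comp.
  + by move=> v a; rewrite af ag.
  + exact: rcoact_mor_comp cf cg.
Defined.

Definition HopfMod_l : category.
Proof.
apply: (@concrete_cat lhopfmod (fun M => M : Type)
  (fun M N f => [/\ linear f, lact_mor (@lact _ _ M) (@lact _ _ N) f &
     rcoact_mor (@lhm_coact M) (@lhm_coact N) f])).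
- by move=> M; split; last exact: rcoact_mor_id.
- move=> L M N f g [lf af cf] [lg ag cg]; split; first exact: linear_comp.
  + by move=> a v; rewrite af ag.
  + exact: rcoact_mor_comp cf cg.
Defined.

Definition HMod_Comod_r : category.
Proof.
apply: (@concrete_cat hmod_rcomod (fun M => M : Type)
  (fun M N f => [/\ linear f, lact_mor (@lact _ _ M) (@lact _ _ N) f &
     rcoact_mor (@hrc_coact M) (@hrc_coact N) f])).
- by move=> M; split; last exact: rcoact_mor_id.
- move=> L M N f g [lf af cf] [lg ag cg]; split; first exact: linear_comp.
  + by move=> a v; rewrite af ag.
  + exact: rcoact_mor_comp cf cg.
Defined.

Definition HMod_Comod_l : category.
Proof.
apply: (@concrete_cat hmod_lcomod (fun M => M : Type)
  (fun M N f => [/\ linear f, lact_mor (@lact _ _ M) (@lact _ _ N) f &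
     lcoact_mor (@hlc_coact M) (@hlc_coact N) f])).
- by move=> M; split; last exact: lcoact_mor_id.
- move=> L M N f g [lf af cf] [lg ag cg]; split; first exact: linear_comp.
  + by move=> a v; rewrite af ag.
  + exact: lcoact_mor_comp cf cg.
Defined.

Definition right_ideal (I : set A) : Prop :=
  [/\ I 0, forall x y, I x -> I y -> I (x + y) &
      forall x a, I x -> I (x * a)].

Definition left_ideal (I : set A) : Prop :=
  [/\ I 0, forall x y, I x -> I y -> I (x + y) &
      forall x a, I x -> I (a * x)].

(* Delta(I) is contained in I ⊗ H, viewed inside H ⊗ H. *)
Definition costable (I : set A) : Prop :=
  forall x : A, I x ->
    hcomul (val x) \in
      span [set t : tens H H | exists (i : A) (h : H),
                                 I i /\ t = (val i : H) ⊗ h].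

Definition nonzero_set (I : set A) : Prop := exists x, I x /\ x != 0.

Definition torsion_r (M : rmodule A) : Prop :=
  forall m : M, exists I : set A,
    [/\ right_ideal I, costable I, nonzero_set I &
        forall x, I x -> ract m x = 0].

Definition torsion_l (M : lmodule A) : Prop :=
  forall m : M, exists I : set A,
    [/\ left_ideal I, costable I, nonzero_set I &
        forall x, I x -> lact x m = 0].

Definition T_r : Mod_r A -> Prop := fun M => torsion_r M.
Definition T_r_H : HopfMod_r -> Prop := fun M => torsion_r (rhm_mod M).
Definition T_l : Mod_l A -> Prop := fun M => torsion_l M.
Definition T_l_H : HopfMod_l -> Prop := fun M => torsion_l (lhm_mod M).

End HopfModules.

Section Flat.
Context (k : fieldType) (A : algType k).

Inductive tensA_rel (M : rmodule A) (N : lmodule A) : set (tens M N) :=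
  TensA (m : M) (a : A) (n : N) : tensA_rel (ract m a ⊗ n - m ⊗ lact a n).

Definition tensA (M : rmodule A) (N : lmodule A) : lmodType k :=
  modquot (@tensA_rel M N).

Definition tensA_mapl (M M' : rmodule A) (N : lmodule A) (f : M -> M')
    (t : tensA M N) : tensA M' N :=
  qproj _ (\tsum_(m, n <- qrepr t) f m ⊗ n).

Definition tensA_mapr (M : rmodule A) (N N' : lmodule A) (f : N -> N')
    (t : tensA M N) : tensA M N' :=
  qproj _ (\tsum_(m, n <- qrepr t) m ⊗ f n).

Lemma tensA_maplE M M' (N : lmodule A) (f : @hom (Mod_r A) M M') t :
  tensA_mapl (N := N) (sval f) (qproj _ t)
  = qproj _ (\tsum_(m, n <- t) sval f m ⊗ n).
Proof.
case: f => f [/= lf af]; rewrite /tensA_mapl.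
have b := tens2_bilinear lf (@linear_idfun k N).
have lF := tlift_linear b; set F := tlift _ in lF *.
apply/qproj_eq; rewrite -(linear_funB lF).
have: qrepr (qproj (@tensA_rel M N) t) - t \in span (@tensA_rel M N).
  by apply/qproj_eq; rewrite qreprK.
move: (_ - t) => y; apply: (span_ind (P := fun y => F y \in span _)).
  by rewrite (linear_fun0 lF) rpred0.
move=> c u v Iu Fv; rewrite lF rpredD // rpredZ // mem_span //.
case: u / Iu => m a n.
by rewrite (linear_funB lF) /F !(tliftE _ _ b) af; exact: TensA.
Qed.

Lemma tensA_maprE (M : rmodule A) N N' (f : @hom (Mod_l A) N N') t :
  tensA_mapr (M := M) (sval f) (qproj _ t)
  = qproj _ (\tsum_(m, n <- t) m ⊗ sval f n).
Proof.
case: f => f [/= lf af]; rewrite /tensA_mapr.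
have b := tens2_bilinear (@linear_idfun k M) lf.
have lF := tlift_linear b; set F := tlift _ in lF *.
apply/qproj_eq; rewrite -(linear_funB lF).
have: qrepr (qproj (@tensA_rel M N) t) - t \in span (@tensA_rel M N).
  by apply/qproj_eq; rewrite qreprK.
move: (_ - t) => y; apply: (span_ind (P := fun y => F y \in span _)).
  by rewrite (linear_fun0 lF) rpred0.
move=> c u v Iu Fv; rewrite lF rpredD // rpredZ // mem_span //.
case: u / Iu => m a n.
by rewrite (linear_funB lF) /F !(tliftE _ _ b) af; exact: TensA.
Qed.

Definition flat_l (N : lmodule A) : Prop :=
  forall (M M' : rmodule A) (f : @hom (Mod_r A) M M'),
    injective (sval f) -> injective (tensA_mapl (N := N) (sval f)).

Definition flat_r (M : rmodule A) : Prop :=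
  forall (N N' : lmodule A) (f : @hom (Mod_l A) N N'),
    injective (sval f) -> injective (tensA_mapr (M := M) (sval f)).

End Flat.

Section FlatOver.
Context (k : fieldType) (H : hopf k) (A : rcoideal_subalg H).

Fact left_regularP : is_lact (fun (a : A) (h : H) => val a * h).
Proof.
split=> [|h|h a b].
- split=> [h|a] c x y; last exact: linear_mull.
  by rewrite linearP mulrDl scalerAl.
- by rewrite (rmorph1 (val : A -> H)) mul1r.
- by rewrite (rmorphM (val : A -> H)) mulrA.
Qed.

Fact right_regularP : is_ract (fun (h : H) (a : A) => h * val a).
Proof.
split=> [|h|h a b].
- split=> [a|h] c x y; first exact: linear_mulr.
  by rewrite linearP mulrDr scalerAr.
- by rewrite (rmorph1 (val : A -> H)) mulr1.
- by rewrite (rmorphM (val : A -> H)) mulrA.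
Qed.

Definition left_flat_over : Prop := flat_l (Lmodule left_regularP).
Definition right_flat_over : Prop := flat_r (Rmodule right_regularP).

End FlatOver.

(* Main.v *)
From Pilot Require Import Defs.
From HB Require Import structures.
From mathcomp Require Import all_boot all_algebra ring_quotient.
From mathcomp Require Import boolp classical_sets freeg.
Import Pilot.Defs.

(** Put C = H/HA^+.  For M in M_A^H the map m |-> m_0 ⊗ S(m_1) embeds M/MA^+ in
    M ⊗_A H, so flatness makes M |-> M/MA^+ exact from M_A^H to M^C.  Its right
    adjoint sends V to the cotensor product V □ H, the kernel of a morphism
    V ⊗ H -> (V ⊗ C) ⊗ H of Hopf modules; applying the exact functor to this
    kernel shows that the counit is invertible.

    The functor M_A -> _H M^C, M |-> M ⊗_A H, is realized as
    M |-> (M ⊗ H)/(M ⊗ H)A^+ with the diagonal action of A, hence is exact too.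
    Its right adjoint sends W to the coinvariants {w | rho w = w ⊗ pi(1)}, on
    which A acts through S^-1; its counit is invertible because
    W □ H = W^{co C} ⊗ H by the fundamental theorem of Hopf modules.

    An exact functor with a right adjoint and invertible counit is the quotient
    by its kernel.  The kernels are the torsion classes: a nonzero costable ideal
    J contains some j with eps(j) = 1, so mJ = 0 gives m = m(1 - j) in MA^+;
    conversely the kernel of A -> M ⊗ H, a |-> m a_1 ⊗ a_2, is costable, kills m,
    and is nonzero, as otherwise exactness would put 1 in A^+.

    The left-handed half is the right-handed one for H^op, whose antipode is
    S^-1; the coalgebras of A^op and A are anti-isomorphic through S^-1. *)

Set Implicit Arguments.
Unset Strict Implicit.
Unset Printing Implicit Defensive.

Import GRing.Theory.
Local Open Scope classical_set_scope.
Local Open Scope ring_scope.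

(** * Tensor products over a field *)

(** Flatness enters only through [aug_exact]: for a monomorphism g : M -> N of Hopf modules, g m in
    NA^+ forces m in MA^+. Right exactness of M |-> M/MA^+ is automatic. Both functors of the
    right-handed half pass through this quotient, the second one after the exact functor M |-> M ⊗
    H, so that a single localization argument serves both; this is the reason for replacing M ⊗_A H.
    The quotient categories are built from zigzags. They are controlled by the unit of the
    adjunction: it belongs to the inverted class because the counit is invertible, and composing
    with it turns every zigzag into an honest morphism. Bijectivity of the antipode provides the
    twisted action on coinvariants, the opposite Hopf algebra, and the fact that for a Hopf module M
    the A-linear images of M span M ⊗ H. Since [tlift] reads off a chosen representative, most
    Sweedler computations carry bilinearity side conditions, which [lin] discharges. Exactness of
    the tensor product over k is obtained from generalized inverses of linear maps. *)

Section TensorCalculus.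
Context (k : fieldType).
Implicit Types (U V W : lmodType k).

Lemma linear_zero V W : linear (fun _ : V => 0 : W).
Proof. by move=> a u v; rewrite scaler0 addr0. Qed.

Lemma linear_add V W (f g : V -> W) :
  linear f -> linear g -> linear (fun v => f v + g v).
Proof. by move=> lf lg a u v; rewrite lf lg scalerDr addrACA. Qed.

Lemma linear_scaled V W (f : V -> W) a : linear f -> linear (fun v => a *: f v).
Proof. by move=> lf b u v; rewrite lf scalerDr !scalerA mulrC. Qed.

Lemma linear_opp V W (f : V -> W) : linear f -> linear (fun v => - f v).
Proof. by move=> lf b u v; rewrite lf opprD scalerN. Qed.

Lemma linear_scalar V W (c : V -> k) (w : W) :
  scalar c -> linear (fun v => c v *: w).
Proof. by move=> lc b u v; rewrite lc scalerDl scalerA. Qed.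

Lemma linear_tpurel V W U (f : V -> W) (u : U) :
  linear f -> linear (fun v => f v ⊗ u).
Proof. move=> lf; exact: linear_comp lf ((tpure_bilinear _ _).1 u). Qed.

Lemma linear_tpurer V W U (f : V -> W) (u : U) :
  linear f -> linear (fun v => u ⊗ f v).
Proof. move=> lf; exact: linear_comp lf ((tpure_bilinear _ _).2 u). Qed.

Lemma linear_tlift_comp U V W V' (F : V -> W -> U) (e : V' -> tens V W) :
  linear e -> bilinear_fun F -> linear (fun x => tlift F (e x)).
Proof. move=> le bF; exact: linear_comp le (tlift_linear bF). Qed.

Lemma linear_mull_comp V (A : algType k) (f : V -> A) (a : A) :
  linear f -> linear (fun v => a * f v).
Proof. by move=> lf b u v; rewrite lf mulrDr scalerAr. Qed.

Lemma linear_mulr_comp V (A : algType k) (f : V -> A) (a : A) :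
  linear f -> linear (fun v => f v * a).
Proof. by move=> lf b u v; rewrite lf mulrDl scalerAl. Qed.

End TensorCalculus.

(* [lin] proves [linear (fun x => E)] and [bilinear_fun f] by recursion on E;
   [lin_hook] is to be extended with the linearity of new operations. *)
Ltac lin_hook := fail.
Ltac lin_base :=
  first [ exact: linear_idfun | assumption | lin_hook | exact: linearP
        | match goal with
          | b : bilinear_fun _ |- _ => first [exact: b.1 | exact: b.2]
          | b : forall _, bilinear_fun _ |- _ =>
              first [exact: (b _).1 | exact: (b _).2]
          | h : forall _, GRing.linear_for _ _ |- _ => exact: h
          | h : forall _ _, GRing.linear_for _ _ |- _ => exact: h
          end ].
Ltac lin :=
  lazymatch goal with
  | |- bilinear_fun _ =>
    first [ assumption
          | split; let w := fresh "w" in intro w; cbv beta; lin ]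
  | |- GRing.linear_for _ ?f =>
    first
      [ exact: linear_idfun
      | match f with
        | ?h \o ?g => refine (linear_comp (f := g) (g := h) _ _); lin
        | tlift ?F => refine (@tlift_linear _ _ _ _ F _); lin
        | tpure ?w => exact: (tpure_bilinear _ _).2
        | fun x => 0 => exact: linear_zero
        | fun x => - (@?e x) => refine (linear_opp _); lin
        | fun x => (@?e x) + (@?g x) => refine (linear_add _ _); lin
        | fun x => ?a *: (@?e x) => refine (linear_scaled (f := e) a _); lin
        | fun x => (?c (@?e x)) *: ?w =>
          refine (linear_comp (f := e) (g := fun y => c y *: w) _
                    (linear_scalar w _)); [lin | lin_base]
        | fun x => ?a * (@?e x) => refine (linear_mull_comp (f := e) a _); lin
        | fun x => (@?e x) * ?a => refine (linear_mulr_comp (f := e) a _); lin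
        | fun x => (@?e x) ⊗ ?w => refine (linear_tpurel (f := e) w _); lin
        | fun x => ?w ⊗ (@?e x) => refine (linear_tpurer (f := e) w _); lin
        | fun x => tlift ?F (@?e x) =>
          refine (linear_tlift_comp (e := e) (F := F) _ _); lin
        | fun x => tlift (@?G x) ?t =>
          refine (tlift_linear_arg (f := fun a b x => G x a b) t _);
          let a := fresh "a" in let b := fresh "b" in intros a b; cbv beta; lin
        | fun x => ?g (@?e x) ?w =>
          lazymatch e with
          | fun y => y => fail
          | _ => refine (linear_comp (f := e) (g := fun y => g y w) _ _);
                 [lin | lin_base]
          end
        | fun x => ?g (@?e x) =>
          lazymatch e with
          | fun y => y => fail
          | _ => refine (linear_comp (f := e) (g := g) _ _); [lin | lin_base]
          end
        end
      | lin_base ]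
  end.

Section TensorCalculus2.
Context (k : fieldType).
Implicit Types (U V W : lmodType k).

Lemma tens_ext V W U (f g : tens V W -> U) : linear f -> linear g ->
  (forall v w, f (v ⊗ w) = g (v ⊗ w)) -> forall t, f t = g t.
Proof.
move=> lf lg fg t; rewrite (tlift_pure t lf) (tlift_pure t lg).
exact: eq_tlift.
Qed.

(** Scalars are absorbed into the left factor, so a tensor is a plain sum of pure tensors and the
    induction step has no coefficient. *)
Lemma tens_ind V W (P : tens V W -> Prop) : P 0 ->
  (forall v w t, P t -> P (v ⊗ w + t)) -> forall t, P t.
Proof.
move=> P0 PD t; rewrite -(tlift_id t) /tlift; move: (qrepr t) => x.
rewrite -[x]freeg_repr fglift_Freeg /prelift.
elim: {x}(repr x : seq _) => [|[a [v w]] s IH]; first by rewrite big_nil.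
rewrite big_cons /=; have -> : a *: (v ⊗ w) = (a *: v) ⊗ w.
  by rewrite (linear_funZ _ _ ((tpure_bilinear _ _).1 w)).
exact: PD.
Qed.

Lemma tlift_tlift V W V' W' U (F : V -> W -> U) (G : V' -> W' -> tens V W) t :
  bilinear_fun F ->
  tlift F (tlift G t) = \tsum_(x, y <- t) tlift F (G x y).
Proof. by move=> bF; rewrite linear_tlift //; exact: tlift_linear. Qed.

(** Both sides are finite double sums over the same two chosen representatives, so the exchange
    holds for arbitrary F, without multilinearity. *)
Lemma tlift_swap V W V' W' U (F : V -> W -> V' -> W' -> U) s t :
  \tsum_(x, y <- s) \tsum_(z, w <- t) F x y z w
  = \tsum_(z, w <- t) \tsum_(x, y <- s) F x y z w.
Proof.
rewrite /tlift; move: (qrepr s) (qrepr t) => {}s {}t.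
rewrite -[s]freeg_repr -[t]freeg_repr !fglift_Freeg /prelift.
under eq_bigr do rewrite fglift_Freeg /prelift scaler_sumr.
rewrite exchange_big; apply: eq_bigr => p _ /=.
rewrite fglift_Freeg /prelift scaler_sumr; apply: eq_bigr => q _ /=.
by rewrite !scalerA mulrC.
Qed.

Lemma tliftZ V W U (c : k) (F : V -> W -> U) t :
  \tsum_(x, y <- t) (c *: F x y) = c *: tlift F t.
Proof. by rewrite (linear_tlift _ _ (linear_scaled c (@linear_idfun k U))). Qed.

Lemma tliftD V W U (F G : V -> W -> U) t :
  \tsum_(x, y <- t) (F x y + G x y) = tlift F t + tlift G t.
Proof.
rewrite /tlift; move: (qrepr t) => {}t.
rewrite -[t]freeg_repr !fglift_Freeg /prelift -big_split /=.
by apply: eq_bigr => p _; rewrite scalerDr.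
Qed.

Definition tmap V W V' W' (f : V -> V') (g : W -> W') (t : tens V W) :
  tens V' W' := \tsum_(v, w <- t) f v ⊗ g w.

Lemma tmap_linear V W V' W' (f : V -> V') (g : W -> W') :
  linear f -> linear g -> linear (tmap f g).
Proof. move=> lf lg; rewrite /tmap; lin. Qed.

Lemma tmapE V W V' W' (f : V -> V') (g : W -> W') v w :
  linear f -> linear g -> tmap f g (v ⊗ w) = f v ⊗ g w.
Proof. by move=> lf lg; rewrite /tmap tliftE //; lin. Qed.

Lemma tmap_comp V W V' W' V2 W2 (f : V -> V') (g : W -> W')
    (f' : V' -> V2) (g' : W' -> W2) t :
  linear f' -> linear g' ->
  tmap f' g' (tmap f g t) = tmap (f' \o f) (g' \o g) t.
Proof.
move=> lf lg; rewrite /tmap tlift_tlift; last by lin.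
by apply: eq_tlift => v w; rewrite tliftE //; lin.
Qed.

Lemma tmap_id V W (f : V -> V) (g : W -> W) t :
  (forall v, f v = v) -> (forall w, g w = w) -> tmap f g t = t.
Proof.
by move=> f1 g1; rewrite -[RHS]tlift_id; apply: eq_tlift => v w; rewrite f1 g1.
Qed.

Lemma tlift_tmap V W V' W' U (f : V -> V') (g : W -> W') (F : V' -> W' -> U) t :
  bilinear_fun F -> tlift F (tmap f g t) = \tsum_(v, w <- t) F (f v) (g w).
Proof.
by move=> bF; rewrite tlift_tlift //; apply: eq_tlift => v w; rewrite tliftE.
Qed.

End TensorCalculus2.

(** * Complements, generalized inverses and exactness of the tensor product *)

Section Splitting.
Context (k : fieldType).
Implicit Types (U V W : lmodType k).

(* A maximal subspace meeting N trivially is a complement of N. *)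
Lemma exists_complement V (N : set V) : submod_closed (fun v => `[< N v >]) ->
  exists M : set V, [/\ submod_closed (fun v => `[< M v >]),
    forall v, N v -> M v -> v = 0 &
    forall v, exists n, N n /\ M (v - n)].
Proof.
move=> [N0 NP].
have {}N0 : N 0 by apply/asboolP.
have {}NP a u v : N u -> N v -> N (a *: u + v).
  by move=> Nu Nv; apply/asboolP/NP; exact/asboolP.
(* Membership of 0 is not demanded, so that the empty union of the empty chain satisfies P; it is
   recovered from maximality. *)
pose P (M : set V) := (forall v, N v -> M v -> v = 0) /\
  (forall a u v, M u -> M v -> M (a *: u + v)).
have [F PF totF|M [[M1 M2] Mmax]] := @Zorn_bigcup V P.
  split=> [v Nv [X FX Xv]|a u v [X FX Xu] [Y FY Yv]].
    exact: (PF _ FX).1 Xv.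
  have [XY|YX] := totF _ _ FX FY.
    by exists Y => //; apply: (PF _ FY).2 => //; exact: XY.
  by exists X => //; apply: (PF _ FX).2 => //; exact: YX.
have M0 : M 0.
  apply: contrapT => nM0.
  apply: (Mmax (M `|` [set 0])).
    split=> [|sub]; first by move=> x; left.
    by apply: nM0; apply: sub; right.
  have E u : (M `|` [set 0]) u -> M u \/ u = 0 by [].
  split=> [v Nv /E[Mv|//]|a u v /E[Mu|->] /E[Mv|->]]; first exact: M1.
  - by left; exact: M2.
  (* Here a *: u is obtained as (a - 1) *: u + u, since M is not yet known to contain 0. *)
  - left; rewrite addr0 -[u]scale1r; have := M2 (a - 1) u u Mu Mu.
    by rewrite scalerBl scale1r subrK.
  - by left; rewrite scaler0 add0r.
  - by right; rewrite scaler0 addr0.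
exists M; split=> //.
  by split=> [|a u v /asboolP Mu /asboolP Mv]; apply/asboolP => //; exact: M2.
move=> v; apply: contrapT => nv.
(* The subspace spanned by M and v. If a v + m lies in N with a nonzero, then dividing by a
   decomposes v, against the choice of v. *)
pose M' : set V := fun x => exists a m, M m /\ x = a *: v + m.
apply: (Mmax M').
  split=> [m Mm|sub]; first by exists 0, m; rewrite scale0r add0r.
  apply: nv; exists 0; split=> //; rewrite subr0; apply: sub.
  by exists 1, 0; rewrite scale1r addr0.
split=> [x Nx [a [m [Mm xE]]]|b _ _ [a [m [Mm ->]]] [a' [m' [Mm' ->]]]].
  have [a0|a0] := eqVneq a 0.
    by apply: M1 => //; rewrite xE a0 scale0r add0r.
  case: nv; exists (a^-1 *: x); split.
    by have := NP a^-1 x 0 Nx N0; rewrite addr0.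
  rewrite xE scalerDr scalerA mulVf // scale1r opprD addrA subrr add0r.
  by have := M2 (- a^-1) m 0 Mm M0; rewrite addr0 scaleNr.
exists (b * a + a'), (b *: m + m'); split; first exact: M2.
by rewrite scalerDr scalerA addrACA -scalerDl.
Qed.

Lemma exists_projection V (N : set V) : submod_closed (fun v => `[< N v >]) ->
  exists p : V -> V, [/\ linear p, forall v, N (p v) &
    forall v, N v -> p v = v].
Proof.
move=> Nsub; have [M [[M0 MP] NM0 /choice[p pP]]] := exists_complement Nsub.
have [{}N0 NP] := Nsub.
have {}M0 : M 0 by apply/asboolP.
have {}MP a u v : M u -> M v -> M (a *: u + v).
  by move=> Mu Mv; apply/asboolP/MP; exact/asboolP.
have {}NP a u v : N u -> N v -> N (a *: u + v).
  by move=> Nu Nv; apply/asboolP/NP; exact/asboolP.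
(* Uniqueness of the N-component is what makes the chosen function p linear. *)
have uniq v n : N n -> M (v - n) -> p v = n.
  move=> Nn Mn; have [Np Mp] := pP v; apply/eqP; rewrite -subr_eq0; apply/eqP.
  apply: NM0; first by have := NP (-1) _ _ Nn Np; rewrite scaleN1r addrC.
  have := MP (-1) _ _ Mp Mn; rewrite scaleN1r opprB.
  by rewrite addrC -addrA [- n + _]addrC addrA [v + _]addrC subrK.
exists p; split=> [a u v|v|v Nv]; last 2 first.
- exact: (pP v).1.
- by apply: uniq => //; rewrite subrr.
have [Nu Mu] := pP u; have [Nv Mv] := pP v.
apply: uniq; first exact: NP.
by rewrite opprD addrACA -scalerBr; exact: MP.
Qed.

(* Generalized inverse: it makes all exactness properties of the tensor
   product over a field equational. *)
Lemma exists_pinv V W (f : V -> W) : linear f ->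
  exists s : W -> V, linear s /\ forall v, f (s (f v)) = f v.
Proof.
move=> lf.
have [|p [lp pN pid]] := @exists_projection W (fun w => exists v, f v = w).
  split=> [|a u v /asboolP[x <-] /asboolP[y <-]]; apply/asboolP.
    by exists 0; rewrite (linear_fun0 lf).
  by exists (a *: x + y); rewrite lf.
have [|q [lq qN qid]] := @exists_projection V (fun v => f v = 0).
  split=> [|a u v /asboolP fu /asboolP fv]; apply/asboolP.
    by rewrite (linear_fun0 lf).
  by rewrite lf fu fv scaler0 addr0.
have [r rP] := choice pN.
(* Subtracting the component in the kernel of f makes the value depend only on f (r w) = p w; this
   removes the arbitrariness of the choice r and gives linearity. *)
exists (fun w => r w - q (r w)); split=> [a u v|v]; last first.
  by rewrite (linear_funB lf) qN subr0 rP pid //; exists v.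
have E x y : f x = f y -> x - q x = y - q y.
  move=> fxy; have : q (x - y) = x - y.
    by apply: qid; rewrite (linear_funB lf) fxy subrr.
  rewrite (linear_funB lq) => h; apply/eqP.
  by rewrite -subr_eq0 opprD addrACA -opprD -h subrr.
rewrite (E _ (a *: r u + r v)); last by rewrite lf !rP lp.
by rewrite lq opprD addrACA -scalerBr.
Qed.

(** The generalized inverse of an injective map is a retraction, and retractions survive
    tensoring. *)
Lemma tmap_inj V V' W (f : V -> V') : linear f -> injective f ->
  injective (@tmap k V W V' W f (fun w => w)).
Proof.
move=> lf fI; have [s [ls sP]] := exists_pinv lf.
apply: (can_inj (g := tmap s (fun w => w))) => t.
by rewrite tmap_comp //; apply: tmap_id => //= v; apply: fI.
Qed.

Lemma tmap_injr V W W' (f : W -> W') : linear f -> injective f ->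
  injective (@tmap k V W V W' (fun v => v) f).
Proof.
move=> lf fI; have [s [ls sP]] := exists_pinv lf.
apply: (can_inj (g := tmap (fun v => v) s)) => t.
by rewrite tmap_comp //; apply: tmap_id => //= v; apply: fI.
Qed.

Lemma tmap_surj V V' W (f : V -> V') : linear f ->
  (forall v, exists u, f u = v) ->
  forall t, exists s, @tmap k V W V' W f (fun w => w) s = t.
Proof.
move=> lf fS t; have [s [ls sP]] := exists_pinv lf.
exists (tmap s (fun w => w) t); rewrite tmap_comp //; apply: tmap_id => //= v.
by have [u <-] := fS v.
Qed.

(** With s and r generalized inverses of f and e, the map c = 1 - s f projects onto the kernel of f,
    and e r is the identity there. Since c ⊗ 1 fixes t, the image of t under r c ⊗ 1 is a
    preimage. *)
Lemma tmap_exact V V' V2 W (e : V -> V') (f : V' -> V2) :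
  linear e -> linear f -> (forall v', f v' = 0 -> exists v, e v = v') ->
  forall t, @tmap k V' W V2 W f (fun w => w) t = 0 ->
  exists s, @tmap k V W V' W e (fun w => w) s = t.
Proof.
move=> le lf ex t ft0; have [s [ls sP]] := exists_pinv lf.
have [r [lr rP]] := exists_pinv le.
pose id := fun w : W => w; pose c v := v - s (f v).
have lc : linear c by rewrite /c; lin.
exists (tmap r id (tmap c id t)); rewrite !tmap_comp //; last by lin.
have -> : tmap (e \o (r \o c)) (id \o (id \o id)) t = tmap c id t.
  apply: eq_tlift => v w /=; congr (_ ⊗ _).
  have [|u eu] := ex (c v); first by rewrite /c (linear_funB lf) sP subrr.
  by rewrite -eu rP.
rewrite -[RHS]subr0.
have -> : 0 = tmap s id (tmap f id t) :> tens V' W.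
  by rewrite ft0 (linear_fun0 (tmap_linear _ _)).
rewrite tmap_comp //.
have L : linear (fun t : tens V' W => tmap c id t - (t - tmap (s \o f) id t)).
  rewrite /tmap /=; lin.
apply/eqP; rewrite -subr_eq0; apply/eqP.
apply: (tens_ext L (@linear_zero k _ _)) => v w.
rewrite !tmapE //=; try by lin.
rewrite /c (linear_funB ((tpure_bilinear _ _).1 w)) subrr //.
Qed.

Definition tswap V W (t : tens V W) : tens W V := \tsum_(v, w <- t) w ⊗ v.

Lemma tswap_linear V W : linear (@tswap V W).
Proof. by rewrite /tswap; lin. Qed.

Lemma tswapE V W (v : V) (w : W) : tswap (v ⊗ w) = w ⊗ v.
Proof. by rewrite /tswap tliftE //; lin. Qed.

Lemma tswapK V W : cancel (@tswap V W) (@tswap W V).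
Proof.
have lVW := @tswap_linear V W; have lWV := @tswap_linear W V.
by apply: tens_ext => [||v w]; [lin | lin | rewrite !tswapE].
Qed.

Lemma tmap_swap V W V' W' (f : V -> V') (g : W -> W') t :
  linear f -> linear g -> tmap g f (tswap t) = tswap (tmap f g t).
Proof.
move=> lf lg; have l1 := @tswap_linear V W; have l2 := @tswap_linear V' W'.
have l3 := tmap_linear lf lg; have l4 := tmap_linear lg lf.
move: t; apply: tens_ext => [||v w]; [lin | lin |].
by rewrite tswapE !tmapE // tswapE.
Qed.

Lemma tmap_surjr V W W' (f : W -> W') : linear f ->
  (forall w, exists u, f u = w) ->
  forall t, exists s, @tmap k V W V W' (fun v => v) f s = t.
Proof.
move=> lf fS t; have [s sE] := tmap_surj (W := V) lf fS (tswap t).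
by exists (tswap s); rewrite tmap_swap // sE tswapK.
Qed.

Lemma tmap_exactr V W W' W2 (e : W -> W') (f : W' -> W2) :
  linear e -> linear f -> (forall w', f w' = 0 -> exists w, e w = w') ->
  forall t, @tmap k V W' V W2 (fun v => v) f t = 0 ->
  exists s, @tmap k V W V W' (fun v => v) e s = t.
Proof.
move=> le lf ex t ft0.
have [|s sE] := tmap_exact (W := V) le lf ex (t := tswap t).
  by rewrite tmap_swap // ft0 (linear_fun0 (@tswap_linear _ _)).
by exists (tswap s); rewrite tmap_swap // sE tswapK.
Qed.

End Splitting.

(** * Linear maps out of quotient spaces *)

Section Quotients.
Context (k : fieldType).
Implicit Types (U V W : lmodType k).

Lemma qproj0 V (N : set V) v : N v -> qproj N v = 0.
Proof.
move=> Nv; rewrite -(linear0 (qproj N : {linear V -> modquot N})).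
by apply/qproj_eq; rewrite subr0; exact: mem_span.
Qed.

Lemma qproj0P V (N : set V) v : qproj N v = 0 <-> v \in span N.
Proof.
rewrite -(linear0 (qproj N : {linear V -> modquot N})) (qproj_eq N v 0).
by rewrite subr0.
Qed.

Lemma span_vanish V W (N : set V) (f : V -> W) : linear f ->
  (forall v, N v -> f v = 0) -> forall v, v \in span N -> f v = 0.
Proof.
move=> lf fN; apply: span_ind => [|a u v Nu fv]; first exact: linear_fun0.
by rewrite lf fN // fv scaler0 addr0.
Qed.

(** Maps out of a quotient are written [f (qrepr q)]; vanishing on the generators makes the choice
    of representative irrelevant. *)
Lemma qliftE V W (N : set V) (f : V -> W) : linear f ->
  (forall v, N v -> f v = 0) -> forall v, f (qrepr (qproj N v)) = f v.
Proof.
move=> lf fN v; apply/eqP; rewrite -subr_eq0 -(linear_funB lf); apply/eqP.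
by apply: span_vanish fN _ _ => //; apply/qproj_eq; rewrite qreprK.
Qed.

Lemma qlift_linear V W (N : set V) (f : V -> W) : linear f ->
  (forall v, N v -> f v = 0) -> linear (fun q : modquot N => f (qrepr q)).
Proof.
move=> lf fN a p q; rewrite -{1}[p]qreprK -{1}[q]qreprK -linearP.
by rewrite !qliftE // lf.
Qed.

Lemma span_linear V W (N : set V) (M : set W) (f : V -> W) : linear f ->
  (forall v, N v -> f v \in span M) -> forall v, v \in span N -> f v \in span M.
Proof.
move=> lf fN; apply: span_ind => [|a u v Nu fv].
  by rewrite (linear_fun0 lf) rpred0.
by rewrite lf rpredD // rpredZ // fN.
Qed.

End Quotients.

(** * Sweedler calculus in coalgebras and comodules *)

Definition trilinear_fun (k : fieldType) (U V W Z : lmodType k)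
    (F : U -> V -> W -> Z) : Prop :=
  [/\ forall v w, linear (fun u => F u v w),
      forall u w, linear (fun v => F u v w) &
      forall u v, linear (fun w => F u v w)].

Ltac trilin := split; intros; cbv beta; lin.

Section Comodules.
Context (k : fieldType).
Implicit Types (U V W : lmodType k) (C : coalgebra k).

(** Coassociativity in the form used by Sweedler notation: the identity in V ⊗ (V ⊗ V) is composed
    with the linear map induced by F. *)
Lemma comulA_tlift V U (Delta : V -> tens V V) (eps : V -> k)
    (F : V -> V -> V -> U) x :
  is_coalgebra Delta eps -> trilinear_fun F ->
  \tsum_(y, z <- Delta x) \tsum_(y1, y2 <- Delta y) F y1 y2 z
  = \tsum_(y, z <- Delta x) \tsum_(z1, z2 <- Delta z) F y z1 z2.
Proof.
move=> cD [F1 F2 F3]; pose G y t := tlift (F y) t.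
have bG : bilinear_fun G by rewrite /G; lin.
have := congr1 (tlift G) (comulA cD x).
rewrite !tlift_tlift // => E; rewrite -[RHS]/(tlift (fun y z => G y (Delta z)) _).
have -> : \tsum_(y, z <- Delta x) G y (Delta z)
  = \tsum_(y, z <- Delta x) tlift G (y ⊗ Delta z).
  by apply: eq_tlift => y z; rewrite tliftE.
rewrite -E; apply: eq_tlift => y z; rewrite tlift_tlift //.
apply: eq_tlift => y1 y2; rewrite tliftE // /G tliftE //; lin.
Qed.

Lemma rcoactA_tlift C V U (rho : V -> tens V C) (F : V -> C -> C -> U) v :
  is_rcoact rho -> trilinear_fun F ->
  \tsum_(v0, v1 <- rho v) \tsum_(w0, w1 <- rho v0) F w0 w1 v1
  = \tsum_(v0, v1 <- rho v) \tsum_(c, d <- comul v1) F v0 c d.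
Proof.
move=> cD [F1 F2 F3]; pose G y t := tlift (F y) t.
have bG : bilinear_fun G by rewrite /G; lin.
have := congr1 (tlift G) (rcoactA cD v).
rewrite !tlift_tlift // => E; rewrite -[RHS]/(tlift (fun y z => G y (comul z)) _).
have -> : \tsum_(y, z <- rho v) G y (comul z)
  = \tsum_(y, z <- rho v) tlift G (y ⊗ comul z).
  by apply: eq_tlift => y z; rewrite tliftE.
rewrite -E; apply: eq_tlift => y z; rewrite tlift_tlift //.
apply: eq_tlift => y1 y2; rewrite tliftE // /G tliftE //; lin.
Qed.

Lemma rcoact1_tlift C V U (rho : V -> tens V C) (F : V -> U) v :
  is_rcoact rho -> linear F ->
  \tsum_(v0, v1 <- rho v) (counit v1 *: F v0) = F v.
Proof.
move=> cD lF; rewrite -[in RHS](rcoact1 cD v) linear_tlift //.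
by apply: eq_tlift => v0 v1; rewrite (linear_funZ _ _ lF).
Qed.

Lemma comul_counitl_tlift V U (Delta : V -> tens V V) (eps : V -> k)
    (F : V -> U) x :
  is_coalgebra Delta eps -> linear F ->
  \tsum_(y, z <- Delta x) (eps y *: F z) = F x.
Proof.
move=> cD lF; rewrite -[in RHS](comul_counitl cD x) linear_tlift //.
by apply: eq_tlift => y z; rewrite (linear_funZ _ _ lF).
Qed.

Lemma comul_counitr_tlift V U (Delta : V -> tens V V) (eps : V -> k)
    (F : V -> U) x :
  is_coalgebra Delta eps -> linear F ->
  \tsum_(y, z <- Delta x) (eps z *: F y) = F x.
Proof.
move=> cD lF; rewrite -[in RHS](comul_counitr cD x) linear_tlift //.
by apply: eq_tlift => y z; rewrite (linear_funZ _ _ lF).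
Qed.

End Comodules.

(** * Hopf algebras and coideal subalgebras *)

Section HopfLinear.
Context (k : fieldType) (H : hopf k).

Lemma hcomul_linear : linear (@hcomul k H).
Proof. exact: comul_linear (hopf_coalgP (hopfP H)). Qed.
Lemma hcounit_scalar : scalar (@hcounit k H).
Proof. exact: counit_linear (hopf_coalgP (hopfP H)). Qed.
Lemma antipode_linear : linear (@antipode k H).
Proof. exact: hopf_antipode_linear (hopfP H). Qed.

Let Hc := hopf_coalgP (hopfP H).

Lemma hcomulA_tlift (U : lmodType k) (F : H -> H -> H -> U) x :
  trilinear_fun F ->
  \tsum_(y, z <- hcomul x) \tsum_(y1, y2 <- hcomul y) F y1 y2 z
  = \tsum_(y, z <- hcomul x) \tsum_(z1, z2 <- hcomul z) F y z1 z2.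
Proof. exact: comulA_tlift Hc. Qed.

Lemma hcounitl_tlift (U : lmodType k) (F : H -> U) x : linear F ->
  \tsum_(y, z <- hcomul x) (hcounit y *: F z) = F x.
Proof. exact: comul_counitl_tlift Hc. Qed.

Lemma hcounitr_tlift (U : lmodType k) (F : H -> U) x : linear F ->
  \tsum_(y, z <- hcomul x) (hcounit z *: F y) = F x.
Proof. exact: comul_counitr_tlift Hc. Qed.

Lemma hcounitB (x y : H) : hcounit (x - y) = hcounit x - hcounit y.
Proof. by rewrite -scaleN1r hcounitD hcounitZ mulN1r. Qed.

End HopfLinear.

Ltac lin_hook ::=
  first [ exact: hcomul_linear | exact: hcounit_scalar | exact: antipode_linear ].

(** * The antipode and its inverse *)

Section Antipode.
Context (k : fieldType) (H : hopf k).
Local Notation Delta := (@hcomul k H).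
Local Notation eps := (@hcounit k H).
Local Notation S := (@antipode k H).
Let Hc := hopf_coalgP (hopfP H).
Let HP := hopfP H.

Lemma antipodel_tlift (U : lmodType k) (F : H -> U) x : linear F ->
  \tsum_(y, z <- Delta x) F (S y * z) = eps x *: F 1.
Proof.
move=> lF; rewrite -(linear_funZ _ _ lF) -(hopf_antipodel HP x).
by rewrite (linear_tlift _ _ lF).
Qed.

Lemma antipoder_tlift (U : lmodType k) (F : H -> U) x : linear F ->
  \tsum_(y, z <- Delta x) F (y * S z) = eps x *: F 1.
Proof.
move=> lF; rewrite -(linear_funZ _ _ lF) -(hopf_antipoder HP x).
by rewrite (linear_tlift _ _ lF).
Qed.

(* Both sides are convolution inverse to the multiplication of H. *)
Lemma antipodeM x y : S (x * y) = S y * S x.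
Proof.
(* P is the threefold convolution S(x_1 y_1) x_2 y_2 S(y_3) S(x_3). Contracting the last two factors
   leaves S(x y), contracting the first two leaves S(y) S(x). *)
pose T (x1 y1 x2 y2 x3 y3 : H) := S (x1 * y1) * ((x2 * y2) * (S y3 * S x3)).
pose P := \tsum_(x1, x2 <- Delta x) \tsum_(y1, y2 <- Delta y)
  \tsum_(x3, x4 <- Delta x2) \tsum_(y3, y4 <- Delta y2) T x1 y1 x3 y3 x4 y4.
transitivity P.
  have E2 x1 y1 x2 y2 : \tsum_(x3, x4 <- Delta x2) \tsum_(y3, y4 <- Delta y2)
      T x1 y1 x3 y3 x4 y4 = eps x2 *: (eps y2 *: S (x1 * y1)).
    transitivity (\tsum_(x3, x4 <- Delta x2)
        (eps y2 *: (S (x1 * y1) * (x3 * S x4)))).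
      apply: eq_tlift => x3 x4.
      rewrite -[x3 in RHS]mulr1.
      rewrite -(antipoder_tlift (F := fun z => S (x1 * y1) * (x3 * z * S x4))).
        by apply: eq_tlift => y3 y4; rewrite /T !mulrA.
      by lin.
    rewrite tliftZ (antipoder_tlift (F := fun z => S (x1 * y1) * z)) ?mulr1.
      by rewrite !scalerA mulrC.
    by lin.
  rewrite /P; under eq_tlift => x1 x2.
    under eq_tlift => y1 y2 do rewrite E2.
    rewrite tliftZ hcounitr_tlift //; last by lin.
    over.
  by rewrite hcounitr_tlift //; lin.
rewrite /P; under eq_tlift => x1 x2.
  rewrite tlift_swap.
  under eq_tlift => x3 x4.
    rewrite -hcomulA_tlift //; last by rewrite /T; trilin.
    over.
  over.
rewrite -hcomulA_tlift //; last by rewrite /T; trilin.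
transitivity (\tsum_(x1, x2 <- Delta x) \tsum_(y1, y2 <- Delta y)
    (eps x1 *: (eps y1 *: (S y2 * S x2)))).
  apply: eq_tlift => x1 x2; rewrite tlift_swap; apply: eq_tlift => y1 y2.
  transitivity (eps (x1 * y1) *: (S y2 * S x2)); last first.
    by rewrite (hopf_counitM HP) scalerA.
  rewrite -[in RHS](mul1r (S y2 * _)) -[RHS](antipodel_tlift (F := fun z => z * _)).
    rewrite (hopf_comulM HP) tlift_tlift; last by lin.
    apply: eq_tlift => x3 x4; rewrite tlift_tlift; last by lin.
    apply: eq_tlift => y3 y4; rewrite tliftE; last by lin.
    by rewrite /T !mulrA.
  by lin.
under eq_tlift => x1 x2.
  rewrite tliftZ hcounitl_tlift //; last by lin.
  over.
by rewrite (hcounitl_tlift (F := fun z => S y * S z)) //; lin.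
Qed.

Lemma antipode1 : S 1 = 1.
Proof.
have := hopf_antipodel HP 1; rewrite (hopf_comul1 HP) tliftE; last by lin.
by rewrite mulr1 (hopf_counit1 HP) scale1r.
Qed.

(** Apply eps to the axiom for S(x_1) x_2 and absorb eps(x_2). Scalars are carried as multiples of 1
    because a [tlift] takes values in a vector space. *)
Lemma counit_antipode x : eps (S x) = eps x.
Proof.
pose F (z : H) := eps z *: (1 : H).
have lF : linear F by rewrite /F; lin.
have := antipodel_tlift x lF; rewrite {2}/F (hopf_counit1 HP) scale1r.
rewrite (eq_tlift (g := fun y z => eps z *: F (S y))); last first.
  by move=> y z; rewrite /F (hopf_counitM HP) scalerA mulrC.
rewrite (hcounitr_tlift (F := fun y => F (S y))) //; last by lin.
rewrite /F => /eqP; rewrite -subr_eq0 -scalerBl scaler_eq0 oner_eq0 orbF.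
by rewrite subr_eq0 => /eqP.
Qed.

Definition tmul (s t : tens H H) : tens H H :=
  \tsum_(a, b <- s) \tsum_(c, d <- t) (a * c) ⊗ (b * d).

Lemma tmul_bilinear : bilinear_fun tmul.
Proof. by rewrite /tmul; lin. Qed.

Lemma tmulE a b c d : tmul (a ⊗ b) (c ⊗ d) = (a * c) ⊗ (b * d).
Proof. by rewrite /tmul tliftE ?tliftE //; lin. Qed.

Lemma tmulA r s t : tmul r (tmul s t) = tmul (tmul r s) t.
Proof.
have [lm rm] := tmul_bilinear.
apply: (tens_ext (f := fun r => tmul r (tmul s t))
  (g := fun r => tmul (tmul r s) t)); [lin | lin |] => a b.
apply: (tens_ext (f := fun s => tmul (a ⊗ b) (tmul s t))
  (g := fun s => tmul (tmul (a ⊗ b) s) t)); [lin | lin |] => c d.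
apply: (tens_ext (f := fun t => tmul (a ⊗ b) (tmul (c ⊗ d) t))
  (g := fun t => tmul (tmul (a ⊗ b) (c ⊗ d)) t)); [lin | lin |] => e f.
by rewrite !tmulE !mulrA.
Qed.

Lemma tmulr1 t : tmul t (1 ⊗ 1) = t.
Proof.
have [lm rm] := tmul_bilinear.
apply: (tens_ext (f := fun t => tmul t (1 ⊗ 1)) (g := fun t => t)); [lin|lin|].
by move=> a b; rewrite tmulE !mulr1.
Qed.

Lemma tmul1r t : tmul (1 ⊗ 1) t = t.
Proof.
have [lm rm] := tmul_bilinear.
apply: (tens_ext (f := fun t => tmul (1 ⊗ 1) t) (g := fun t => t)); [lin|lin|].
by move=> a b; rewrite tmulE !mul1r.
Qed.

(* Both sides are convolution inverse to the comultiplication of H. *)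
Lemma comul_antipode x : Delta (S x) = \tsum_(x1, x2 <- Delta x) S x2 ⊗ S x1.
Proof.
have [lm rm] := tmul_bilinear.
pose R z := \tsum_(x1, x2 <- Delta z) S x2 ⊗ S x1.
have lR : linear R by rewrite /R; lin.
have DM a b : Delta (a * b) = tmul (Delta a) (Delta b).
  by rewrite (hopf_comulM HP).
(* In y_1 S(y_4) ⊗ y_2 S(y_3) the inner pair y_2 S(y_3) is contracted before the outer one. *)
have ER y : \tsum_(a, b <- Delta y) tmul (Delta a) (R b) = eps y *: ((1:H) ⊗ (1:H)).
  pose F (a1 a2 b1 b2 : H) := (a1 * S b2) ⊗ (a2 * S b1).
  transitivity (\tsum_(a, b <- Delta y) \tsum_(a1, a2 <- Delta a)
      \tsum_(b1, b2 <- Delta b) F a1 a2 b1 b2).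
    apply: eq_tlift => a b; rewrite /tmul; apply: eq_tlift => a1 a2.
    rewrite /R tlift_tlift; last by lin.
    by apply: eq_tlift => b1 b2; rewrite tliftE //; lin.
  rewrite hcomulA_tlift //; last by rewrite /F; trilin.
  transitivity (\tsum_(a, b <- Delta y) ((a * S b) ⊗ (1 : H))).
    apply: eq_tlift => a b.
    rewrite -hcomulA_tlift //; last by rewrite /F; trilin.
    rewrite -(hcounitl_tlift (F := fun d => (a * S d) ⊗ (1 : H)) b ); last by lin.
    apply: eq_tlift => c d.
    by rewrite (antipoder_tlift (F := fun z : H => (a * S d) ⊗ z)) //; lin.
  by rewrite (antipoder_tlift (F := fun z : H => z ⊗ (1 : H))) //; lin.
(* The threefold convolution of Δ∘S, Δ and R: the last two cancel to leave Δ(S x), the first two to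
   leave R x. *)
transitivity (\tsum_(x1, x2 <- Delta x) \tsum_(x3, x4 <- Delta x2)
    tmul (Delta (S x1)) (tmul (Delta x3) (R x4))).
  rewrite -[LHS]tmulr1.
  rewrite -(hcounitr_tlift (F := fun z => tmul (Delta (S z)) (1 ⊗ 1)) x).
    apply: eq_tlift => x1 x2.
    rewrite -(linear_tlift _ _ (rm (Delta (S x1)))) ER.
    by rewrite (linear_funZ _ _ (rm _)).
  by lin.
rewrite -hcomulA_tlift //; last by trilin.
rewrite -[RHS]/(R x) -(hcounitl_tlift (F := R) x ) //.
apply: eq_tlift => y z; rewrite -[R z in RHS]tmul1r -(hopf_comul1 HP).
rewrite -(antipodel_tlift (F := fun u => tmul (Delta u) (R z))); last by lin.
by apply: eq_tlift => y1 y2; rewrite tmulA DM.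
Qed.

Section Inverse.
Context (T : H -> H) (ST : cancel S T) (TS : cancel T S).

Lemma antipode_inv_linear : linear T.
Proof.
by move=> a u v; apply: (can_inj ST); rewrite antipode_linear !TS.
Qed.

Lemma antipode_invM x y : T (x * y) = T y * T x.
Proof. by apply: (can_inj ST); rewrite antipodeM !TS. Qed.

Lemma antipode_inv1 : T 1 = 1.
Proof. by apply: (can_inj ST); rewrite antipode1 !TS. Qed.

Lemma counit_antipode_inv x : eps (T x) = eps x.
Proof. by rewrite -counit_antipode TS. Qed.

Lemma comul_antipode_inv x : Delta (T x) = \tsum_(x1, x2 <- Delta x) T x2 ⊗ T x1.
Proof.
have lT := antipode_inv_linear.
rewrite -[in RHS](TS x) comul_antipode tlift_tlift; last by lin.
rewrite -[LHS]tlift_id; apply: eq_tlift => a b; rewrite tliftE; last by lin.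
by rewrite !ST.
Qed.

(** Applying S, which reverses products, turns this into the axiom for S. The factors appear in the
    order opposite to that of Δ, as T is an antipode for the opposite multiplication. *)
Lemma antipode_invl x : \tsum_(y, z <- Delta x) (T z * y) = eps x *: 1.
Proof.
have lT := antipode_inv_linear; apply: (can_inj ST).
rewrite (linear_tlift _ _ (@antipode_linear _ _)).
rewrite (linear_funZ _ _ (@antipode_linear _ _)) antipode1.
rewrite -(hopf_antipodel HP); apply: eq_tlift => y z.
by rewrite antipodeM TS.
Qed.

Lemma antipode_invr x : \tsum_(y, z <- Delta x) (z * T y) = eps x *: 1.
Proof.
have lT := antipode_inv_linear; apply: (can_inj ST).
rewrite (linear_tlift _ _ (@antipode_linear _ _)).
rewrite (linear_funZ _ _ (@antipode_linear _ _)) antipode1.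
rewrite -(hopf_antipoder HP); apply: eq_tlift => y z.
by rewrite antipodeM TS.
Qed.

Lemma antipode_invl_tlift (U : lmodType k) (F : H -> U) x : linear F ->
  \tsum_(y, z <- Delta x) F (T z * y) = eps x *: F 1.
Proof.
move=> lF; rewrite -(linear_funZ _ _ lF) -(antipode_invl x).
by rewrite (linear_tlift _ _ lF).
Qed.

Lemma antipode_invr_tlift (U : lmodType k) (F : H -> U) x : linear F ->
  \tsum_(y, z <- Delta x) F (z * T y) = eps x *: F 1.
Proof.
move=> lF; rewrite -(linear_funZ _ _ lF) -(antipode_invr x).
by rewrite (linear_tlift _ _ lF).
Qed.

End Inverse.
End Antipode.

Section CoidealSubalgebra.
Context (k : fieldType) (H : hopf k) (A : rcoideal_subalg H).
Local Notation Delta := (@hcomul k H).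
Local Notation eps := (@hcounit k H).
Local Notation S := (@antipode k H).
Local Notation valA := (val : A -> H).
Let Hc := hopf_coalgP (hopfP H).
Let HP := hopfP H.

Lemma valA_linear : linear valA.
Proof. exact: linearP. Qed.

Lemma tens_val_inj : injective (@tens_val k H _ A).
Proof. exact: tmap_inj valA_linear val_inj. Qed.

Lemma tens_val_linear : linear (@tens_val k H _ A).
Proof. exact: (tmap_linear valA_linear (@linear_idfun k H)). Qed.

Lemma tens_valE (a : A) (h : H) : tens_val (a ⊗ h) = valA a ⊗ h.
Proof. exact: (tmapE a h valA_linear (@linear_idfun k H)). Qed.

Lemma rcomul_linear : linear (@rcomul k H A).
Proof.
move=> c a b; apply: tens_val_inj; rewrite tens_val_linear !rcomulE.
by rewrite linearP hcomul_linear.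
Qed.

Lemma rcomul_tlift (U : lmodType k) (F : H -> H -> U) (a : A) :
  bilinear_fun F ->
  tlift F (Delta (valA a)) = \tsum_(b, h <- rcomul a) F (valA b) h.
Proof.
move=> bF; rewrite -rcomulE /tens_val tlift_tlift //.
by apply: eq_tlift => b h; rewrite tliftE.
Qed.

(** Coassociativity is tested after the embedding of A ⊗ (H ⊗ H) into H ⊗ (H ⊗ H), where it becomes
    that of H. *)
Lemma rcomul_rcoact : @is_rcoact k (hopf_coalg H) A (@rcomul k H A).
Proof.
split.
- exact: rcomul_linear.
- move=> a; apply: (@tmap_injr k _ _ _ (fun w => w)) => //.
  apply: (tmap_inj (f := valA) valA_linear val_inj).
  have lv := valA_linear; rewrite !tmap_comp //.
  set T := tmap _ _; have lT : linear T by apply: tmap_linear.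
  rewrite [in LHS](linear_tlift _ _ lT) [in RHS](linear_tlift _ _ lT) /=.
  transitivity (\tsum_(y, z <- Delta (valA a)) \tsum_(y1, y2 <- Delta y)
      (y1 ⊗ (y2 ⊗ z))).
    rewrite rcomul_tlift; last by lin.
    apply: eq_tlift => b h; rewrite linear_tlift // rcomul_tlift; last by lin.
    by apply: eq_tlift => c g; rewrite /T tmapE.
  rewrite (comulA Hc) rcomul_tlift; last by lin.
  by apply: eq_tlift => b h; rewrite /T tmapE.
- move=> a; apply: val_inj; rewrite (linear_tlift _ _ valA_linear) /=.
  transitivity (\tsum_(y, z <- Delta (valA a)) (eps z *: y)).
    rewrite rcomul_tlift; last by lin.
    by apply: eq_tlift => b h; rewrite (linear_funZ _ _ valA_linear).
  exact: comul_counitr Hc _.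
Qed.

Lemma rcomulA_tlift (U : lmodType k) (F : A -> H -> H -> U) (a : A) :
  trilinear_fun F ->
  \tsum_(b, h <- rcomul a) \tsum_(c, g <- rcomul b) F c g h
  = \tsum_(b, h <- rcomul a) \tsum_(g1, g2 <- Delta h) F b g1 g2.
Proof. exact: rcoactA_tlift rcomul_rcoact. Qed.

Lemma rcomul_counitr (U : lmodType k) (F : A -> U) (a : A) : linear F ->
  \tsum_(b, h <- rcomul a) (eps h *: F b) = F a.
Proof. exact: rcoact1_tlift rcomul_rcoact. Qed.

Lemma rcomul_counitl (U : lmodType k) (F : H -> U) (a : A) : linear F ->
  \tsum_(b, h <- rcomul a) (eps (valA b) *: F h) = F (valA a).
Proof.
move=> lF; rewrite -[RHS](hcounitl_tlift _ lF).
by rewrite (rcomul_tlift (F := fun y z => eps y *: F z)) //; lin.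
Qed.

Lemma rcomulM (a b : A) : rcomul (a * b) =
  \tsum_(a1, a2 <- rcomul a) \tsum_(b1, b2 <- rcomul b) (a1 * b1) ⊗ (a2 * b2).
Proof.
have lT := tens_val_linear; have lv := valA_linear.
apply: tens_val_inj; rewrite rcomulE (rmorphM valA) (hopf_comulM HP).
rewrite rcomul_tlift; last by lin.
rewrite (linear_tlift _ _ lT); apply: eq_tlift => a1 a2.
rewrite rcomul_tlift; last by lin.
rewrite (linear_tlift _ _ lT); apply: eq_tlift => b1 b2.
by rewrite tens_valE (rmorphM valA).
Qed.

Lemma rcomul1 : rcomul (1 : A) = 1 ⊗ 1.
Proof.
apply: tens_val_inj.
by rewrite rcomulE tens_valE (rmorph1 valA) (hopf_comul1 HP).
Qed.

Definition aug (a : A) : k := eps (valA a).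

Lemma aug_scalar : scalar aug.
Proof. by move=> c a b; rewrite /aug linearP hcounit_scalar. Qed.

Lemma augM a b : aug (a * b) = aug a * aug b.
Proof. by rewrite /aug (rmorphM valA) (hopf_counitM HP). Qed.

Lemma aug1 : aug 1 = 1.
Proof. by rewrite /aug (rmorph1 valA) (hopf_counit1 HP). Qed.

Lemma augZ c a : aug (c *: a) = c * aug a.
Proof. by rewrite /aug linearZ hcounitZ. Qed.

Lemma augB a b : aug (a - b) = aug a - aug b.
Proof. by rewrite /aug linearB hcounitB. Qed.

End CoidealSubalgebra.

(** * Induced module and comodule structures *)

Section KernelSpace.
Context (k : fieldType) (V W : lmodType k) (f : V -> W).

(** The proof [lf] is part of the name, so that the subspace structure can be inferred from the
    predicate alone. *)
Definition ker_pred (lf : linear f) : {pred V} := fun v => f v == 0.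

Lemma ker_pred_submod (lf : linear f) : submod_closed (ker_pred lf).
Proof.
split=> [|a u v]; rewrite !unfold_in ?(linear_fun0 lf) //.
by move=> /eqP fu /eqP fv; rewrite lf fu fv scaler0 addr0.
Qed.

HB.instance Definition _ (lf : linear f) :=
  GRing.isSubmodClosed.Build k V (ker_pred lf) (ker_pred_submod lf).

Record ker_type (lf : linear f) :=
  KerType { ker_val : V; _ : ker_val \in ker_pred lf }.

HB.instance Definition _ (lf : linear f) := [isSub for @ker_val lf].
HB.instance Definition _ (lf : linear f) := [Choice of ker_type lf by <:].
HB.instance Definition _ (lf : linear f) :=
  [SubChoice_isSubLmodule of ker_type lf by <:].

Lemma exists_kernel : linear f -> exists (K : lmodType k) (i : K -> V),
  [/\ linear i, injective i & forall v, f v = 0 <-> exists x, i x = v].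
Proof.
move=> lf; exists (ker_type lf), val; split; [exact: linearP | exact: val_inj |].
move=> v; split=> [/eqP fv|[x <-]]; first by exists (KerType fv).
exact/eqP/(valP x).
Qed.

End KernelSpace.

Section InducedStructures.
Context (k : fieldType) (A : algType k) (C : coalgebra k).
Implicit Types (V W K Q : lmodType k).

(** A map i compatible with the coactions carries both sides of coassociativity at v to those at i
    v. So coassociativity is pulled back along injective maps and pushed forward along surjective
    ones. *)
Lemma tmap_comul_coact V W (i : V -> W) (rV : V -> tens V C) (rW : W -> tens W C) v :
  linear i -> linear rV -> linear rW ->
  (forall v, tmap i (fun c => c) (rV v) = rW (i v)) ->
  tmap i (fun s => s) (\tsum_(v0, v1 <- rV v) \tsum_(w0, w1 <- rV v0) w0 ⊗ (w1 ⊗ v1))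
  = \tsum_(v0, v1 <- rW (i v)) \tsum_(w0, w1 <- rW v0) w0 ⊗ (w1 ⊗ v1) /\
  tmap i (fun s => s) (\tsum_(v0, v1 <- rV v) v0 ⊗ comul v1)
  = \tsum_(v0, v1 <- rW (i v)) v0 ⊗ comul v1.
Proof.
move=> li lV lW iE; have lC := comul_linear (coalgP C).
set T := tmap _ _; have lT : linear T by apply: tmap_linear.
split; rewrite (linear_tlift _ _ lT) -iE tlift_tmap; try by lin.
  apply: eq_tlift => v0 v1; rewrite (linear_tlift _ _ lT) -iE tlift_tmap.
    by apply: eq_tlift => w0 w1; rewrite /T tmapE.
  by lin.
by apply: eq_tlift => v0 v1; rewrite /T tmapE.
Qed.

Lemma tmap_counit_coact V W (i : V -> W) (rV : V -> tens V C) (rW : W -> tens W C) v :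
  linear i -> (forall v, tmap i (fun c => c) (rV v) = rW (i v)) ->
  i (\tsum_(v0, v1 <- rV v) (counit v1 *: v0))
  = \tsum_(v0, v1 <- rW (i v)) (counit v1 *: v0).
Proof.
move=> li iE; have lC := counit_linear (coalgP C).
rewrite (linear_tlift _ _ li) -iE tlift_tmap; last by lin.
by apply: eq_tlift => v0 v1; rewrite (linear_funZ _ _ li).
Qed.

Lemma sub_ract V K (act : V -> A -> V) (i : K -> V) :
  is_ract act -> linear i -> injective i ->
  (forall x a, exists y, i y = act (i x) a) ->
  exists act' : K -> A -> K,
    is_ract act' /\ forall x a, i (act' x a) = act (i x) a.
Proof.
move=> [[b1 b2] m1 mA] li iI ex.
have [act' act'P] := choice (fun p => ex p.1 p.2).
exists (fun x a => act' (x, a)); split=> [|x a]; last exact: act'P.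
split=> [|v|v a b]; last 2 first.
- by apply: iI; rewrite act'P /= m1.
- by apply: iI; rewrite !act'P /= mA.
split=> [a|x] c u v; apply: iI; rewrite li !act'P /=.
  by rewrite li b1.
by rewrite b2.
Qed.

Lemma sub_rcoact V K (rho : V -> tens V C) (i : K -> V) :
  is_rcoact rho -> linear i -> injective i ->
  (forall x, exists t, tmap i (fun c => c) t = rho (i x)) ->
  exists rho' : K -> tens K C,
    is_rcoact rho' /\ forall x, tmap i (fun c => c) (rho' x) = rho (i x).
Proof.
move=> rP li iI /choice[rho' rho'P]; exists rho'; split=> //.
have lr := rcoact_linear rP.
have lr' : linear rho'.
  move=> c u v; apply: (tmap_inj li iI).
  have lt := tmap_linear li (@linear_idfun k C).
  by rewrite lt !rho'P li lr.
split=> // v.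
  have [E1 E2] := tmap_comul_coact v li lr' lr rho'P.
  by apply: (tmap_inj li iI); rewrite E1 E2; exact: rcoactA rP _.
by apply: iI; rewrite (tmap_counit_coact v li rho'P); exact: rcoact1 rP _.
Qed.

Lemma quot_ract V Q (act : V -> A -> V) (q : V -> Q) :
  is_ract act -> linear q -> (forall y, exists x, q x = y) ->
  (forall x a, q x = 0 -> q (act x a) = 0) ->
  exists act' : Q -> A -> Q,
    is_ract act' /\ forall x a, q (act x a) = act' (q x) a.
Proof.
move=> [[b1 b2] m1 mA] lq /choice[r rP] st.
have E x y a : q x = q y -> q (act x a) = q (act y a).
  move=> xy; apply/eqP; rewrite -subr_eq0 -(linear_funB lq).
  rewrite -(linear_funB (b1 a)); apply/eqP/st.
  by rewrite (linear_funB lq) xy subrr.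
exists (fun y a => q (act (r y) a)); split=> [|x a]; last exact: E.
split=> [|v|v a b]; last 2 first.
- by rewrite m1.
- by rewrite mA; exact: E.
split=> [a|x] c u v; last by rewrite b2 lq.
by rewrite -lq -b1; apply: E; rewrite lq !rP.
Qed.

Lemma quot_rcoact V Q (rho : V -> tens V C) (q : V -> Q) :
  is_rcoact rho -> linear q -> (forall y, exists x, q x = y) ->
  (forall x, q x = 0 -> tmap q (fun c => c) (rho x) = 0) ->
  exists rho' : Q -> tens Q C,
    is_rcoact rho' /\ forall x, tmap q (fun c => c) (rho x) = rho' (q x).
Proof.
move=> rP lq qS st; have [r rPi] := choice qS.
have lr := rcoact_linear rP.
have lt := tmap_linear lq (@linear_idfun k C).
have E x y : q x = q y ->
    tmap q (fun c => c) (rho x) = tmap q (fun c : C => c) (rho y).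
  move=> xy; apply/eqP; rewrite -subr_eq0 -(linear_funB lt).
  rewrite -(linear_funB lr); apply/eqP/st.
  by rewrite (linear_funB lq) xy subrr.
pose rho' y := tmap q (fun c : C => c) (rho (r y)).
have rE x : tmap q (fun c : C => c) (rho x) = rho' (q x) by exact: E.
have lr' : linear rho'.
  by move=> c u v; rewrite /rho' -lt -lr; apply: E; rewrite lq !rPi.
exists rho'; split=> //; split=> // y; have [x <-] := qS y.
  by have [<- <-] := tmap_comul_coact x lq lr lr' rE; rewrite (rcoactA rP).
by rewrite -(tmap_counit_coact x lq rE) (rcoact1 rP).
Qed.

Definition prod_act V W (aV : V -> A -> V) (aW : W -> A -> W) (p : V * W) a :=
  (aV p.1 a, aW p.2 a).

Lemma prod_ract V W (aV : V -> A -> V) (aW : W -> A -> W) :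
  is_ract aV -> is_ract aW -> @is_ract k A (V * W)%type (prod_act aV aW).
Proof.
move=> [[b1 b2] m1 mA] [[b1' b2'] m1' mA']; rewrite /prod_act.
split=> [|[v w]|[v w] a b] /=; last 2 first.
- by rewrite m1 m1'.
- by rewrite mA mA'.
split=> [a c [u x] [u' x']|[v w] c a b] /=; first by rewrite b1 b1'.
by rewrite b2 b2'.
Qed.

Definition prod_coact V W (rV : V -> tens V C) (rW : W -> tens W C)
    (p : V * W) : tens (V * W)%type C :=
  tmap (fun v => (v, 0)) (fun c => c) (rV p.1)
  + tmap (fun w => (0, w)) (fun c => c) (rW p.2).

Lemma linear_pairl V W : linear (fun v : V => (v, 0 : W)).
Proof.
move=> c u v; rewrite -[RHS]/(c *: u + v, c *: (0 : W) + 0).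
by rewrite scaler0 addr0.
Qed.
Lemma linear_pairr V W : linear (fun w : W => (0 : V, w)).
Proof.
move=> c u v; rewrite -[RHS]/(c *: (0 : V) + 0, c *: u + v).
by rewrite scaler0 addr0.
Qed.

Lemma prod_coact_linear V W (rV : V -> tens V C) (rW : W -> tens W C) :
  linear rV -> linear rW -> linear (prod_coact rV rW).
Proof.
move=> lV lW; have ll := @linear_pairl V W; have lr := @linear_pairr V W.
have l1 : linear (fun p : (V * W)%type => p.1) by [].
have l2 : linear (fun p : (V * W)%type => p.2) by [].
by rewrite /prod_coact /tmap; lin.
Qed.

Lemma prod_coactl V W (rV : V -> tens V C) (rW : W -> tens W C) v : linear rW ->
  tmap (fun v => (v, 0)) (fun c => c) (rV v) = prod_coact rV rW (v, 0).
Proof.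
move=> lW; rewrite /prod_coact /= (linear_fun0 lW).
by rewrite (linear_fun0 (tmap_linear (@linear_pairr V W) _)) // addr0.
Qed.

Lemma prod_coactr V W (rV : V -> tens V C) (rW : W -> tens W C) w : linear rV ->
  tmap (fun w => (0, w)) (fun c => c) (rW w) = prod_coact rV rW (0, w).
Proof.
move=> lV; rewrite /prod_coact /= (linear_fun0 lV).
by rewrite (linear_fun0 (tmap_linear (@linear_pairl V W) _)) // add0r.
Qed.

Lemma pair_add V W (p : V * W) : p = (p.1, 0) + (0, p.2).
Proof.
by case: p => v w; rewrite -[RHS]/(v + 0, 0 + w) addr0 add0r.
Qed.

(** Both axioms are linear in p, so they reduce to the two summands, whose inclusions are compatible
    with the coactions. *)
Lemma prod_rcoact V W (rV : V -> tens V C) (rW : W -> tens W C) :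
  is_rcoact rV -> is_rcoact rW -> is_rcoact (prod_coact rV rW).
Proof.
move=> PV PW; have lV := rcoact_linear PV; have lW := rcoact_linear PW.
have ll := @linear_pairl V W; have lr := @linear_pairr V W.
have lR := prod_coact_linear lV lW; have lC := comul_linear (coalgP C).
have le := counit_linear (coalgP C).
have El v := prod_coactl rV v lW; have Er w := prod_coactr rW w lV.
set R := prod_coact rV rW in lR El Er *.
split=> // p; rewrite (pair_add p).
  pose L1 p := \tsum_(v0, v1 <- R p) \tsum_(w0, w1 <- R v0) w0 ⊗ (w1 ⊗ v1).
  pose L2 p := \tsum_(v0, v1 <- R p) v0 ⊗ comul v1.
  rewrite -[LHS]/(L1 _) -[RHS]/(L2 _).
  have lL1 : linear L1 by rewrite /L1; lin.
  have lL2 : linear L2 by rewrite /L2; lin.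
  rewrite (linear_funD lL1) (linear_funD lL2) /L1 /L2.
  have [<- <-] := tmap_comul_coact p.1 ll lV lR El.
  have [<- <-] := tmap_comul_coact p.2 lr lW lR Er.
  by rewrite (rcoactA PV) (rcoactA PW).
pose L1 p := \tsum_(v0, v1 <- R p) (counit v1 *: v0).
have lL1 : linear L1 by rewrite /L1; lin.
rewrite -[LHS]/(L1 _) (linear_funD lL1) /L1.
rewrite -(tmap_counit_coact p.1 ll El) -(tmap_counit_coact p.2 lr Er).
by rewrite (rcoact1 PV) (rcoact1 PW).
Qed.

End InducedStructures.

(** * Localization of categories *)

Section Equivalences.
Context (C D : category).

Definition fully_faithful (L : functor C D) : Prop :=
  forall X Y (h : hom (L X) (L Y)), exists! f : hom X Y, fmap L f = h.

Definition essentially_surjective (L : functor C D) : Prop :=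
  forall Y, exists X (e : hom (L X) Y), isomorphism e.

Lemma fully_faithful_equiv (L : functor C D) :
  fully_faithful L -> essentially_surjective L -> equivalent_cat C D.
Proof.
move=> ff es.
pose G Y := sval (cid (es Y)).
pose e Y : hom (L (G Y)) Y := sval (cid (svalP (cid (es Y)))).
have eP Y : isomorphism (e Y) := svalP (cid (svalP (cid (es Y)))).
pose e' Y : hom Y (L (G Y)) := sval (cid (eP Y)).
have e'e Y : e' Y ∘m e Y = idm _ := (svalP (cid (eP Y))).1.
have ee' Y : e Y ∘m e' Y = idm _ := (svalP (cid (eP Y))).2.
pose pre X Y (h : hom (L X) (L Y)) : hom X Y := sval (cid (ff X Y h)).
have preK X Y (h : hom (L X) (L Y)) : fmap L (pre X Y h) = h.
  exact: (svalP (cid (ff X Y h))).1.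
have inj X Y (f g : hom X Y) : fmap L f = fmap L g -> f = g.
  by move=> fg; have [x [_ xU]] := ff X Y (fmap L g); rewrite -(xU f) // -(xU g).
pose Gm Y Y' (g : hom Y Y') := pre _ _ (e' Y' ∘m g ∘m e Y).
have Gm1 Y : Gm Y Y (idm Y) = idm (G Y).
  by apply: inj; rewrite preK fmap1 compm1 e'e.
have GmM Y1 Y2 Y3 (g : hom Y2 Y3) (f : hom Y1 Y2) :
    Gm _ _ (g ∘m f) = Gm _ _ g ∘m Gm _ _ f.
  apply: inj; rewrite fmapM !preK !compA.
  by rewrite -[_ ∘m e Y2 ∘m e' Y2]compA ee' compm1.
exists L, (@Functor D C G Gm Gm1 GmM); split.
  exists (fun X => pre _ _ (e (L X))); split=> [X|X Y f] /=.
    exists (pre _ _ (e' (L X))).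
    by split; apply: inj; rewrite fmapM !preK fmap1 ?e'e ?ee'.
  by apply: inj; rewrite !fmapM /= !preK !compA ee' comp1m.
by exists e; split=> [//|X Y f] /=; rewrite /Gm preK !compA ee' comp1m.
Qed.

End Equivalences.

Lemma natural_iso_trans (C D : category) (F G K : functor C D) :
  natural_iso F G -> natural_iso G K -> natural_iso F K.
Proof.
move=> [a [aI aN]] [b [bI bN]]; exists (fun X => b X ∘m a X); split=> [X|X Y f].
  have [a' [a1 a2]] := aI X; have [b' [b1 b2]] := bI X; exists (a' ∘m b').
  split; rewrite !compA.
    by rewrite -[_ ∘m b' ∘m b X]compA b1 compm1.
  by rewrite -[_ ∘m a X ∘m a']compA a2 compm1.
by rewrite -compA aN !compA bN.
Qed.

Lemma equivalent_cat_trans (C D E : category) :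
  equivalent_cat C D -> equivalent_cat D E -> equivalent_cat C E.
Proof.
move=> [F [F' [FF' F'F]]] [G [G' [GG' G'G]]].
exists (functor_comp G F), (functor_comp F' G'); split.
  apply: natural_iso_trans FF'; have [a [aI aN]] := GG'.
  exists (fun X => fmap F' (a (F X))); split=> [X|X Y f] /=.
    have [b [b1 b2]] := aI (F X); exists (fmap F' b).
    by rewrite -!fmapM b1 b2 !fmap1.
  by rewrite -!fmapM aN.
apply: natural_iso_trans G'G; have [a [aI aN]] := F'F.
exists (fun X => fmap G (a (G' X))); split=> [X|X Y f] /=.
  have [b [b1 b2]] := aI (G' X); exists (fmap G b).
  by rewrite -!fmapM b1 b2 !fmap1.
by rewrite -!fmapM aN.
Qed.

(** X and e are the value at Y of a right adjoint of F and the counit there. Giving such an arrow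
    for every Y replaces the construction of the adjoint functor. *)
Definition universal_arrow (C D : category) (F : functor C D) (Y : D) (X : C)
    (e : hom (F X) Y) : Prop :=
  forall X' (h : hom (F X') Y), exists! u : hom X' X, e ∘m fmap F u = h.

(** * Localization along a functor with invertible counit *)

Section ReflectiveLocalization.
Context (C D : category) (W : forall X Y : C, hom X Y -> Prop) (F : functor C D).
Context (F_counit : forall Y, exists X (e : hom (F X) Y),
           isomorphism e /\ universal_arrow e).
Context (F_inverts : forall X Y (f : hom X Y), W f <-> isomorphism (fmap F f)).

Let G Y : C := sval (cid (F_counit Y)).
Let e Y : hom (F (G Y)) Y := sval (cid (svalP (cid (F_counit Y)))).
Let eP Y : isomorphism (e Y) /\ universal_arrow (e Y) :=
  svalP (cid (svalP (cid (F_counit Y)))).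
Let tr X Y (h : hom (F X) Y) : hom X (G Y) := sval (cid ((eP Y).2 X h)).
Let trK X Y (h : hom (F X) Y) : e Y ∘m fmap F (tr h) = h :=
  (svalP (cid ((eP Y).2 X h))).1.
Let trU X Y (h : hom (F X) Y) u : e Y ∘m fmap F u = h -> tr h = u.
Proof. exact: (svalP (cid ((eP Y).2 X h))).2. Qed.
Let e' Y : hom Y (F (G Y)) := sval (cid (eP Y).1).
Let e'e Y : e' Y ∘m e Y = idm _ := (svalP (cid (eP Y).1)).1.
Let ee' Y : e Y ∘m e' Y = idm _ := (svalP (cid (eP Y).1)).2.
Let winv X Y (w : hom X Y) (Ww : W w) : hom (F Y) (F X) :=
  sval (cid (proj1 (F_inverts w) Ww)).
Let winvl X Y (w : hom X Y) (Ww : W w) : winv Ww ∘m fmap F w = idm _ :=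
  (svalP (cid (proj1 (F_inverts w) Ww))).1.
Let winvr X Y (w : hom X Y) (Ww : W w) : fmap F w ∘m winv Ww = idm _ :=
  (svalP (cid (proj1 (F_inverts w) Ww))).2.

Fixpoint zigzag_eval X Y (p : zigzag W X Y) : hom (F X) (F Y) :=
  match p with
  | ZNil _ => idm _
  | ZFwd _ _ _ f p' => zigzag_eval p' ∘m fmap F f
  | ZBwd _ _ _ _ Ww p' => zigzag_eval p' ∘m winv Ww
  end.

Lemma zigzag_eval_eq X Y (p q : zigzag W X Y) :
  zeq p q -> zigzag_eval p = zigzag_eval q.
Proof.
elim=> //= {X Y p q}.
- by move=> X Y p q r _ -> _ ->.
- by move=> X Y Z f p q _ ->.
- by move=> X Y Z w Ww p q _ ->.
- by move=> X Y p; rewrite fmap1 compm1.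
- by move=> X Y Z T f g p; rewrite fmapM compA.
- by move=> X Y Z w Ww p; rewrite -compA winvl compm1.
- by move=> X Y Z w Ww p; rewrite -compA winvr compm1.
Qed.

Lemma zigzag_eval_cat X Y Z (p : zigzag W X Y) (q : zigzag W Y Z) :
  zigzag_eval (zcat p q) = zigzag_eval q ∘m zigzag_eval p.
Proof.
elim: p q => /= [X' q|X' Y' Z' f p IH q|X' Y' Z' w Ww p IH q].
- by rewrite compm1.
- by rewrite IH compA.
- by rewrite IH compA.
Qed.

Local Notation Q := (loc_functor W).

Let ev X Y (c : @hom (localization W) X Y) : hom (F X) (F Y) :=
  zigzag_eval (zrepr c).

Let ev_class X Y (p : zigzag W X Y) : ev (zclass p) = zigzag_eval p.
Proof. by apply: zigzag_eval_eq; apply/zclass_eq/zreprK. Qed.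

Let ev1 X : ev (idm (X : localization W)) = idm (F X).
Proof. exact: ev_class. Qed.

Let evM X Y Z (d : @hom (localization W) Y Z) (c : @hom (localization W) X Y) :
  ev (d ∘m c) = ev d ∘m ev c.
Proof. by rewrite {1}/ev /= /loc_comp -/(ev _) ev_class zigzag_eval_cat. Qed.

Definition localization_lift : functor (localization W) D :=
  @Functor (localization W) D (fun X => F X) ev ev1 evM.

Let evQ X Y (f : hom X Y) : ev (fmap Q f) = fmap F f.
Proof. by rewrite /= ev_class /= comp1m. Qed.

Let eta X : hom X (G (F X)) := tr (idm (F X)).

Let F_eta X : fmap F (eta X) = e' (F X).
Proof.
by rewrite -[LHS]comp1m -e'e -compA /eta trK compm1.
Qed.

(** By the triangle identity F sends the unit to the inverse of the counit, and W is exactly the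
    class that F inverts. *)
Let W_eta X : W (eta X).
Proof.
by apply/F_inverts; rewrite F_eta; exists (e (F X)); rewrite ee' e'e.
Qed.

(** After composition with the unit a zigzag becomes the image of the transpose of its evaluation.
    As the unit is inverted, a zigzag is therefore determined up to [zeq] by its evaluation in D. *)
Let zigzag_eta X Y (p : zigzag W X Y) :
  fmap Q (eta Y) ∘m (zclass p : @hom (localization W) X Y)
  = fmap Q (tr (zigzag_eval p)).
Proof.
elim: p => /= [X'|X' Y' Z f p IH|X' Y' Z w Ww p IH].
- by rewrite loc_compE.
- have -> : zclass (ZFwd f p) = loc_comp (zclass p) (zclass (ZFwd f (ZNil W Y'))).
    by rewrite loc_compE.
  rewrite loc_compA IH.
  have := fmapM Q (tr (zigzag_eval p)) f; rewrite /= => <-.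
  by congr (zclass (ZFwd _ _)); apply/esym/trU; rewrite fmapM compA trK.
- have -> : zclass (ZBwd Ww p) = loc_comp (zclass p) (zclass (ZBwd Ww (ZNil W Y'))).
    by rewrite loc_compE.
  rewrite loc_compA IH.
  set u := tr (_ ∘m _); have -> : tr (zigzag_eval p) = u ∘m w.
    by apply: trU; rewrite fmapM compA trK -compA winvl compm1.
  have := fmapM Q u w; rewrite /= => ->; rewrite -loc_compA.
  rewrite [X in loc_comp _ X]loc_compE /=.
  have -> : zclass (ZBwd Ww (ZFwd w (ZNil W X'))) = zclass (ZNil W X').
    by apply/zclass_eq/ZBwdFwd.
  by rewrite loc_compm1.
Qed.

Let Q_eta_cancel X Y (c d : @hom (localization W) X Y) :
  fmap Q (eta Y) ∘m c = fmap Q (eta Y) ∘m d -> c = d.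
Proof.
have [q [q1 _]] := loc_functor_inverts (W_eta Y).
by move=> cd; rewrite -[c]comp1m -[d]comp1m -q1 -!compA cd.
Qed.

Lemma localization_lift_ff : fully_faithful localization_lift.
Proof.
(* The preimage of h is its transpose X -> G (F Y) followed by the formal inverse of the unit at
   Y. *)
move=> X Y h; pose p := ZFwd (tr h) (ZBwd (W_eta Y) (ZNil W Y)).
have pE : zigzag_eval p = h.
  rewrite /= comp1m -[RHS](trK h); congr (_ ∘m _).
  by rewrite -[winv _]compm1 -e'e compA -F_eta winvl comp1m.
exists (zclass p); split=> [|c cE]; first by rewrite /= ev_class.
apply: Q_eta_cancel; rewrite zigzag_eta pE.
by rewrite -[c in RHS]zreprK zigzag_eta -cE.
Qed.

Lemma localization_equiv : equivalent_cat (localization W) D.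
Proof.
apply: (fully_faithful_equiv localization_lift_ff) => Y.
by exists (G Y), (e Y); exact: (eP Y).1.
Qed.

(** The right adjoint is Y |-> G (F Y): morphisms X -> Y of the localization are morphisms F X -> F
    Y by full faithfulness, and these are morphisms X -> G (F Y) of C by transposition. *)
Lemma localization_right_adjoint : has_right_adjoint Q.
Proof.
pose R Y := G (F Y).
pose Rm (Y Y' : localization W) (g : hom Y Y') : hom (R Y) (R Y') :=
  tr (ev g ∘m e (F Y)).
have Rm1 Y : Rm Y Y (idm _) = idm _.
  by apply: trU; rewrite fmap1 compm1 ev1 comp1m.
have RmM Y1 Y2 Y3 (g : hom Y2 Y3) (f : hom Y1 Y2) :
    Rm _ _ (g ∘m f) = Rm _ _ g ∘m Rm _ _ f.
  by apply: trU; rewrite fmapM compA trK -compA trK compA evM.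
exists (@Functor (localization W) C R Rm Rm1 RmM).
exists (fun X Y (c : hom (Q X) Y) => tr (ev c)); split=> [X Y|X' X Y Y' f h g].
  pose back (u : hom X (R Y)) : @hom (localization W) X Y :=
    sval (cid (localization_lift_ff (e (F Y) ∘m fmap F u))).
  have backP u : ev (back u) = e (F Y) ∘m fmap F u.
    exact: (svalP (cid (localization_lift_ff (e (F Y) ∘m fmap F u)))).1.
  exists back => [c|u]; last by apply: trU; rewrite backP.
  have [x [_ xU]] := localization_lift_ff
    (ev c : hom (localization_lift X) (localization_lift Y)).
  by rewrite -[RHS](xU c) //; apply/esym/xU; rewrite /= backP trK.
rewrite /=; apply: trU; rewrite !fmapM !compA trK -!compA.
rewrite [e _ ∘m (_ ∘m _)]compA trK.
rewrite -[loc_comp g h]/(g ∘m h).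
rewrite -[loc_comp _ (zclass _)]/((g ∘m h) ∘m fmap Q f).
by rewrite !evM evQ !compA.
Qed.

End ReflectiveLocalization.

(** * Abelian categories of structured vector spaces *)

Section ConcreteAbelian.
Context (k : fieldType) (O : Type) (U : O -> lmodType k).
Context (P : forall X Y : O, (U X -> U Y) -> Prop).

(** Conditions on underlying linear maps under which kernels, cokernels and biproducts are those of
    vector spaces. [ca_inj] and [ca_surj] promote set-theoretic factorizations to morphisms. *)
Record concrete_abelian : Prop := ConcreteAbelian {
  ca_linear : forall X Y (f : U X -> U Y), P f -> linear f;
  ca_zero : forall X Y, @P X Y (fun _ => 0);
  ca_add : forall X Y (f g : U X -> U Y), P f -> P g -> @P X Y (fun x => f x + g x);
  ca_inj : forall X Y Z (u : U X -> U Y) (i : U Y -> U Z),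
    P i -> injective i -> @P X Z (fun x => i (u x)) -> P u;
  ca_surj : forall X Y Z (q : U X -> U Y) (u : U Y -> U Z),
    P q -> (forall y, exists x, q x = y) -> @P X Z (fun x => u (q x)) -> P u;
  ca_kernel : forall X Y (f : U X -> U Y), P f ->
    exists K (i : U K -> U X),
      [/\ P i, injective i & forall x, f x = 0 <-> exists y, i y = x];
  ca_cokernel : forall X Y (f : U X -> U Y), P f ->
    exists Q (q : U Y -> U Q),
      [/\ P q, forall y, exists x, q x = y &
          forall y, q y = 0 <-> exists x, f x = y];
  ca_biproduct : forall X Y, exists Z (i : U X -> U Z) (j : U Y -> U Z)
      (p : U Z -> U X) (q : U Z -> U Y),
    [/\ P i, P j, P p & P q] /\
    [/\ forall x, p (i x) = x, forall y, q (j y) = y,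
        forall y, p (j y) = 0, forall x, q (i x) = 0 &
        forall z, i (p z) + j (q z) = z];
  ca_inhabited : inhabited O
}.

Context (P1 : forall X, @P X X (fun x => x)).
Context (PM : forall X Y Z (f : U X -> U Y) (g : U Y -> U Z),
  P f -> P g -> @P X Z (fun x => g (f x))).
Local Notation CC := (@concrete_cat O (fun X => U X : Type) P P1 PM).
Context (CA : concrete_abelian).

Local Notation mk f Pf := (exist _ f Pf : @hom CC _ _).

Lemma concrete_homP (X Y : CC) (f g : hom X Y) :
  (forall x, sval f x = sval g x) -> f = g.
Proof.
move: f g => [f Pf] [g Pg] /= fg; have {}fg : f = g by apply/funext.
exact: eq_exist.
Qed.

Lemma concrete_comp (X Y Z : CC) (g : hom Y Z) (f : hom X Y) x :
  sval (g ∘m f) x = sval g (sval f x).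
Proof. by []. Qed.

Lemma concrete_hom0 (X Y : CC) (f : hom X Y) : sval f 0 = 0.
Proof. exact: linear_fun0 (ca_linear CA (svalP f)). Qed.

Lemma concrete_zero_object : exists Z : CC, zero_object Z /\ forall z : U Z, z = 0.
Proof.
have [X0] := ca_inhabited CA.
(* The kernel of an identity morphism is a zero space. *)
have [Z [i [Pi iI ker]]] := ca_kernel CA (P1 X0).
have Z0 (z : U Z) : z = 0.
  apply: iI; rewrite (linear_fun0 (ca_linear CA Pi)).
  by apply/ker; exists z.
exists Z; split=> //; split=> X.
  exists (mk _ (ca_zero CA X Z)); split=> // f _; apply: concrete_homP => x /=.
  by rewrite (Z0 (sval f x)).
exists (mk _ (ca_zero CA Z X)); split=> // f _; apply: concrete_homP => z /=.
by rewrite (Z0 z) concrete_hom0.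
Qed.

Lemma concrete_zero_morphism (X Y : CC) (f : hom X Y) :
  zero_morphism f <-> forall x, sval f x = 0.
Proof.
split=> [[Z [g [h [[Z1 _] ->]]]] x|f0]; last first.
  have [Z [Z0 _]] := concrete_zero_object.
  exists Z, (mk _ (ca_zero CA X Z)), (mk _ (ca_zero CA Z Y)); split=> //.
  exact: concrete_homP.
have [c [_ cU]] := Z1 Z.
have /(congr1 (fun m => sval m (sval g x))) : idm Z = mk _ (ca_zero CA Z Z).
  by rewrite -(cU (idm Z)) // -(cU (mk _ (ca_zero CA Z Z))).
by rewrite concrete_comp /= => ->; exact: concrete_hom0.
Qed.

Definition kernel_map (K X Y : CC) (i : hom K X) (f : hom X Y) : Prop :=
  injective (sval i) /\ forall x, sval f x = 0 <-> exists y, sval i y = x.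

Definition cokernel_map (X Y Q : CC) (q : hom Y Q) (f : hom X Y) : Prop :=
  (forall y, exists x, sval q x = y) /\
  forall y, sval q y = 0 <-> exists x, sval f x = y.

Lemma kernel_map_is_kernel (K X Y : CC) (i : hom K X) (f : hom X Y) :
  kernel_map i f -> is_kernel i f.
Proof.
move=> [iI ker]; split=> [|T g /concrete_zero_morphism fg].
  by apply/concrete_zero_morphism => x /=; apply/ker; exists x.
have /choice[u uP] t : exists y, sval i y = sval g t by apply/ker/fg.
have Pu : P u.
  apply: (ca_inj CA (svalP i) iI).
  have -> : (fun t => sval i (u t)) = sval g by apply/funext.
  exact: svalP g.
exists (mk u Pu); split=> [|v vE]; first exact: concrete_homP.
by apply: concrete_homP => t; apply: iI; rewrite /= uP -vE.
Qed.

(** Kernels are unique up to isomorphism, so a categorical kernel inherits both properties from the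
    concrete one given by [ca_kernel]. *)
Lemma is_kernelP (K X Y : CC) (i : hom K X) (f : hom X Y) :
  is_kernel i f <-> kernel_map i f.
Proof.
split; last exact: kernel_map_is_kernel.
move=> [i0 iU]; have [K0 [j [Pj jI jker]]] := ca_kernel CA (svalP f).
pose j' : @hom CC K0 X := mk j Pj.
have [j0 jU] : is_kernel j' f by apply: kernel_map_is_kernel.
have [u [uP _]] := jU _ _ i0; have [v [vP _]] := iU _ _ j0.
have vu : v ∘m u = idm K.
  have [w [_ wU]] := iU _ _ i0; rewrite -(wU (v ∘m u)) ?compA ?vP //.
  by apply: wU; rewrite compm1.
split=> [x y xy|x]; last first.
  split=> [/jker[z <-]|[y <-]]; last by move/concrete_zero_morphism: i0 => /(_ y).
  by exists (sval v z); rewrite -concrete_comp vP.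
have : sval u x = sval u y by apply: jI; have /(congr1 sval) /= E := uP;
  move: xy; rewrite -uP.
by move=> /(congr1 (sval v)); rewrite -!concrete_comp vu.
Qed.

Lemma cokernel_map_is_cokernel (X Y Q : CC) (q : hom Y Q) (f : hom X Y) :
  cokernel_map q f -> is_cokernel q f.
Proof.
move=> [qS ker]; split=> [|T g /concrete_zero_morphism gf].
  by apply/concrete_zero_morphism => x /=; apply/ker; exists x.
have [r rP] := choice qS.
have E y y' : sval q y = sval q y' -> sval g y = sval g y'.
  move=> yy'; apply/eqP; rewrite -subr_eq0 -(linear_funB (ca_linear CA (svalP g))).
  have /ker[x <-] : sval q (y - y') = 0.
    by rewrite (linear_funB (ca_linear CA (svalP q))) yy' subrr.
  by have := gf x; rewrite /= => ->.
have uP y : sval g (r (sval q y)) = sval g y by exact: E.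
have Pu : @P Q T (fun z => sval g (r z)).
  apply: (ca_surj CA (svalP q) qS).
  have -> : (fun y => sval g (r (sval q y))) = sval g by apply/funext.
  exact: svalP g.
exists (mk _ Pu); split=> [|v vE]; first exact: concrete_homP.
by apply: concrete_homP => z; rewrite /= -vE /= rP.
Qed.

Lemma is_cokernelP (X Y Q : CC) (q : hom Y Q) (f : hom X Y) :
  is_cokernel q f <-> cokernel_map q f.
Proof.
split; last exact: cokernel_map_is_cokernel.
move=> [q0 qU]; have [Q0 [p [Pp pS pker]]] := ca_cokernel CA (svalP f).
pose p' : @hom CC Y Q0 := mk p Pp.
have [p0 pU] : is_cokernel p' f by apply: cokernel_map_is_cokernel.
have [u [uP _]] := pU _ _ q0; have [v [vP _]] := qU _ _ p0.
have uv : u ∘m v = idm Q.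
  have [w [_ wU]] := qU _ _ q0; rewrite -(wU (u ∘m v)) -?compA ?vP //.
  by apply: wU; rewrite comp1m.
split=> [z|y].
  have [y yP] := pS (sval v z); exists y.
  rewrite -[RHS]/(sval (idm Q) z) -uv concrete_comp -yP -uP.
  by [].
split=> [qy|[x <-]]; last by move/concrete_zero_morphism: q0 => /(_ x).
apply/pker; have -> : p y = sval v (sval q y) by rewrite -concrete_comp vP.
by rewrite qy concrete_hom0.
Qed.

(** The inclusion of the kernel and the zero map have the same composite with f, so they
    coincide. *)
Lemma monomorphism_inj (X Y : CC) (f : hom X Y) :
  monomorphism f -> injective (sval f).
Proof.
move=> fm x y xy; have [K [i [Pi iI iker]]] := ca_kernel CA (svalP f).
have /iker[z zE] : sval f (x - y) = 0.
  by rewrite (linear_funB (ca_linear CA (svalP f))) xy subrr.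
have : mk i Pi = mk _ (ca_zero CA K X).
  apply: fm; apply: concrete_homP => t /=.
  by rewrite concrete_hom0; apply/iker; exists t.
move/(congr1 (fun m => sval m z)) => /=; rewrite zE => /eqP.
by rewrite subr_eq0 => /eqP.
Qed.

Lemma epimorphism_surj (X Y : CC) (f : hom X Y) :
  epimorphism f -> forall y, exists x, sval f x = y.
Proof.
move=> fe y; have [Q [q [Pq qS qker]]] := ca_cokernel CA (svalP f).
apply/qker; have : mk q Pq = mk _ (ca_zero CA Y Q).
  by apply: fe; apply: concrete_homP => t /=; apply/qker; exists t.
by move/(congr1 (fun m => sval m y)).
Qed.

Lemma concrete_abelian_cat : abelian CC.
Proof.
have lin X Y (f : @hom CC X Y) : linear (sval f) := ca_linear CA (svalP f).
have funD X Y (f : @hom CC X Y) := linear_funD (lin X Y f).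
split.
- by have [Z [Z0 _]] := concrete_zero_object; exists Z.
- move=> X Y; have [Z [i [j [p [q [[Pi Pj Pp Pq] [pi qj pj qi ij]]]]]]] :=
    ca_biproduct CA X Y.
  exists Z, (mk p Pp), (mk q Pq) => T f g.
  have Pu := ca_add CA (PM (svalP f) Pi) (PM (svalP g) Pj).
  exists (mk _ Pu); split=> [|v [vf vg]]; last first.
    by apply: concrete_homP => t; rewrite /= -vf -vg /= ij.
  split; apply: concrete_homP => t /=.
    by rewrite (linear_funD (ca_linear CA Pp)) pi pj addr0.
  by rewrite (linear_funD (ca_linear CA Pq)) qj qi add0r.
- move=> X Y; have [Z [i [j [p [q [[Pi Pj Pp Pq] [pi qj pj qi ij]]]]]]] :=
    ca_biproduct CA X Y.
  exists Z, (mk i Pi), (mk j Pj) => T f g.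
  have Pu := ca_add CA (PM Pp (svalP f)) (PM Pq (svalP g)).
  exists (mk _ Pu); split=> [|v [vf vg]]; last first.
    by apply: concrete_homP => t; rewrite /= -vf -vg /= -funD ij.
  split; apply: concrete_homP => t /=.
    by rewrite pi qi concrete_hom0 addr0.
  by rewrite pj qj concrete_hom0 add0r.
- move=> X Y f; have [K [i [Pi iI ker]]] := ca_kernel CA (svalP f).
  by exists K, (mk i Pi); apply: kernel_map_is_kernel.
- move=> X Y f; have [Q [q [Pq qS ker]]] := ca_cokernel CA (svalP f).
  by exists Q, (mk q Pq); apply: cokernel_map_is_cokernel.
- move=> X Y f /monomorphism_inj fI.
  have [Q [q [Pq qS ker]]] := ca_cokernel CA (svalP f).
  by exists Q, (mk q Pq); apply: kernel_map_is_kernel.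
- move=> X Y f /epimorphism_surj fS.
  have [K [i [Pi iI ker]]] := ca_kernel CA (svalP f).
  by exists K, (mk i Pi); apply: cokernel_map_is_cokernel.
Qed.

(** Once kernels and cokernels are the concrete ones, [inv] identifies [serre_iso] with the class of
    morphisms inverted by F, and localization along F applies. *)
Theorem concrete_localizing (S : O -> Prop) (D : category) (F : functor CC D) :
  (forall Y, exists X (e : hom (F X) Y), isomorphism e /\ universal_arrow e) ->
  (forall (X' X X'' : CC) (f : hom X' X) (g : hom X X''),
    kernel_map f g -> (forall y, exists x, sval g x = y) ->
    (S X <-> S X' /\ S X'')) ->
  (forall (K X Y Q : CC) (i : hom K X) (f : hom X Y) (q : hom Y Q),
    kernel_map i f -> cokernel_map q f ->
    (S K /\ S Q <-> isomorphism (fmap F f))) ->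
  @localizing CC S /\ equivalent_cat (@serre_quotient CC S) D.
Proof.
move=> univ ext inv.
have invP (X Y : CC) (f : hom X Y) : @serre_iso CC S X Y f <-> isomorphism (fmap F f).
  split=> [[[K [i [/is_kernelP ki SK]]] [Q [q [/is_cokernelP qi SQ]]]]|].
    by apply/(inv _ _ _ _ _ _ _ ki qi).
  have [K [i [Pi iI iker]]] := ca_kernel CA (svalP f).
  have [Q [q [Pq qS qker]]] := ca_cokernel CA (svalP f).
  have ki : kernel_map (mk i Pi) f by [].
  have qi : cokernel_map (mk q Pq) f by [].
  move=> /(inv _ _ _ _ _ _ _ ki qi) [SK SQ].
  split; first by exists K, (mk i Pi); split=> //; apply/is_kernelP.
  by exists Q, (mk q Pq); split=> //; apply/is_cokernelP.
split; last exact: localization_equiv univ invP.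
split; last exact: localization_right_adjoint univ invP.
split=> [|X' X X'' f g [/is_kernelP kf /is_cokernelP [gS _]]].
  exact: concrete_abelian_cat.
exact: ext kf gS.
Qed.

End ConcreteAbelian.

(** E is in effect an equivalence that keeps underlying spaces. Kernels, cokernels and biproducts
    are moved into its image by isomorphisms; this serves the categories of left modules. *)
Lemma concrete_abelian_transport (k : fieldType) (O O2 : Type)
    (U : O -> lmodType k) (P : forall X Y : O, (U X -> U Y) -> Prop)
    (E : O2 -> O) (P2 : forall X Y : O2, (U (E X) -> U (E Y)) -> Prop) :
  (forall X Y Z (f : U X -> U Y) (g : U Y -> U Z),
    P _ _ f -> P _ _ g -> P X Z (fun x => g (f x))) ->
  (forall X Y f, P2 X Y f <-> P (E X) (E Y) f) ->
  (forall Y, exists X (f : U (E X) -> U Y) (g : U Y -> U (E X)),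
     [/\ P _ _ f, P _ _ g, forall x, g (f x) = x & forall y, f (g y) = y]) ->
  concrete_abelian P -> concrete_abelian (U := fun X => U (E X)) P2.
Proof.
move=> PM PP2 ES CA; split=> /=.
- by move=> X Y f /PP2; exact: ca_linear.
- by move=> X Y; apply/PP2/(ca_zero CA).
- by move=> X Y f g /PP2 Pf /PP2 Pg; apply/PP2/(ca_add CA).
- move=> X Y Z u i /PP2 Pi iI /PP2 Pui; apply/PP2.
  exact: (ca_inj CA Pi iI Pui).
- move=> X Y Z q u /PP2 Pq qS /PP2 Puq; apply/PP2.
  exact: (ca_surj CA Pq qS Puq).
- move=> X Y f /PP2 Pf; have [K [i [Pi iI ker]]] := ca_kernel CA Pf.
  have [K' [a [b [Pa Pb ab ba]]]] := ES K.
  exists K', (fun x => i (a x)); split.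
  + by apply/PP2/PM.
  + by move=> x y /iI /(can_inj ab).
  move=> x; split=> [/ker[y <-]|[y <-]]; first by exists (b y); rewrite ba.
  by apply/ker; exists (a y).
- move=> X Y f /PP2 Pf; have [Q [q [Pq qS ker]]] := ca_cokernel CA Pf.
  have [Q' [a [b [Pa Pb ab ba]]]] := ES Q.
  exists Q', (fun x => b (q x)); split.
  + by apply/PP2/PM.
  + by move=> y; have [x xE] := qS (a y); exists x; rewrite xE ab.
  move=> y; rewrite -ker; split=> [by0|->].
    by rewrite -[q y]ba by0 (linear_fun0 (ca_linear CA Pa)).
  exact: linear_fun0 (ca_linear CA Pb).
- move=> X Y; have [Z [i [j [p [q [[Pi Pj Pp Pq] [pi qj pj qi ij]]]]]]] :=
    ca_biproduct CA (E X) (E Y).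
  have [Z' [a [b [Pa Pb ab ba]]]] := ES Z.
  exists Z', (fun x => b (i x)), (fun y => b (j y)), (fun z => p (a z)),
    (fun z => q (a z)); split.
    by split; apply/PP2/PM.
  split=> [x|y|y|x|z]; rewrite ?ba //.
  by rewrite -(linear_funD (ca_linear CA Pb)) ij ab.
- by have [Y] := ca_inhabited CA; have [X _] := ES Y; split; exact: X.
Qed.

(** * Relative Hopf modules *)

Lemma exists_cokernel (k : fieldType) (V W : lmodType k) (f : V -> W) :
  linear f -> exists (Q : lmodType k) (q : W -> Q),
  [/\ linear q, forall y, exists x, q x = y &
      forall y, q y = 0 <-> exists x, f x = y].
Proof.
move=> lf; pose N : set W := fun y => exists x, f x = y.
exists (modquot N), (qproj N); split; first exact: linearP.
  by move=> y; exists (qrepr y); rewrite qreprK.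
move=> y; split=> [/qproj0P|Ny]; last by apply: qproj0.
apply: (span_ind (P := N)) => [|a _ v [x <-] [x' <-]].
  by exists 0; rewrite (linear_fun0 lf).
by exists (a *: x + x'); rewrite lf.
Qed.

Section RightModules.
Context (k : fieldType) (A : algType k).

Definition rmod_mor (M N : rmodule A) (f : M -> N) : Prop :=
  linear f /\ ract_mor (@ract _ _ M) (@ract _ _ N) f.

Lemma ract_linearl (M : rmodule A) a : linear (fun m : M => ract m a).
Proof. exact: (ract_bilinear (ractP M)).1. Qed.
Lemma ract_linearr (M : rmodule A) m : linear (@ract _ _ M m).
Proof. exact: (ract_bilinear (ractP M)).2. Qed.

Lemma ract0 (M : rmodule A) a : ract (0 : M) a = 0.
Proof. exact: linear_fun0 (ract_linearl a). Qed.

Fact ract_selfP : @is_ract k A A (fun x a => x * a).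
Proof.
split=> [|v|v a b]; [|exact: mulr1|exact: mulrA].
split=> [w|v]; first exact: (linear_mulr_comp w (@linear_idfun k A)).
exact: (linear_mull_comp v (@linear_idfun k A)).
Qed.

Lemma rmod_abelian :
  concrete_abelian (U := fun M : rmodule A => M : lmodType k) rmod_mor.
Proof.
split.
- by move=> X Y f [].
- by move=> X Y; split=> [|v a]; [exact: linear_zero | rewrite ract0].
- move=> X Y f g [lf af] [lg ag]; split; first exact: linear_add.
  by move=> v a; rewrite af ag (linear_funD (@ract_linearl Y a)).
- move=> X Y Z u i [li ai] iI [lui aui]; split.
    by move=> c v w; apply: iI; rewrite lui li.
  by move=> v a; apply: iI; rewrite aui ai.
- move=> X Y Z q u [lq aq] qS [luq auq]; split.
    move=> c v w; have [v' <-] := qS v; have [w' <-] := qS w.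
    by rewrite -lq luq.
  by move=> v a; have [v' <-] := qS v; rewrite -aq auq.
- move=> X Y f [lf af]; have [K [i [li iI ker]]] := exists_kernel lf.
  have [|act' [aP iE]] := sub_ract (ractP X) li iI.
    move=> x a; apply/ker; have fx : f (i x) = 0 by apply/ker; exists x.
    by rewrite af fx ract0.
  exists (Rmodule aP), i; split=> //; split=> // x a; exact: iE.
- move=> X Y f [lf af]; have [Q [q [lq qS ker]]] := exists_cokernel lf.
  have [|act' [aP qE]] := quot_ract (ractP Y) lq qS.
    move=> y a /ker[x <-]; apply/ker; exists (ract x a); exact: af.
  by exists (Rmodule aP), q; split=> //; split.
- move=> X Y; exists (Rmodule (prod_ract (ractP X) (ractP Y))).
  exists (fun x => (x, 0)), (fun y => (0, y)), fst, snd; split.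
    split; split=> //.
    + exact: linear_pairl.
    + by move=> v a; rewrite /= /prod_act /= ract0.
    + exact: linear_pairr.
    + by move=> v a; rewrite /= /prod_act /= ract0.
  by split=> // z; rewrite -pair_add.
- exact: (inhabits (Rmodule ract_selfP)).
Qed.

End RightModules.

Section RightHopfModules.
Context (k : fieldType) (H : hopf k) (A : rcoideal_subalg H).

Definition hopf_mor (M N : rhopfmod A) (f : M -> N) : Prop :=
  [/\ linear f, ract_mor (@ract _ _ M) (@ract _ _ N) f &
      rcoact_mor (@rhm_coact _ _ _ M) (@rhm_coact _ _ _ N) f].

(** The coaction with its second factor typed as the algebra H instead of the coalgebra
    [hopf_coalg H], so that products may be formed under [tlift]. *)
Definition hco (M : rhopfmod A) (m : M) : tens M H := rhm_coact m.

Lemma hco_linear (M : rhopfmod A) : linear (@hco M).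
Proof. exact: rcoact_linear (rhm_coactP M). Qed.

Lemma hcoA_tlift (M : rhopfmod A) (U : lmodType k) (F : M -> H -> H -> U) m :
  trilinear_fun F ->
  \tsum_(m0, m1 <- hco m) \tsum_(n0, n1 <- hco m0) F n0 n1 m1
  = \tsum_(m0, m1 <- hco m) \tsum_(c, d <- hcomul m1) F m0 c d.
Proof. exact: rcoactA_tlift (rhm_coactP M). Qed.

Lemma hco1_tlift (M : rhopfmod A) (U : lmodType k) (F : M -> U) m : linear F ->
  \tsum_(m0, m1 <- hco m) (hcounit m1 *: F m0) = F m.
Proof. exact: rcoact1_tlift (rhm_coactP M). Qed.

Lemma hco_ract (M : rhopfmod A) (m : M) (a : A) : hco (ract m a) =
  \tsum_(m0, m1 <- hco m) \tsum_(a1, a2 <- rcomul a) ract m0 a1 ⊗ (m1 * a2).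
Proof. exact: rhm_compat. Qed.

Lemma hco_mor (M N : rhopfmod A) (f : M -> N) m : hopf_mor f ->
  hco (f m) = tmap f (fun h => h) (hco m).
Proof. by move=> [_ _ fc]; exact: fc. Qed.

Lemma hco_mor_tlift (M N : rhopfmod A) (f : M -> N) (U : lmodType k)
    (F : N -> H -> U) m : hopf_mor f -> bilinear_fun F ->
  tlift F (hco (f m)) = \tsum_(m0, m1 <- hco m) F (f m0) m1.
Proof. by move=> fm bF; rewrite (hco_mor _ fm) tlift_tmap. Qed.

Fact hopf_selfP : forall (m a : A), rcomul (m * a) =
  \tsum_(m0, m1 <- rcomul m) \tsum_(a1, a2 <- rcomul a) (m0 * a1) ⊗ (m1 * a2).
Proof. exact: rcomulM. Qed.

Definition hopf_self : rhopfmod A :=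
  @Rhopfmod k H A (Rmodule (@ract_selfP k A)) (@rcomul k H A) (rcomul_rcoact A)
    hopf_selfP.

End RightHopfModules.

Ltac lin_hook ::=
  first [ exact: hcomul_linear | exact: hcounit_scalar | exact: antipode_linear
        | exact: rcomul_linear | exact: aug_scalar | exact: valA_linear
        | exact: ract_linearl | exact: ract_linearr | exact: hco_linear
        | match goal with
          | |- GRing.linear_for _ (tmap _ _) => apply: tmap_linear; lin
          | |- GRing.linear_for _ (fun x => tmap _ _ x) => apply: tmap_linear; lin
          end
        | match goal with f : hopf_mor _ |- _ => by case: f end
        | match goal with f : rmod_mor _ |- _ => by case: f end ].

Section RightHopfAbelian.
Context (k : fieldType) (H : hopf k) (A : rcoideal_subalg H).
Implicit Types (M N : rhopfmod A).

Lemma hopf_mor_zero M N : hopf_mor (fun _ : M => 0 : N).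
Proof.
split; first exact: linear_zero.
  by move=> v a; rewrite ract0.
move=> v; rewrite -[LHS]/(hco 0) (linear_fun0 (@hco_linear _ _ _ N)).
rewrite (eq_tlift (g := fun _ _ => 0)) ?tlift0 // => m h.
exact: linear_fun0 ((tpure_bilinear _ _).1 h).
Qed.

Lemma hopf_mor_add M N f g : hopf_mor f -> hopf_mor g ->
  @hopf_mor _ _ _ M N (fun x => f x + g x).
Proof.
move=> fm gm; have [lf af cf] := fm; have [lg ag cg] := gm.
split; first exact: linear_add.
  by move=> v a; rewrite af ag (linear_funD (@ract_linearl _ _ N a)).
move=> v; rewrite -[LHS]/(hco (f v + g v)) (linear_funD (@hco_linear _ _ _ N)).
rewrite !hco_mor // /tmap -tliftD; apply: eq_tlift => m h.
by rewrite (linear_funD ((tpure_bilinear _ _).1 h)).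
Qed.

Lemma tmap_compat (V W : rmodule A) (i : V -> W) (t : tens V H) a :
  rmod_mor i ->
  tmap i (fun h => h) (\tsum_(m0, m1 <- t) \tsum_(a1, a2 <- rcomul a)
    ract m0 a1 ⊗ (m1 * a2))
  = \tsum_(m0, m1 <- tmap i (fun h => h) t) \tsum_(a1, a2 <- rcomul a)
    ract m0 a1 ⊗ (m1 * a2).
Proof.
move=> im; have [li ai] := im.
rewrite (linear_tlift _ _ (tmap_linear li (@linear_idfun _ _))).
rewrite tlift_tmap; last by lin.
apply: eq_tlift => m0 m1.
rewrite (linear_tlift _ _ (tmap_linear li (@linear_idfun _ _))).
by apply: eq_tlift => a1 a2; rewrite tmapE // ai.
Qed.

Lemma exists_hopf_sub M (K : lmodType k) (i : K -> M) :
  linear i -> injective i ->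
  (forall x a, exists y, i y = ract (i x) a) ->
  (forall x, exists t, tmap i (fun c => c) t = hco (i x)) ->
  exists (K' : rhopfmod A) (i' : K' -> M),
    [/\ hopf_mor i', injective i' &
        forall v, (exists x, i' x = v) <-> (exists x, i x = v)].
Proof.
move=> li iI stA stH.
have [act' [aP aE]] := sub_ract (ractP M) li iI stA.
have [rho' [rP rE]] := sub_rcoact (rhm_coactP M) li iI stH.
have im : @rmod_mor _ _ (Rmodule aP) M i by split.
pose r : Rmodule aP -> tens (Rmodule aP) H := rho'.
have compat (m : Rmodule aP) (a : A) : r (ract m a) =
    \tsum_(m0, m1 <- r m) \tsum_(a1, a2 <- rcomul a)
       ract m0 a1 ⊗ ((m1 : H) * a2).
  apply: (tmap_inj li iI); rewrite /r rE aE -[LHS]/(hco (ract (i m) a)) hco_ract.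
  by rewrite (tmap_compat _ _ im) /= (rE m).
exists (@Rhopfmod _ _ _ (Rmodule aP) _ rP compat), i; split=> //.
by split=> // v; rewrite /= -rE.
Qed.

Lemma exists_hopf_kernel M N (f : M -> N) : hopf_mor f ->
  exists (K : rhopfmod A) (i : K -> M),
    [/\ hopf_mor i, injective i & forall x, f x = 0 <-> exists y, i y = x].
Proof.
move=> fm; have [lf af cf] := fm.
have [K [i [li iI ker]]] := exists_kernel lf.
have fi x : f (i x) = 0 by apply/ker; exists x.
have [||K' [i' [i'm i'I i'E]]] := exists_hopf_sub li iI.
- by move=> x a; apply/ker; rewrite af fi ract0.
(* The coaction restricts to the kernel K because K ⊗ H is the kernel of f ⊗ 1. *)
- move=> x; apply: (tmap_exact li lf) => [v /ker //|].
  by rewrite -(hco_mor _ fm) fi (linear_fun0 (@hco_linear _ _ _ N)).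
by exists K', i'; split=> // x; rewrite i'E.
Qed.

Lemma exists_hopf_cokernel M N (f : M -> N) : hopf_mor f ->
  exists (Q : rhopfmod A) (q : N -> Q),
    [/\ hopf_mor q, forall y, exists x, q x = y &
        forall y, q y = 0 <-> exists x, f x = y].
Proof.
move=> fm; have [lf af cf] := fm.
have [Q [q [lq qS ker]]] := exists_cokernel lf.
have qf x : q (f x) = 0 by apply/ker; exists x.
have [|act' [aP qE]] := quot_ract (ractP N) lq qS.
  by move=> y a /ker[x <-]; rewrite -af qf.
have [|rho' [rP rE]] := quot_rcoact (rhm_coactP N) lq qS.
  move=> y /ker[x <-]; rewrite -[rhm_coact _]/(hco (f x)) (hco_mor _ fm).
  rewrite tmap_comp // /tmap (eq_tlift (g := fun _ _ => 0)) ?tlift0 // => m h.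
  by rewrite /= qf; exact: linear_fun0 ((tpure_bilinear _ _).1 h).
have qm : @rmod_mor _ _ N (Rmodule aP) q by split.
pose r : Rmodule aP -> tens (Rmodule aP) H := rho'.
have compat (m : Rmodule aP) (a : A) : r (ract m a) =
    \tsum_(m0, m1 <- r m) \tsum_(a1, a2 <- rcomul a)
       ract m0 a1 ⊗ ((m1 : H) * a2).
  have [y <-] := qS m; rewrite /r /= -qE -!rE -[rhm_coact _]/(hco (ract y a)) hco_ract.
  by rewrite (tmap_compat _ _ qm).
exists (@Rhopfmod _ _ _ (Rmodule aP) _ rP compat), q; split=> //.
by split=> // v; rewrite /= -rE.
Qed.

Lemma exists_hopf_biproduct M N : exists (Z : rhopfmod A)
    (i : M -> Z) (j : N -> Z) (p : Z -> M) (q : Z -> N),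
    [/\ hopf_mor i, hopf_mor j, hopf_mor p & hopf_mor q] /\
    [/\ forall x, p (i x) = x, forall y, q (j y) = y,
        forall y, p (j y) = 0, forall x, q (i x) = 0 &
        forall z, i (p z) + j (q z) = z].
Proof.
pose aP := prod_ract (ractP M) (ractP N); pose Z := Rmodule aP.
pose rP := prod_rcoact (rhm_coactP M) (rhm_coactP N).
pose rho : Z -> tens Z H := prod_coact (@rhm_coact _ _ _ M) (@rhm_coact _ _ _ N).
have ll := @linear_pairl k M N; have lr := @linear_pairr k M N.
have lM := @hco_linear _ _ _ M; have lN := @hco_linear _ _ _ N.
have im : @rmod_mor _ _ M Z (fun x => (x, 0)).
  by split=> // v a; rewrite /= /prod_act /= ract0.
have jm : @rmod_mor _ _ N Z (fun x => (0, x)).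
  by split=> // v a; rewrite /= /prod_act /= ract0.
have iE x : tmap (fun x => (x, 0)) (fun h : H => h) (hco x) = rho (x, 0).
  exact: (@prod_coactl k (hopf_coalg H) _ _ (@rhm_coact _ _ _ M)
    (@rhm_coact _ _ _ N) x lN).
have jE x : tmap (fun x => (0, x)) (fun h : H => h) (hco x) = rho (0, x).
  exact: (@prod_coactr k (hopf_coalg H) _ _ (@rhm_coact _ _ _ M)
    (@rhm_coact _ _ _ N) x lM).
have lrho : linear rho := @prod_coact_linear k (hopf_coalg H) _ _
  (@rhm_coact _ _ _ M) (@rhm_coact _ _ _ N) lM lN.
have compat (m : Z) (a : A) : rho (ract m a) =
    \tsum_(m0, m1 <- rho m) \tsum_(a1, a2 <- rcomul a)
       ract m0 a1 ⊗ ((m1 : H) * a2).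
  have aE : ract m a = (ract m.1 a, 0) + (0, ract m.2 a) :> Z by exact: pair_add.
  rewrite aE (linear_funD lrho) -iE -jE !hco_ract (tmap_compat _ _ im).
  rewrite (tmap_compat _ _ jm) iE jE.
  have lR : linear (fun t : tens Z H => \tsum_(m0, m1 <- t)
      \tsum_(a1, a2 <- rcomul a) ract m0 a1 ⊗ (m1 * a2)) by lin.
  by rewrite -(linear_funD lR) -(linear_funD lrho) -pair_add.
pose Z' := @Rhopfmod _ _ _ Z rho rP compat.
exists Z', (fun x => (x, 0)), (fun y => (0, y)), fst, snd; split; last first.
  by split=> // z; rewrite -pair_add.
split.
- split; [exact: ll | exact: im.2 |] => v.
  by rewrite -[RHS]/(tmap (fun x => (x, 0)) (fun h : H => h) (hco v)) iE.
- split; [exact: lr | exact: jm.2 |] => v.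
  by rewrite -[RHS]/(tmap (fun x => (0, x)) (fun h : H => h) (hco v)) jE.
- split=> // v; rewrite -[LHS]/(hco v.1).
  rewrite -[RHS]/(@tmap k Z H M H fst (fun h => h) (rho v)).
  have lt : linear (@tmap k Z H M H fst (fun h => h)) by apply: tmap_linear.
  rewrite [v in RHS]pair_add (linear_funD lrho) (linear_funD lt) -iE -jE.
  rewrite !tmap_comp // tmap_id // [X in _ = _ + X](_ : _ = 0) ?addr0 //.
  rewrite /tmap (eq_tlift (g := fun _ _ => 0)) ?tlift0 // => m h /=.
  exact: linear_fun0 ((tpure_bilinear _ _).1 h).
- split=> // v; rewrite -[LHS]/(hco v.2).
  rewrite -[RHS]/(@tmap k Z H N H snd (fun h => h) (rho v)).
  have lt : linear (@tmap k Z H N H snd (fun h => h)) by apply: tmap_linear.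
  rewrite [v in RHS]pair_add (linear_funD lrho) (linear_funD lt) -iE -jE.
  rewrite !tmap_comp // [X in _ = X + _](_ : _ = 0) ?add0r ?tmap_id //.
  rewrite /tmap (eq_tlift (g := fun _ _ => 0)) ?tlift0 // => m h /=.
  exact: linear_fun0 ((tpure_bilinear _ _).1 h).
Qed.

Lemma hopf_abelian :
  concrete_abelian (U := fun M : rhopfmod A => M : lmodType k) (@hopf_mor _ _ A).
Proof.
split.
- by move=> X Y f [].
- exact: hopf_mor_zero.
- exact: hopf_mor_add.
- move=> X Y Z u i im iI um; have [li ai ci] := im; have [lui aui cui] := um.
  have lu : linear u by move=> c v w; apply: iI; rewrite lui li.
  split=> // [v a|v]; first by apply: iI; rewrite aui ai.
  apply: (tmap_inj (f := i) li iI).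
  rewrite -[LHS]/(tmap i (fun h => h) (hco (u v))) -(hco_mor _ im) (hco_mor _ um).
  by rewrite -[\tsum_(_, _ <- _) _]/(tmap u (fun h => h) (hco v)) tmap_comp.
- move=> X Y Z q u qm qS um; have [lq aq cq] := qm; have [luq auq cuq] := um.
  have lu : linear u.
    move=> c v w; have [v' <-] := qS v; have [w' <-] := qS w.
    by rewrite -lq luq.
  split=> // [v a|v]; have [v' <-] := qS v; first by rewrite -aq auq.
  rewrite -[LHS]/(hco (u (q v'))) (hco_mor _ um) -[rhm_coact (q v')]/(hco (q v')).
  rewrite (hco_mor _ qm) -/(tmap u (fun h : H => h) _) tmap_comp //.
- exact: exists_hopf_kernel.
- exact: exists_hopf_cokernel.
- exact: exists_hopf_biproduct.
- exact: (inhabits (hopf_self A)).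
Qed.

End RightHopfAbelian.

(** * The Hopf modules M ⊗ H *)

Section DiagonalHopfModule.
Context (k : fieldType) (H : hopf k) (A : rcoideal_subalg H).
Implicit Types (M N : rmodule A).

(** The diagonal action. In M ⊗_A H one has m a_1 ⊗ S(h a_2) = eps(a) m ⊗ S(h), so m ⊗ h |-> m ⊗
    S(h) compares (M ⊗ H)/(M ⊗ H)A^+ with M ⊗_A H. *)
Definition dact M (t : tens M H) (a : A) : tens M H :=
  \tsum_(m, h <- t) \tsum_(a1, a2 <- rcomul a) ract m a1 ⊗ (h * a2).

Definition dco M (t : tens M H) : tens (tens M H) H :=
  \tsum_(m, h <- t) \tsum_(h1, h2 <- hcomul h) (m ⊗ h1) ⊗ h2.

Lemma dact_bilinear M : bilinear_fun (@dact M).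
Proof. by rewrite /dact; lin. Qed.

Lemma dco_linear M : linear (@dco M).
Proof. by rewrite /dco; lin. Qed.

Lemma dactE M (m : M) h a :
  dact (m ⊗ h) a = \tsum_(a1, a2 <- rcomul a) ract m a1 ⊗ (h * a2).
Proof. by rewrite /dact tliftE //; lin. Qed.

Lemma dcoE M (m : M) h :
  dco (m ⊗ h) = \tsum_(h1, h2 <- hcomul h) (m ⊗ h1) ⊗ h2.
Proof. by rewrite /dco tliftE //; lin. Qed.

Fact dact_ract M : is_ract (@dact M).
Proof.
have [bl br] := @dact_bilinear M.
split; first by split.
- apply: tens_ext; [exact: bl | exact: linear_idfun |] => m h.
  by rewrite dactE rcomul1 tliftE ?(ractm1 (ractP M)) ?mulr1 //; lin.
- move=> v a b; move: v; apply: tens_ext; [lin | lin |] => m h.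
  rewrite !dactE rcomulM tlift_tlift; last by lin.
  rewrite (linear_tlift _ _ (bl b)); apply: eq_tlift => a1 a2.
  rewrite tlift_tlift; last by lin.
  rewrite dactE; apply: eq_tlift => b1 b2.
  by rewrite tliftE ?(ractA (ractP M)) ?mulrA //; lin.
Qed.

Fact dco_rcoact M : @is_rcoact k (hopf_coalg H) _ (@dco M).
Proof.
have lco := @dco_linear M.
have lc := @hcomul_linear k H.
split; first exact: dco_linear.
- apply: tens_ext => [||m h]; [lin | lin |].
  rewrite !dcoE !tlift_tlift; try by lin.
  transitivity (\tsum_(y, z <- hcomul h) \tsum_(y1, y2 <- hcomul y)
      ((m ⊗ y1) ⊗ (y2 ⊗ z))).
    apply: eq_tlift => y z; rewrite tliftE; last by lin.
    rewrite dcoE tlift_tlift; last by lin.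
    by apply: eq_tlift => y1 y2; rewrite tliftE //; lin.
  rewrite hcomulA_tlift; last by trilin.
  apply: eq_tlift => y z; rewrite tliftE /=; last by lin.
  rewrite -[in RHS](tlift_id (hcomul z)).
  by rewrite (linear_tlift _ _ ((tpure_bilinear _ _).2 _)).
- apply: tens_ext => [||m h].
  + apply: linear_tlift_comp => //.
    have le := @hcounit_scalar k H.
    by lin.
  + exact: linear_idfun.
  have le := @hcounit_scalar k H.
  rewrite dcoE tlift_tlift; last by lin.
  rewrite -[RHS](hcounitr_tlift (F := fun h => m ⊗ h)); last by lin.
  by apply: eq_tlift => y z; rewrite tliftE //; lin.
Qed.

Fact dact_dco M (t : tens M H) (a : A) : dco (dact t a) =
  \tsum_(m0, m1 <- dco t) \tsum_(a1, a2 <- rcomul a) dact m0 a1 ⊗ (m1 * a2).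
Proof.
have [bl br] := @dact_bilinear M; have lco := @dco_linear M.
move: t; apply: tens_ext => [||m h]; [lin | lin |].
rewrite dactE dcoE tlift_tlift; last by lin.
rewrite (linear_tlift _ _ lco).
transitivity (\tsum_(a1, a2 <- rcomul a) \tsum_(h1, h2 <- hcomul h)
    \tsum_(b1, b2 <- hcomul a2) ((ract m a1 ⊗ (h1 * b1)) ⊗ (h2 * b2))).
  apply: eq_tlift => a1 a2; rewrite dcoE (hopf_comulM (hopfP H)) tlift_tlift.
    apply: eq_tlift => h1 h2; rewrite tlift_tlift; last by lin.
    by apply: eq_tlift => b1 b2; rewrite tliftE //; lin.
  by lin.
rewrite tlift_swap; apply: eq_tlift => h1 h2; rewrite tliftE; last by lin.
rewrite -rcomulA_tlift; last by trilin.
apply: eq_tlift => a1 a2; rewrite dactE.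
by rewrite (linear_tlift _ _ ((tpure_bilinear _ _).1 _)).
Qed.

Definition diag_hopf M : rhopfmod A :=
  @Rhopfmod k H A (Rmodule (@dact_ract M)) _ (@dco_rcoact M) (@dact_dco M).

Lemma tmap_hopf_mor M N (f : M -> N) : rmod_mor f ->
  @hopf_mor _ _ _ (diag_hopf M) (diag_hopf N) (tmap f (fun h => h)).
Proof.
move=> fm; have [lf af] := fm.
have lt : linear (@tmap k M H N H f (fun h => h)) by apply: tmap_linear.
have [bl br] := @dact_bilinear M; have [bl' br'] := @dact_bilinear N.
split=> //.
- move=> t a; move: t; apply: tens_ext => [||m h].
  + exact: linear_comp (bl a) lt.
  + exact: linear_comp lt (bl' a).
  rewrite /= tmapE // !dactE (linear_tlift _ _ lt).
  by apply: eq_tlift => a1 a2; rewrite tmapE // af.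
- move=> t; rewrite -[LHS]/(dco (tmap f (fun h => h) t)).
  rewrite -[RHS]/(tmap (tmap f (fun h : H => h)) (fun h : H => h) (dco t)).
  have ltt := tmap_linear lt (@linear_idfun k H).
  move: t; apply: tens_ext => [||m h].
  + exact: linear_comp lt (@dco_linear N).
  + exact: linear_comp (@dco_linear M) ltt.
  rewrite tmapE // !dcoE (linear_tlift _ _ ltt).
  by apply: eq_tlift => h1 h2; rewrite !tmapE.
Qed.

End DiagonalHopfModule.

(** * The subspace MA^+ and its behaviour under morphisms *)

Section Augmentation.
Context (k : fieldType) (H : hopf k) (A : rcoideal_subalg H).

(** Only the generators are collected; the subspace MA^+ is [span (maug M)]. *)
Definition maug (M : rmodule A) : set M :=
  fun v => exists (m : M) (a : A), aug a = 0 /\ v = ract m a.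

Arguments maug M _ : clear implicits.

Lemma mem_maug (M : rmodule A) (m : M) (a : A) :
  aug a = 0 -> ract m a \in span (maug M).
Proof. by move=> a0; apply: mem_span; exists m, a. Qed.

Lemma ract_aug (M : rmodule A) (m : M) (a : A) :
  qproj (maug M) (ract m a) = aug a *: qproj (maug M) m.
Proof.
rewrite -linearZ; apply/qproj_eq.
have -> : ract m a - aug a *: m = ract m (a - aug a *: 1).
  rewrite (linear_funB (ract_linearr m)).
  by rewrite (linear_funZ _ _ (ract_linearr m)) (ractm1 (ractP M)).
by apply: mem_maug; rewrite augB augZ aug1 mulr1 subrr.
Qed.

Lemma maug_map (M N : rmodule A) (f : M -> N) m : rmod_mor f ->
  m \in span (maug M) -> f m \in span (maug N).
Proof.
move=> [lf af]; apply: span_linear => // _ [x [a [a0 ->]]].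
by rewrite af; exact: mem_maug.
Qed.

Lemma maug_lift (M N : rmodule A) (f : M -> N) : rmod_mor f ->
  (forall y, exists x, f x = y) ->
  forall n, n \in span (maug N) -> exists m, m \in span (maug M) /\ f m = n.
Proof.
move=> [lf af] fS n.
apply: (span_ind (P := fun n => exists m, m \in span (maug M) /\ f m = n)).
  by exists 0; rewrite rpred0 (linear_fun0 lf).
move=> c u v [x [a [a0 ->]]] [m [mM <-]]; have [y <-] := fS x.
exists (c *: ract y a + m); rewrite lf af; split=> //.
by rewrite rpredD // rpredZ // mem_maug.
Qed.

(* Left exactness of the functor M |-> M/MA^+ on M_A^H. *)
Definition aug_exact : Prop :=
  forall (M N : rhopfmod A) (g : M -> N), hopf_mor g -> injective g ->
  forall m, g m \in span (maug N) -> m \in span (maug M).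

Lemma hopf_rmod_mor (M N : rhopfmod A) (f : M -> N) : hopf_mor f -> rmod_mor f.
Proof. by case. Qed.

(** g is factored through its image, realized as the cokernel Q of its kernel. The hypothesis
    applies to the injection of Q into N, and the result is lifted along the surjection q. *)
Lemma aug_exact_image (M N : rhopfmod A) (g : M -> N) : aug_exact ->
  hopf_mor g -> forall m, g m \in span (maug N) ->
  exists m', m' \in span (maug M) /\ g m' = g m.
Proof.
move=> ex gm m gmN; have [lg ag cg] := gm.
have [K [i [im iI iker]]] := exists_hopf_kernel gm.
have [Q [q [qm qS qker]]] := exists_hopf_cokernel im.
have [r rP] := choice qS; have [lq aq cq] := qm.
have E x y : q x = q y <-> g x = g y.
  have -> : q x = q y <-> q (x - y) = 0.
    by rewrite (linear_funB lq); split=> [->|/eqP]; rewrite ?subrr // subr_eq0 => /eqP.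
  rewrite qker -iker (linear_funB lg).
  by split=> [/eqP|->]; rewrite ?subrr // subr_eq0 => /eqP.
have uE x : g (r (q x)) = g x by apply/E.
have um : hopf_mor (fun z => g (r z)).
  apply: (ca_surj (@hopf_abelian k H A) qm qS).
  by have -> : (fun x => g (r (q x))) = g by apply/funext.
have uI : injective (fun z => g (r z)) by move=> z z' /E; rewrite !rP.
have /(maug_lift (hopf_rmod_mor qm) qS)[m' [m'M m'E]] : q m \in span (maug Q).
  by apply: (ex _ _ _ um uI); rewrite uE.
by exists m'; split=> //; apply/E.
Qed.

End Augmentation.
Arguments maug {k H A} M _.

Lemma tlift_mem (k : fieldType) (V W U : lmodType k) (N : set U)
    (F : V -> W -> U) t :
  (forall v w, F v w \in span N) -> tlift F t \in span N.
Proof.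
move=> FN; rewrite /tlift; move: (qrepr t) => {}t.
rewrite -[t]freeg_repr fglift_Freeg /prelift; apply: rpred_sum => p _.
by apply: rpredZ; exact: FN.
Qed.

(** * Flatness makes M |-> M/MA^+ left exact *)

Section FlatExact.
Context (k : fieldType) (H : hopf k) (A : rcoideal_subalg H).
Local Notation S := (@antipode k H).
Local Notation HA := (Lmodule (left_regularP A)).

(* m |-> m_0 ⊗ S(m_1) identifies M/MA^+ with a subspace of M ⊗_A H *)
Let phi (M : rhopfmod A) (m : M) : tensA M HA :=
  qproj _ (\tsum_(m0, m1 <- hco m) m0 ⊗ (S m1 : HA)).

Let phi_linear (M : rhopfmod A) : linear (@phi M).
Proof.
pose E (m : M) := \tsum_(m0, m1 <- hco m) m0 ⊗ (S m1 : HA).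
have lE : linear E by rewrite /E; lin.
by move=> c u v; rewrite /phi -!/(E _) lE linearP.
Qed.

(** Over A, m_0 a_1 ⊗ S(a_2) S(m_1) equals m_0 ⊗ a_1 S(a_2) S(m_1), and the antipode axiom contracts
    the product. It is essential here that a_1 lies in A. *)
Let phi_act (M : rhopfmod A) (m : M) a : phi (ract m a) = aug a *: phi m.
Proof.
rewrite /phi hco_ract tlift_tlift; last by lin.
rewrite -!linearZ -tliftZ !(linear_tlift _ _ (@linearP _ _ _ _ (qproj _))).
apply: eq_tlift => m0 m1; rewrite tlift_tlift; last by lin.
rewrite (linear_tlift _ _ (@linearP _ _ _ _ (qproj _))).
pose F (x : H) : tensA M HA := qproj _ (m0 ⊗ (x * S m1 : HA)).
have lF : linear F by rewrite /F; lin.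
rewrite linearZ.
transitivity (aug a *: F 1); last by rewrite /F mul1r.
rewrite -antipoder_tlift // rcomul_tlift; last first.
  by split=> w; lin.
apply: eq_tlift => a1 a2; rewrite tliftE; last by lin.
rewrite /F antipodeM -mulrA; apply/qproj_eq/mem_span.
exact: (TensA m0 a1 (S a2 * S m1 : HA)).
Qed.

(** The map phi is natural and kills NA^+, so flatness gives phi m = 0. It remains to recover the
    class of m from phi m. *)
Lemma flat_aug_exact : left_flat_over A -> aug_exact A.
Proof.
move=> flat M N g gm gI m gmN; have [lg ag cg] := gm.
pose f : @hom (Mod_r A) M N := exist _ g (conj lg ag).
have fphi x : tensA_mapl (sval f) (phi x) = phi (g x).
  rewrite /phi tensA_maplE; congr (qproj _ _).
  rewrite hco_mor_tlift //; last by lin.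
  rewrite tlift_tlift; last by lin.
  by apply: eq_tlift => m0 m1; rewrite tliftE //; lin.
have phi0 : phi (g m) = 0.
  apply: span_vanish gmN; first exact: phi_linear.
  by move=> _ [n [a [a0 ->]]]; rewrite phi_act a0 scale0r.
have {phi0} : phi m = phi 0.
  apply: (flat M N f gI); rewrite !fphi phi0 (linear_fun0 lg).
  by rewrite (linear_fun0 (@phi_linear N)).
rewrite (linear_fun0 (@phi_linear M)) => phi0; apply/qproj0P.
(* A retraction of phi: x ⊗ h |-> eps(h) [x] descends to M ⊗_A H because A acts on M/MA^+ through
   eps, and it sends phi m to the class of m since eps S = eps. *)
pose E (t : tens M HA) := \tsum_(x, h <- t) (hcounit (h : H) *: qproj (maug M) x).
have lE : linear E by rewrite /E; lin.
have EN t : tensA_rel (M := M) (N := HA) t -> E t = 0.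
  case=> x a h; rewrite (linear_funB lE) /E !tliftE; try by lin.
  rewrite ract_aug /= (hopf_counitM (hopfP H)) scalerA mulrC.
  by rewrite /aug mulrC subrr.
have := qliftE lE EN (\tsum_(m0, m1 <- hco m) m0 ⊗ (S m1 : HA)).
rewrite -/(phi m) phi0 (linear_fun0 (qlift_linear lE EN)) => E0.
rewrite [RHS]E0 /E tlift_tlift; last by lin.
rewrite -[LHS](hco1_tlift (F := qproj (maug M))); last exact: linearP.
apply: eq_tlift => m0 m1; rewrite tliftE; last by lin.
by rewrite counit_antipode.
Qed.

End FlatExact.

(** * Torsion modules as the modules killed by the quotient functors *)

Section Torsion.
Context (k : fieldType) (H : hopf k) (A : rcoideal_subalg H).
Local Notation S := (@antipode k H).
Local Notation valA := (val : A -> H).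

(** [costable] is stated inside H ⊗ H; injectivity of A ⊗ H -> H ⊗ H brings it back to A ⊗ H, where
    A can act. *)
Lemma costable_rcomul (I : set A) x : costable I -> I x ->
  rcomul x \in span [set t : tens A H | exists i h, I i /\ t = i ⊗ h].
Proof.
pose N : set (tens A H) := [set t : tens A H | exists i h, I i /\ t = i ⊗ h].
move=> coI Ix; rewrite -/N.
have : exists t, t \in span N /\ tens_val t = hcomul (valA x).
  have := coI x Ix; move: (hcomul (valA x)) => u.
  pose P u := exists t, t \in span N /\ tens_val t = u.
  move: u; apply: (span_ind (P := P)) => [|c u v [i [h [Ii ->]]] [t [tN <-]]].
    by exists 0; rewrite rpred0 (linear_fun0 (@tens_val_linear _ _ A)).
  exists (c *: (i ⊗ h) + t); rewrite tens_val_linear tens_valE; split=> //.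
  by rewrite rpredD // rpredZ // mem_span //; exists i, h.
by move=> [t [tN]]; rewrite -rcomulE => /tens_val_inj <-.
Qed.

(** If eps vanished on I, then x = eps(x_1) x_2 would be zero for every x in I, since the first
    factors of Δ(x) can be taken in I. *)
Lemma costable_aug (I : set A) : costable I -> nonzero_set I ->
  exists j, I j /\ aug j != 0.
Proof.
move=> coI [x [Ix x0]]; apply: contrapT => nj.
have I0 i : I i -> aug i = 0.
  by move=> Ii; apply: contrapT => /eqP i0; apply: nj; exists i.
case/negP: x0; apply/eqP/val_inj; rewrite [RHS](linear_fun0 (@valA_linear k H A)).
rewrite -[LHS](hcounitl_tlift (F := fun h : H => h)) //.
have := coI x Ix; move: (hcomul (valA x)) => u; move: u; apply: span_vanish.
  by lin.
move=> _ [i [h [Ii ->]]]; rewrite tliftE; last by lin.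
by rewrite -/(aug i) I0 // scale0r.
Qed.

Lemma annihilated_aug (M : rmodule A) (m : M) (I : set A) :
  costable I -> nonzero_set I -> (forall x, I x -> ract m x = 0) ->
  m \in span (maug M).
Proof.
move=> coI nI mI; have [j [Ij j0]] := costable_aug coI nI.
have -> : m = ract m (1 - (aug j)^-1 *: j).
  rewrite (linear_funB (ract_linearr m)) (linear_funZ _ _ (ract_linearr m)).
  by rewrite (mI j Ij) scaler0 subr0 (ractm1 (ractP M)).
by apply: mem_maug; rewrite augB augZ aug1 mulVf // subrr.
Qed.

Lemma annihilated_diag (M : rmodule A) (m : M) h (I : set A) :
  costable I -> (forall x, I x -> ract m x = 0) ->
  forall x, I x -> dact (m ⊗ h) x = 0.
Proof.
move=> coI mI x Ix; rewrite dactE; move: (costable_rcomul coI Ix).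
apply: span_vanish => [|_ [i [g [Ii ->]]]]; first by lin.
rewrite tliftE; last by lin.
by rewrite mI // (linear_fun0 ((tpure_bilinear _ _).1 _)).
Qed.

Lemma torsion_diag_aug (M : rmodule A) : torsion_r M ->
  forall t : tens M H, t \in span (maug (diag_hopf M)).
Proof.
move=> tM; apply: tens_ind => [|m h t tN]; first exact: rpred0.
rewrite rpredD //; have [I [_ coI nI mI]] := tM m.
exact: (@annihilated_aug (diag_hopf M) _ I coI nI (annihilated_diag _ coI mI)).
Qed.

Lemma aug_torsion_diag (M : rmodule A) : aug_exact A ->
  (forall t : tens M H, t \in span (maug (diag_hopf M))) -> torsion_r M.
Proof.
move=> ex tM m; pose g (a : A) : diag_hopf M := dact (m ⊗ 1) a.
have gm : @hopf_mor _ _ _ (hopf_self A) (diag_hopf M) g.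
  split; first exact: (dact_bilinear M).2.
    by move=> v a; exact: (ractA (dact_ract M)).
  move=> a; rewrite -[LHS]/(dco (dact (m ⊗ 1) a)) dact_dco dcoE.
  rewrite (hopf_comul1 (hopfP H)) tliftE; last by lin.
  have [bl br] := dact_bilinear M; rewrite tliftE; last by lin.
  by apply: eq_tlift => a1 a2; rewrite mul1r.
have [lg ag cg] := gm.
exists (fun a => g a = 0); split.
- split=> [|x y gx gy|x a gx]; first exact: linear_fun0.
    by rewrite (linear_funD lg) gx gy addr0.
  by rewrite (ag x a) gx ract0.
- move=> x gx; have [K [i [li iI ker]]] := exists_kernel lg.
  (* With K the kernel of g, costability holds because g is colinear and K ⊗ H is the kernel of g ⊗
     1. *)
  have [s sE] : exists s, @tmap _ K H A H i (fun h => h) s = rcomul x.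
    apply: (tmap_exact li lg) => [v /ker //|].
    rewrite -[LHS](hco_mor (M := hopf_self A) (N := diag_hopf M) x gm) gx.
    exact: linear_fun0 (@hco_linear _ _ _ (diag_hopf M)).
  rewrite -rcomulE -sE; move: s {sE}; have lt := @tens_val_linear _ _ A.
  have ltm : linear (@tmap _ K H A H i (fun h => h)) by apply: tmap_linear.
  apply: tens_ind => [|v h t tN].
    by rewrite (linear_fun0 ltm) (linear_fun0 lt) rpred0.
  rewrite (linear_funD ltm) (linear_funD lt) rpredD //.
  rewrite tmapE // tens_valE mem_span //; exists (i v), h; split=> //.
  by apply/ker; exists v.
- apply: contrapT => nz.
  have gI : injective g.
    move=> x y xy; apply/eqP; rewrite -subr_eq0; apply: contrapT => /negP xy0.
    by apply: nz; exists (x - y); rewrite (linear_funB lg) xy subrr.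
  have : aug (1 : A) *: (1 : H) = 0.
    have := ex _ _ _ gm gI 1 (tM _).
    apply: (span_vanish (f := fun a : A => aug a *: (1 : H))); first by lin.
    by move=> _ [a [b [b0 ->]]]; rewrite /= augM b0 mulr0 scale0r.
  by rewrite aug1 scale1r => /eqP; rewrite oner_eq0.
- move=> x gx; rewrite -[LHS](rcomul_counitr (F := fun a => ract m a)); last by lin.
  (* Applying eps to the second factor of m x_1 ⊗ x_2 gives back m x. *)
  pose E (t : tens M H) := \tsum_(y, h <- t) (hcounit h *: y).
  have lE : linear E by rewrite /E; lin.
  rewrite -(linear_fun0 lE) -gx /g dactE (linear_tlift _ _ lE).
  by apply: eq_tlift => a1 a2; rewrite /E tliftE ?mul1r //; lin.
Qed.

Lemma torsion_diagP (M : rmodule A) : aug_exact A ->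
  (torsion_r M <-> forall t : tens M H, t \in span (maug (diag_hopf M))).
Proof.
by move=> ex; split; [exact: torsion_diag_aug | exact: aug_torsion_diag].
Qed.

(** If M = MA^+ then M ⊗ H = (M ⊗ H)A^+: each [theta h] is an A-linear map M -> M ⊗ H, and their
    images span, because m ⊗ h is the sum of the theta (h T(m_1)) m_0. The inverse antipode occurs
    through T(m_2) m_1 = eps. *)
Lemma torsion_hopfP (M : rhopfmod A) (T : H -> H) :
  cancel S T -> cancel T S -> aug_exact A ->
  (torsion_r M <-> forall m : M, m \in span (maug M)).
Proof.
move=> ST TS ex; split=> [tM m|Maug].
  by have [I [_ coI nI mI]] := tM m; exact: annihilated_aug mI.
apply: aug_torsion_diag => //.
have lT := antipode_inv_linear ST TS.
pose theta h (m : M) : diag_hopf M := \tsum_(m0, m1 <- hco m) m0 ⊗ (h * m1).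
have thetam h : @rmod_mor _ _ M (diag_hopf M) (theta h).
  split; first by rewrite /theta; lin.
  have [bl br] := dact_bilinear M.
  move=> m a; rewrite /theta hco_ract tlift_tlift; last by lin.
  rewrite /= (linear_tlift _ _ (bl a)); apply: eq_tlift => m0 m1.
  rewrite tlift_tlift; last by lin.
  rewrite dactE; apply: eq_tlift => a1 a2.
  by rewrite tliftE ?mulrA //; lin.
apply: tens_ind => [|m h t tN]; first exact: rpred0.
rewrite rpredD //.
have -> : m ⊗ h = \tsum_(m0, m1 <- hco m) theta (h * T m1) m0.
  rewrite /theta hcoA_tlift; last by trilin.
  rewrite -(hco1_tlift (F := fun m => m ⊗ h) m); last by lin.
  apply: eq_tlift => m0 m1.
  transitivity (hcounit m1 *: (m0 ⊗ (h * 1))); first by rewrite mulr1.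
  rewrite -(antipode_invl_tlift (T := T) ST TS (F := fun x => m0 ⊗ (h * x))).
    by apply: eq_tlift => c d; rewrite mulrA.
  by lin.
by apply: tlift_mem => m0 m1; exact: (maug_map (thetam _) (Maug _)).
Qed.

End Torsion.

Lemma concrete_isomorphism (O : Type) (U : O -> Type)
    (P : forall X Y : O, (U X -> U Y) -> Prop)
    (P1 : forall X, @P X X (fun x => x))
    (PM : forall X Y Z (f : U X -> U Y) (g : U Y -> U Z),
       P _ _ f -> P _ _ g -> @P X Z (fun x => g (f x)))
    (X Y : concrete_cat P1 PM) (f : hom X Y) :
  (forall X Y f g, P X Y f -> cancel f g -> cancel g f -> P Y X g) ->
  isomorphism f <-> injective (sval f) /\ forall y, exists x, sval f x = y.
Proof.
move=> Pinv; split=> [[g [gf fg]]|[fI /choice[g gP]]].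
  have K1 x : sval g (sval f x) = x.
    by rewrite -[LHS]/(sval (g ∘m f) x) gf.
  have K2 y : sval f (sval g y) = y.
    by rewrite -[LHS]/(sval (f ∘m g) y) fg.
  by split; [exact: can_inj K1 | move=> y; exists (sval g y)].
have fK : cancel (sval f) g by move=> x; apply: fI; rewrite gP.
exists (exist _ g (Pinv _ _ _ _ (svalP f) fK gP)).
by split; apply: eq_exist; apply/funext.
Qed.

(** * The functor M |-> M/MA^+ with values in C-comodules *)

Section QuotientMaps.
Context (k : fieldType) (H : hopf k) (A : rcoideal_subalg H).
Implicit Types (M N : rmodule A).

Definition qmap M N (f : M -> N) (x : modquot (maug M)) : modquot (maug N) :=
  qproj (maug N) (f (qrepr x)).

Lemma qproj_linear_fun M : linear (qproj (maug M)).
Proof. exact: linearP. Qed.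

Lemma qmap_vanish M N (f : M -> N) : rmod_mor f ->
  forall v, maug M v -> qproj (maug N) (f v) = 0.
Proof.
by move=> fm v Mv; apply/qproj0P; apply: (maug_map fm); exact: mem_span.
Qed.

Lemma qmapE M N (f : M -> N) m : rmod_mor f ->
  qmap f (qproj (maug M) m) = qproj (maug N) (f m).
Proof.
move=> fm; have lf := fm.1.
apply: (qliftE (f := fun v => qproj (maug N) (f v)) _ (qmap_vanish fm)).
exact: linear_comp lf (@qproj_linear_fun N).
Qed.

Lemma qmap_linear M N (f : M -> N) : rmod_mor f -> linear (qmap f).
Proof.
move=> fm; apply: qlift_linear (qmap_vanish fm).
exact: linear_comp fm.1 (@qproj_linear_fun N).
Qed.

(** Bijectivity of [qmap f] expressed on representatives, the form in which exactness is applied. *)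
Definition aug_iso M N (f : M -> N) : Prop :=
  (forall m, f m \in span (maug N) -> m \in span (maug M)) /\
  (forall n, exists m, n - f m \in span (maug N)).

Lemma aug_isoP M N (f : M -> N) : rmod_mor f ->
  (injective (qmap f) /\ forall y, exists x, qmap f x = y) <-> aug_iso f.
Proof.
move=> fm; have lq := qmap_linear fm; split=> [[fI fS]|[fI fS]]; split.
- move=> m /qproj0P; rewrite -qmapE // -(linear_fun0 lq) => /fI E.
  by apply/qproj0P.
- move=> n; have [x xE] := fS (qproj (maug N) n); exists (qrepr x).
  by apply/qproj_eq; rewrite -xE -{1}[x]qreprK qmapE.
- move=> x y; rewrite -[x]qreprK -[y]qreprK !qmapE // => /qproj_eq.
  by rewrite -(linear_funB fm.1) => /fI /qproj_eq.
- move=> y; have [m mE] := fS (qrepr y); exists (qproj (maug M) m).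
  by rewrite qmapE // -[RHS]qreprK; apply/esym/qproj_eq.
Qed.

Lemma qmap_id M x : qmap (fun m : M => m) x = x.
Proof. exact: qreprK. Qed.

Lemma qmap_comp M N (K : rmodule A) (f : M -> N) (g : N -> K) x : rmod_mor f -> rmod_mor g ->
  qmap (fun m => g (f m)) x = qmap g (qmap f x).
Proof. by move=> fm gm; rewrite {3}/qmap qmapE. Qed.

End QuotientMaps.

Section ComoduleQuotient.
Context (k : fieldType) (H : hopf k) (A : rcoideal_subalg H).
Local Notation C := (HA_coalg A).
Local Notation pi := (qproj (@HAplus_gen k H A) : H -> HA_quot A).

Lemma pi_linear : linear pi.
Proof. exact: linearP. Qed.

Fact pi_coact (M : rhopfmod A) :
  @is_rcoact k C M (fun m => tmap (fun m => m) pi (hco m)).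
Proof.
have lp := pi_linear.
have lq : linear (@qcomul k H A) := @qcomul_linear k H A.
have lqe : scalar (@qcounit k H A) := @qcounit_linear k H A.
split.
- by rewrite /tmap; lin.
- move=> m; rewrite !tlift_tmap; try by lin.
  transitivity (\tsum_(m0, m1 <- hco m) \tsum_(n0, n1 <- hco m0)
      (n0 ⊗ (pi n1 ⊗ pi m1))).
    by apply: eq_tlift => m0 m1; rewrite tlift_tmap //; lin.
  rewrite hcoA_tlift; last by trilin.
  apply: eq_tlift => m0 m1; rewrite /= qcomulE.
  by rewrite (linear_tlift _ _ ((tpure_bilinear _ _).2 _)).
- move=> m; rewrite tlift_tmap; last by lin.
  rewrite -[RHS](hco1_tlift (F := fun m => m)) //.
  by apply: eq_tlift => m0 m1; rewrite /= qcounitE.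
Qed.

(** The coaction of m a becomes eps(a_1) [m_0] ⊗ pi(m_1 a_2) = [m_0] ⊗ pi(m_1 a), and pi(m_1 a) =
    eps(a) pi(m_1). *)
Lemma tmap_pi_aug (M : rhopfmod A) x : qproj (maug M) x = 0 ->
  tmap (qproj (maug M)) pi (hco x) = 0.
Proof.
have lp := pi_linear; have lq := @qproj_linear_fun _ _ _ M.
move=> /qproj0P.
apply: (span_vanish (f := fun x => tmap (qproj (maug M)) pi (hco x))).
  by rewrite /tmap; lin.
move=> _ [m [a [a0 ->]]]; rewrite hco_ract /tmap tlift_tlift; last by lin.
rewrite -[RHS](@tlift0 k M H _ (hco m)); apply: eq_tlift => m0 m1.
rewrite tlift_tlift; last by lin.
transitivity (qproj (maug M) m0 ⊗ pi (m1 * val a)); last first.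
  rewrite pi_aug -/(aug a) a0 scale0r.
  exact: linear_fun0 ((tpure_bilinear _ _).2 _).
rewrite -(rcomul_counitl (F := fun h => qproj (maug M) m0 ⊗ pi (m1 * h))); last by lin.
apply: eq_tlift => a1 a2; rewrite tliftE; last by lin.
by rewrite ract_aug (linear_funZ _ _ ((tpure_bilinear _ _).1 _)).
Qed.

Lemma exists_quotient_coact (M : rhopfmod A) :
  exists rho : modquot (maug M) -> tens (modquot (maug M)) C,
    is_rcoact rho /\
    forall x, tmap (qproj (maug M)) pi (hco x) = rho (qproj (maug M) x).
Proof.
have lp := pi_linear; have lq := @qproj_linear_fun _ _ _ M.
have [||rho [rP rE]] := quot_rcoact (pi_coact M) lq.
- by move=> y; exists (qrepr y); rewrite qreprK.
- by move=> x x0; rewrite tmap_comp //; exact: tmap_pi_aug.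
by exists rho; split=> // x; rewrite -rE tmap_comp.
Qed.

Definition quotient_comodule (M : rhopfmod A) : rcomodule C :=
  Rcomodule (proj1 (svalP (cid (exists_quotient_coact M)))).

Lemma quotient_coactE (M : rhopfmod A) x :
  rcoact (qproj (maug M) x : quotient_comodule M)
  = tmap (qproj (maug M)) pi (hco x).
Proof. exact/esym/(proj2 (svalP (cid (exists_quotient_coact M)))). Qed.

Definition comod_mor (V W : rcomodule C) (f : V -> W) : Prop :=
  linear f /\ rcoact_mor (@rcoact _ _ V) (@rcoact _ _ W) f.

Lemma qmap_comod_mor (M N : rhopfmod A) (f : M -> N) : hopf_mor f ->
  @comod_mor (quotient_comodule M) (quotient_comodule N) (qmap f).
Proof.
move=> fm; have rm := hopf_rmod_mor fm; have lf := qmap_linear rm.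
have lp := pi_linear; split=> // x; rewrite -[x]qreprK; move: (qrepr x) => {}x.
rewrite qmapE // !quotient_coactE (hco_mor _ fm).
rewrite -[RHS]/(tmap (qmap f) (fun c => c) (tmap _ _ (hco x))).
rewrite !tmap_comp //; last exact: qproj_linear_fun.
by apply: eq_tlift => m h /=; rewrite qmapE.
Qed.

Definition quotient_comodule_functor : functor (HopfMod_r A) (Comod_r C).
Proof.
refine (@Functor (HopfMod_r A) (Comod_r C) quotient_comodule
  (fun M N f => exist _ (qmap (sval f)) (qmap_comod_mor (svalP f))) _ _).
- move=> M; apply: eq_exist; apply/funext => x; exact: qmap_id.
- move=> M N K g f; apply: eq_exist; apply/funext => x.
  by apply: qmap_comp; apply: hopf_rmod_mor; [exact: (svalP f)|exact: (svalP g)].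
Defined.

Lemma comod_mor_inv (V W : rcomodule C) (f : V -> W) g :
  comod_mor f -> cancel f g -> cancel g f -> comod_mor g.
Proof.
move=> [lf cf] fK gK.
have lg : linear g by move=> a u v; apply: (can_inj fK); rewrite lf !gK.
split=> // w; rewrite -[in RHS](gK w) cf tlift_tlift; last by lin.
rewrite -[LHS]tlift_id; apply: eq_tlift => v c.
by rewrite tliftE ?fK //; lin.
Qed.

Lemma comod_isoP (V W : Comod_r C) (f : hom V W) :
  isomorphism f <-> injective (sval f) /\ forall y, exists x, sval f x = y.
Proof.
apply: concrete_isomorphism => X Y {}f g; exact: comod_mor_inv.
Qed.

Lemma quotient_comodule_isoP (M N : HopfMod_r A) (f : hom M N) :
  isomorphism (fmap quotient_comodule_functor f) <-> aug_iso (sval f).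
Proof.
by rewrite comod_isoP; apply: aug_isoP; apply: hopf_rmod_mor (svalP f).
Qed.

End ComoduleQuotient.

(** * The adjunctions *)

Section Cotensor.
Context (k : fieldType) (H : hopf k) (A : rcoideal_subalg H).
Local Notation C := (HA_coalg A).
Local Notation pi := (qproj (@HAplus_gen k H A) : H -> HA_quot A).
Let lp : linear pi := @pi_linear k H A.
Let lqc : linear (@qcomul k H A) := @qcomul_linear k H A.

Definition triv_act (V : lmodType k) (v : V) (a : A) : V := aug a *: v.

Fact triv_ract (V : lmodType k) : is_ract (@triv_act V).
Proof.
rewrite /triv_act; split=> [|v|v a b].
- split=> [a|v]; last exact: linear_scalar (@aug_scalar _ _ _).
  exact: linear_scaled.
- by rewrite aug1 scale1r.
- by rewrite augM scalerA mulrC.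
Qed.

(** With A acting on V through eps, the diagonal action on V ⊗ H is right multiplication on H; this
    makes V ⊗ H an instance of [diag_hopf]. *)
Definition triv (V : lmodType k) : rmodule A := Rmodule (@triv_ract V).

Lemma triv_mor (V W : lmodType k) (f : V -> W) : linear f ->
  @rmod_mor _ _ (triv V) (triv W) f.
Proof. by move=> lf; split=> // v a; rewrite /= (linear_funZ _ _ lf). Qed.

Lemma triv_dactE (V : lmodType k) (v : V) h a :
  @dact _ _ _ (triv V) (v ⊗ h) a = v ⊗ (h * val a).
Proof.
rewrite dactE -(rcomul_counitl (F := fun x => v ⊗ (h * x))); last by lin.
apply: eq_tlift => a1 a2; rewrite /= /triv_act.
by rewrite (linear_funZ _ _ ((tpure_bilinear _ _).1 _)).
Qed.

(** This identifies (V ⊗ H)/(V ⊗ H)A^+ with V ⊗ C: HA^+ is the kernel of pi, and tensoring with V is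
    exact. *)
Lemma triv_augP (V : lmodType k) (t : tens V H) :
  t \in span (maug (diag_hopf (triv V))) <-> tmap (fun v => v) pi t = 0.
Proof.
have [bl br] := @dact_bilinear _ _ _ (triv V); split.
  apply: span_vanish; first by lin.
  move=> _ [s [a [a0 ->]]]; move: s; apply: tens_ext => [||v h].
  - refine (linear_comp (bl a) _); lin.
  - exact: linear_zero.
  rewrite /= triv_dactE tmapE // pi_aug -/(aug a) a0 scale0r.
  exact: linear_fun0 ((tpure_bilinear _ _).2 _).
have [K [i [li iI ker]]] := exists_kernel lp.
move=> /(tmap_exactr li lp (fun h => proj1 (ker h))) [s <-].
move: s => {t}; apply: tens_ind => [|v x t tN].
  by rewrite (linear_fun0 (tmap_linear (@linear_idfun _ _) li)) rpred0.
have lt := tmap_linear (@linear_idfun _ V) li.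
rewrite (linear_funD lt) rpredD // tmapE //.
have : i x \in span (@HAplus_gen k H A) by apply/qproj0P/ker; exists x.
apply: (span_linear (f := fun h => v ⊗ h)); first by lin.
by move=> _ [h a a0]; rewrite -triv_dactE; exact: (@mem_maug _ _ _ (diag_hopf (triv V))).
Qed.

Lemma hopf_mor_opp (M N : rhopfmod A) f : hopf_mor f ->
  @hopf_mor _ _ _ M N (fun x => - f x).
Proof.
move=> fm; have [lf af cf] := fm; split; first exact: linear_opp.
  by move=> v a; rewrite af -[RHS]/((fun n => ract n a) (- f v)) -!scaleN1r
    (linear_funZ _ _ (ract_linearl a)).
move=> v; rewrite -[LHS]/(hco (- f v)) -scaleN1r (linear_funZ _ _ (@hco_linear _ _ _ N)).
rewrite (hco_mor _ fm) /tmap -tliftZ; apply: eq_tlift => m h.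
by rewrite -(linear_funZ _ _ ((tpure_bilinear _ _).1 _)) scaleN1r.
Qed.

Section Delta.
Context (V : rcomodule C).
Local Notation VH := (diag_hopf (triv V)).
Local Notation VCH := (diag_hopf (triv (tens V C))).
Let lV : linear (@rcoact _ _ V) := rcoact_linear (rcoactP V).

Definition cot_left (t : tens V H) : tens (tens V C) H :=
  tmap (@rcoact _ _ V) (fun h => h) t.

Definition cot_right (t : tens V H) : tens (tens V C) H :=
  \tsum_(v, h <- t) \tsum_(h1, h2 <- hcomul h) (v ⊗ pi h1) ⊗ h2.

(* The kernel of [cot_diff] is the cotensor product of V and H over C. *)
Definition cot_diff (t : tens V H) : tens (tens V C) H :=
  cot_left t - cot_right t.

Lemma cot_left_linear : linear cot_left.
Proof. by rewrite /cot_left; lin. Qed.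
Lemma cot_right_linear : linear cot_right.
Proof. by rewrite /cot_right; lin. Qed.
Lemma cot_diff_linear : linear cot_diff.
Proof.
exact: linear_add cot_left_linear (linear_opp cot_right_linear).
Qed.

Lemma cot_rightE v h :
  cot_right (v ⊗ h) = \tsum_(h1, h2 <- hcomul h) (v ⊗ pi h1) ⊗ h2.
Proof. by rewrite /cot_right tliftE //; lin. Qed.

(** A-linearity is the identity pi(h_1 a_1) ⊗ h_2 a_2 = pi(h_1) ⊗ h_2 a, which uses a_1 in A and
    pi(h b) = eps(b) pi(h) for b in A. *)
Lemma cot_right_mor : @hopf_mor _ _ _ VH VCH cot_right.
Proof.
have lr := cot_right_linear.
split=> // [t a|t].
  have [bl br] := @dact_bilinear _ _ _ (triv V).
  have [bl' br'] := @dact_bilinear _ _ _ (triv (tens V C)).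
  move: t; apply: tens_ext => [||v h].
  - exact: linear_comp (bl a) lr.
  - exact: linear_comp lr (bl' a).
  rewrite /= triv_dactE !cot_rightE (linear_tlift _ _ (bl' a)).
  rewrite (hopf_comulM (hopfP H)) tlift_tlift; last by lin.
  apply: eq_tlift => h1 h2; rewrite tlift_tlift; last by lin.
  rewrite triv_dactE rcomul_tlift; last by split=> w; lin.
  rewrite -(rcomul_counitl (F := fun x => (v ⊗ pi h1) ⊗ (h2 * x))); last by lin.
  apply: eq_tlift => a1 a2; rewrite tliftE; last by lin.
  rewrite pi_aug (linear_funZ _ _ ((tpure_bilinear _ _).2 _)).
  by rewrite (linear_funZ _ _ ((tpure_bilinear _ _).1 _)).
rewrite -[LHS]/(dco (M := triv (tens V C)) (cot_right t)).
rewrite -[RHS]/(tmap cot_right (fun h : H => h) (dco (M := triv V) t)).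
have l1 := @dco_linear _ _ _ (triv V).
have l2 := @dco_linear _ _ _ (triv (tens V C)).
have lt := tmap_linear lr (@linear_idfun _ H).
move: t; apply: tens_ext => [||v h].
- exact: linear_comp lr l2.
- exact: linear_comp l1 lt.
rewrite cot_rightE dcoE (linear_tlift _ _ l2) (linear_tlift _ _ lt).
transitivity (\tsum_(y, z <- hcomul h) \tsum_(z1, z2 <- hcomul z)
   (((v ⊗ pi y) ⊗ z1) ⊗ z2)).
  by apply: eq_tlift => y z; rewrite dcoE.
rewrite -hcomulA_tlift; last by trilin.
apply: eq_tlift => y z; rewrite tmapE // cot_rightE.
by rewrite (linear_tlift _ _ ((tpure_bilinear _ _).1 _)).
Qed.

Lemma cot_diff_mor : @hopf_mor _ _ _ VH VCH cot_diff.
Proof.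
apply: (@hopf_mor_add _ _ _ VH VCH).
  by apply: tmap_hopf_mor; apply: triv_mor.
exact: hopf_mor_opp cot_right_mor.
Qed.

(** On the cotensor product of V and H this induces the counit of the adjunction. *)
Definition cot_ev (t : tens V H) : V := \tsum_(v, h <- t) (hcounit h *: v).

Lemma cot_ev_linear : linear cot_ev.
Proof. by rewrite /cot_ev; lin. Qed.

Lemma cot_evE v h : cot_ev (v ⊗ h) = hcounit h *: v.
Proof. by rewrite /cot_ev tliftE //; lin. Qed.

Lemma cot_ev_act t a : cot_ev (@dact _ _ _ (triv V) t a) = aug a *: cot_ev t.
Proof.
have [bl br] := @dact_bilinear _ _ _ (triv V); have le := cot_ev_linear.
move: t; apply: tens_ext => [||v h].
- exact: linear_comp (bl a) le.
- exact: linear_scaled.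
by rewrite triv_dactE !cot_evE (hopf_counitM (hopfP H)) scalerA mulrC.
Qed.

(** An element of V ⊗ H is recovered from its coaction through [cot_ev]. Hence a colinear map into V
    ⊗ H is determined by its composite with [cot_ev], which yields uniqueness in the universal
    property. *)
Lemma cot_ev_coact t : tmap cot_ev (fun h : H => h) (dco (M := triv V) t) = t.
Proof.
have le := cot_ev_linear; have lt := tmap_linear le (@linear_idfun _ H).
move: t; apply: tens_ext => [||v h].
- exact: linear_comp (@dco_linear _ _ _ (triv V)) lt.
- exact: linear_idfun.
rewrite dcoE (linear_tlift _ _ lt) -[RHS](hcounitl_tlift (F := fun h => v ⊗ h)).
  apply: eq_tlift => h1 h2; rewrite tmapE // cot_evE.
  by rewrite (linear_funZ _ _ ((tpure_bilinear _ _).1 _)).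
by lin.
Qed.

(** Apply eps to the last factor of both sides of the cotensor condition. Modulo A^+, an element of
    the cotensor product is thus the coaction of its image under [cot_ev]. *)
Lemma cot_diff_counit t : cot_diff t = 0 ->
  tmap (fun v => v) pi t = rcoact (cot_ev t).
Proof.
have le := cot_ev_linear.
pose E (s : tens (tens V C) H) := \tsum_(w, h <- s) (hcounit h *: w).
have lE : linear E by rewrite /E; lin.
move=> /(congr1 E); rewrite (linear_fun0 lE) (linear_funB lE) => /eqP.
rewrite subr_eq0 => /eqP.
have -> : E (cot_left t) = rcoact (cot_ev t).
  move: t; apply: tens_ext => [||v h]; first exact: linear_comp cot_left_linear lE.
    exact: linear_comp le lV.
  rewrite /E /cot_left tlift_tmap; last by lin.
  by rewrite tliftE ?cot_evE ?(linear_funZ _ _ lV) //; lin.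
have -> : E (cot_right t) = tmap (fun v => v) pi t.
  move: t; apply: tens_ext => [||v h]; first exact: linear_comp cot_right_linear lE.
    by lin.
  rewrite cot_rightE (linear_tlift _ _ lE) tmapE //.
  rewrite -[RHS](hcounitr_tlift (F := fun h => v ⊗ pi h)); last by lin.
  by apply: eq_tlift => h1 h2; rewrite /E tliftE //; lin.
by move=> ->.
Qed.

(** Lift rho(v) to t in V ⊗ H. Its defect [cot_diff t] lies in the A^+-part of the target, so
    exactness corrects t by an element of (V ⊗ H)A^+, which [cot_ev] does not see. *)
Lemma cotensor_counit_surj (v : V) : aug_exact A ->
  exists t, cot_diff t = 0 /\ cot_ev t = v.
Proof.
move=> ex; have le := cot_ev_linear.
have [|t tE] := tmap_surjr (V := V) lp _ (rcoact v).
  by move=> c; exists (qrepr c); rewrite qreprK.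
have evt : cot_ev t = v.
  rewrite -[RHS](rcoact1 (rcoactP V)) -tE tlift_tmap; last first.
    have lqe : scalar (@qcounit k H A) := @qcounit_linear k H A.
    by lin.
  by apply: eq_tlift => w h; rewrite /= qcounitE.
(* By [triv_augP] this is an identity in (V ⊗ C) ⊗ C, namely coassociativity of the coaction at
   v. *)
have : cot_diff t \in span (maug VCH).
  apply/triv_augP; have lt := tmap_linear (@linear_idfun _ (tens V C)) lp.
  rewrite (linear_funB lt).
  pose K (s : tens V C) := \tsum_(w, c <- s) \tsum_(c1, c2 <- qcomul c)
    ((w ⊗ c1) ⊗ (c2 : C)).
  have lK : linear K by rewrite /K; lin.
  have -> : tmap (fun v => v) pi (cot_right t) = K (tmap (fun v => v) pi t).
    move: t {tE evt}; apply: tens_ext => [||w h].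
    - exact: linear_comp cot_right_linear lt.
    - by lin.
    rewrite cot_rightE (linear_tlift _ _ lt) tmapE // /K tliftE; last by lin.
    rewrite tlift_qcomul; last by lin.
    by apply: eq_tlift => h1 h2; rewrite tmapE.
  rewrite /cot_left tmap_comp //.
  have -> : tmap ((fun v => v) \o @rcoact _ _ V) (pi \o (fun h => h)) t
    = tmap (@rcoact _ _ V) (fun c => c) (tmap (fun v => v) pi t).
    by rewrite tmap_comp.
  rewrite tE /K -(rcoactA_tlift v (F := fun w c1 c2 => (w ⊗ c1) ⊗ c2) (rcoactP V));
    last by trilin.
  rewrite -[X in _ - X](_ : tmap (@rcoact _ _ V) (fun c => c) (rcoact v) = _).
    by rewrite subrr.
  apply: eq_tlift => w c; rewrite -[in LHS](tlift_id (rcoact w)).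
  by rewrite (linear_tlift _ _ ((tpure_bilinear _ _).1 _)).
move=> /(aug_exact_image (M := VH) (N := VCH) ex cot_diff_mor) [m [mN mE]].
exists (t - m); rewrite (linear_funB cot_diff_linear) mE subrr; split=> //.
rewrite (linear_funB le) evt -[RHS]subr0; congr (_ - _).
move: mN; apply: span_vanish => // _ [s [a [a0 ->]]].
by rewrite cot_ev_act a0 scale0r.
Qed.

Lemma cotensor_counit_inj (K : rhopfmod A) (i : K -> VH) x : aug_exact A ->
  hopf_mor i -> injective i -> cot_diff (i x) = 0 -> cot_ev (i x) = 0 ->
  x \in span (maug K).
Proof.
move=> ex im iI ix0 evx; apply: (ex _ _ _ im iI); apply/triv_augP.
by rewrite cot_diff_counit // evx (linear_fun0 lV).
Qed.

End Delta.

Lemma quotient_comodule_universal (V : Comod_r C) : aug_exact A ->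
  exists (K : HopfMod_r A) (e : hom (quotient_comodule_functor A K) V),
    isomorphism e /\ universal_arrow e.
Proof.
move=> ex; have dm := cot_diff_mor V.
have lV : linear (@rcoact _ _ V) := rcoact_linear (rcoactP V).
have le := @cot_ev_linear V; have ld := @cot_diff_linear V.
have [K [i [im iI iker]]] := exists_hopf_kernel dm; have [li ai ci] := im.
have di x : cot_diff (i x) = 0 by apply/iker; exists x.
have lei : linear (fun x => cot_ev (i x)) by exact: linear_comp li le.
have van x : maug K x -> cot_ev (i x) = 0.
  by move=> [y [a [a0 ->]]]; rewrite ai cot_ev_act a0 scale0r.
pose e (y : quotient_comodule K) : V := cot_ev (i (qrepr y)).
have eE x : e (qproj (maug K) x) = cot_ev (i x) := qliftE lei van x.
have le' : linear e := qlift_linear lei van.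
have em : comod_mor e.
  split=> // y; rewrite -[y]qreprK; move: (qrepr y) => {}x.
  rewrite eE -cot_diff_counit // quotient_coactE.
  rewrite -[RHS]/(tmap e (fun c => c) (tmap (qproj (maug K)) pi (hco x))).
  rewrite tmap_comp // -[in LHS](cot_ev_coact (i x)).
  rewrite -[dco (i x)]/(hco (M := diag_hopf (triv V)) (i x)) (hco_mor _ im).
  rewrite !tmap_comp //.
  by apply: eq_tlift => m h /=; rewrite eE.
exists K, (exist _ e em); split.
  apply/comod_isoP => /=; split.
    move=> y y'; rewrite -[y]qreprK -[y']qreprK !eE => yy'; apply/qproj_eq.
    apply: (cotensor_counit_inj ex im iI (di _)).
    by rewrite (linear_funB li) (linear_funB le) yy' subrr.
  move=> v; have [t [/iker[x xE] tv]] := cotensor_counit_surj v ex.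
  by exists (qproj (maug K) x); rewrite eE xE.
move=> M [h [lh ch]].
pose hq (m : M) : V := h (qproj (maug M) m).
have lhq : linear hq by apply: linear_comp lh; exact: qproj_linear_fun.
have hqa m a : hq (ract m a) = aug a *: hq m.
  by rewrite /hq ract_aug (linear_funZ _ _ lh).
(* The transpose of h is m |-> h[m_0] ⊗ m_1; colinearity of h places it in the cotensor product. *)
pose u0 (m : M) : tens V H := tmap hq (fun x => x) (hco m).
have lu0 : linear u0 by rewrite /u0; lin.
have u0m : @hopf_mor _ _ _ M (diag_hopf (triv V)) u0.
  split=> // [m a|m].
    have [bl br] := @dact_bilinear _ _ _ (triv V).
    rewrite /= /u0 hco_ract /tmap tlift_tlift; last by lin.
    rewrite (linear_tlift _ _ (bl a)); apply: eq_tlift => m0 m1.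
    rewrite tlift_tlift; last by lin.
    rewrite triv_dactE -(rcomul_counitl (F := fun x => hq m0 ⊗ (m1 * x))).
      apply: eq_tlift => a1 a2; rewrite tliftE; last by lin.
      by rewrite hqa (linear_funZ _ _ ((tpure_bilinear _ _).1 _)).
    by lin.
  rewrite -[LHS]/(dco (M := triv V) (u0 m)) /u0 /dco tlift_tmap; last by lin.
  rewrite -(hcoA_tlift (F := fun n0 n1 m1 => (hq n0 ⊗ n1) ⊗ m1)); last by trilin.
  apply: eq_tlift => m0 m1; rewrite /tmap.
  by rewrite (linear_tlift _ _ ((tpure_bilinear _ _).1 _)).
have du0 m : cot_diff (u0 m) = 0.
  rewrite /cot_diff /cot_left /cot_right /u0 tmap_comp // tlift_tmap; last by lin.
  rewrite -(hcoA_tlift (F := fun n0 n1 m1 => (hq n0 ⊗ pi n1) ⊗ m1)); last by trilin.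
  rewrite -[X in _ - X](_ : tmap (@rcoact _ _ V \o hq)
    ((fun x => x) \o (fun x => x)) (hco m) = _).
    by rewrite subrr.
  apply: eq_tlift => m0 m1 /=.
  rewrite {1}/hq ch quotient_coactE tlift_tmap; last by lin.
  by rewrite (linear_tlift _ _ ((tpure_bilinear _ _).1 _)).
have /choice[u uE] m : exists x, i x = u0 m by apply/iker/du0.
have um : hopf_mor u.
  apply: (ca_inj (@hopf_abelian k H A) im iI).
  by have -> : (fun m => i (u m)) = u0 by apply/funext.
have ev_u0 m : cot_ev (u0 m) = hq m.
  rewrite /u0 /cot_ev tlift_tmap; last by lin.
  exact: hco1_tlift.
exists (exist _ u um); split.
  apply: eq_exist; apply/funext => y /=; rewrite -[y]qreprK.
  by rewrite qmapE ?eE ?uE ?ev_u0 //; exact: hopf_rmod_mor um.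
move=> [v vm] vE; have [lv av cv] := vm.
apply: eq_exist; apply/funext => m; apply: iI; rewrite uE.
have ev m' : cot_ev (i (v m')) = hq m'.
  have := congr1 (fun f => sval f (qproj (maug M) m')) vE.
  by rewrite /= qmapE ?eE //; exact: hopf_rmod_mor vm.
rewrite -[RHS]cot_ev_coact -[dco (i (v m))]/(hco (M := diag_hopf (triv V)) (i (v m))).
rewrite (hco_mor _ im) (hco_mor _ vm) !tmap_comp //.
by apply: eq_tlift => n h' /=; rewrite ev.
Qed.

End Cotensor.

Section LeftModules.
Context (k : fieldType) (A : algType k).

Lemma lact_linearl (M : lmodule A) (m : M) : linear (fun a => lact a m).
Proof. exact: (lact_bilinear (lactP M)).1. Qed.
Lemma lact_linearr (M : lmodule A) a : linear (@lact _ _ M a).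
Proof. exact: (lact_bilinear (lactP M)).2. Qed.

End LeftModules.

Section QuotientAction.
Context (k : fieldType) (H : hopf k) (A : rcoideal_subalg H).

Lemma qact_linearl (c : HA_quot A) : linear (fun h => qact h c).
Proof.
move=> a g h; rewrite -[c]qreprK !qactE -linearP.
by rewrite mulrDl scalerAl.
Qed.

Lemma qact_linearr (h : H) : linear (@qact k H A h).
Proof.
move=> a c d; rewrite -[c]qreprK -[d]qreprK -linearP !qactE -linearP.
by rewrite mulrDr scalerAr.
Qed.

Definition wco (W : hmod_rcomod A) (w : W) : tens W (HA_coalg A) := hrc_coact w.

Lemma wco_linear (W : hmod_rcomod A) : linear (@wco W).
Proof. exact: rcoact_linear (hrc_coactP W). Qed.

Lemma wco_lact (W : hmod_rcomod A) (h : H) (w : W) : wco (lact h w) =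
  \tsum_(h1, h2 <- hcomul h) \tsum_(w0, w1 <- wco w) lact h1 w0 ⊗ qact h2 w1.
Proof. exact: hrc_compat. Qed.

End QuotientAction.

Ltac lin_hook ::=
  first [ exact: hcomul_linear | exact: hcounit_scalar | exact: antipode_linear
        | exact: rcomul_linear | exact: aug_scalar | exact: valA_linear
        | exact: ract_linearl | exact: ract_linearr | exact: hco_linear
        | exact: lact_linearl | exact: lact_linearr | exact: wco_linear
        | exact: qact_linearl | exact: qact_linearr
        | match goal with
          | |- GRing.linear_for _ (tmap _ _) => apply: tmap_linear; lin
          | |- GRing.linear_for _ (fun x => tmap _ _ x) => apply: tmap_linear; lin
          end
        | match goal with f : hopf_mor _ |- _ => by case: f end
        | match goal with f : rmod_mor _ |- _ => by case: f end ].

(** * The functor M_A -> _H M^C and the coinvariants *)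

Section InducedModule.
Context (k : fieldType) (H : hopf k) (A : rcoideal_subalg H).
Local Notation C := (HA_coalg A).
Local Notation pi := (qproj (@HAplus_gen k H A) : H -> HA_quot A).
Implicit Types (M N : rmodule A).
Let lp : linear pi := @pi_linear k H A.

Definition lmulH (M : rmodule A) (g : H) (t : tens M H) : tens M H :=
  tmap (fun m => m) (fun h => g * h) t.

Lemma hco_diag M (t : tens M H) : @hco _ _ _ (diag_hopf M) t = dco t.
Proof. by []. Qed.

Lemma lmulH_linear M g : linear (@lmulH M g).
Proof. by rewrite /lmulH; lin. Qed.

Lemma lmulH_linearl M (t : tens M H) : linear (fun g => lmulH g t).
Proof. by rewrite /lmulH /tmap; lin. Qed.

Lemma lmulHE M g (m : M) h : lmulH g (m ⊗ h) = m ⊗ (g * h).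
Proof. by rewrite /lmulH tmapE //; lin. Qed.

Lemma lmulH_mor M g : @rmod_mor _ _ (diag_hopf M) (diag_hopf M) (@lmulH M g).
Proof.
have lg := @lmulH_linear M g; split=> // t a.
have [bl br] := dact_bilinear M; move: t; apply: tens_ext => [||m h].
- exact: linear_comp (bl a) lg.
- exact: linear_comp lg (bl a).
rewrite /= lmulHE !dactE (linear_tlift _ _ lg); apply: eq_tlift => a1 a2.
by rewrite lmulHE mulrA.
Qed.

Definition ind_act (M : rmodule A) (g : H) : quotient_comodule (diag_hopf M) ->
  quotient_comodule (diag_hopf M) :=
  @qmap _ _ _ (diag_hopf M) (diag_hopf M) (@lmulH M g).

Lemma ind_actE M g t : @ind_act M g (qproj _ t) = qproj _ (lmulH g t).
Proof. exact: qmapE (lmulH_mor M g). Qed.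

Fact ind_lact M : is_lact (@ind_act M).
Proof.
split=> [|v|v a b].
- split=> [v|g]; last exact: qmap_linear (lmulH_mor M g).
  move=> c g h; rewrite -[v]qreprK !ind_actE -linearP; congr (qproj _ _).
  exact: lmulH_linearl.
- rewrite -[v]qreprK ind_actE; congr (qproj _ _); apply: tmap_id => //.
  exact: mul1r.
- rewrite -[v]qreprK !ind_actE; congr (qproj _ _).
  rewrite /lmulH tmap_comp //; last exact: linear_mull.
  by apply: eq_tlift => m h /=; rewrite mulrA.
Qed.

Fact ind_compat M (h : H) (m : quotient_comodule (diag_hopf M)) :
  rcoact (ind_act h m) = \tsum_(h1, h2 <- hcomul h) \tsum_(m0, m1 <- rcoact m)
    ind_act h1 m0 ⊗ qact h2 m1.
Proof.
have liL v : linear (fun g => @ind_act M g v) := (lact_bilinear (ind_lact M)).1 v.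
have liR g : linear (@ind_act M g) := (lact_bilinear (ind_lact M)).2 g.
have lq := @qproj_linear_fun _ _ _ (diag_hopf M).
rewrite -[m]qreprK; move: (qrepr m) => {m} t.
rewrite ind_actE !quotient_coactE.
have lh := @lmulH_linear M h; have ld := @hco_linear _ _ _ (diag_hopf M).
have lt := tmap_linear lq lp.
move: t; apply: tens_ext => [||m x].
- exact: linear_comp lh (linear_comp ld lt).
- by lin.
rewrite lmulHE !hco_diag !dcoE !(linear_tlift _ _ lt).
rewrite (hopf_comulM (hopfP H)) tlift_tlift; last by lin.
apply: eq_tlift => h1 h2; rewrite tlift_tlift; last by lin.
rewrite tlift_tlift; last by lin.
apply: eq_tlift => x1 x2; rewrite tliftE; last by lin.
rewrite !tmapE // tliftE; last by lin.
by rewrite ind_actE lmulHE qactE.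
Qed.

Definition induced (M : rmodule A) : hmod_rcomod A :=
  @HmodRcomod k H A (Lmodule (ind_lact M)) _
    (rcoactP (quotient_comodule (diag_hopf M))) (@ind_compat M).

Definition hrc_mor (V W : hmod_rcomod A) (f : V -> W) : Prop :=
  [/\ linear f, lact_mor (@lact _ _ V) (@lact _ _ W) f &
      rcoact_mor (@hrc_coact _ _ _ V) (@hrc_coact _ _ _ W) f].

Lemma induced_mor (M N : rmodule A) (f : M -> N) : rmod_mor f ->
  @hrc_mor (induced M) (induced N)
    (@qmap _ _ _ (diag_hopf M) (diag_hopf N) (tmap f (fun h => h))).
Proof.
move=> fm; have [lf af] := fm; have tm := tmap_hopf_mor fm.
have [lq cq] := qmap_comod_mor tm; split=> // g x; rewrite -[x]qreprK.
rewrite /= ind_actE !(qmapE _ (hopf_rmod_mor tm)) ind_actE; congr (qproj _ _).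
by rewrite /lmulH !tmap_comp //; exact: linear_mull.
Qed.

Definition induced_functor : functor (Mod_r A) (HMod_Comod_r A).
Proof.
refine (@Functor (Mod_r A) (HMod_Comod_r A) induced
  (fun M N f => exist _ _ (induced_mor (svalP f))) _ _).
- move=> M; apply: eq_exist; apply/funext => x /=.
  rewrite -[RHS]qreprK /qmap; congr (qproj _ _); exact: tmap_id.
- move=> M N K g f; apply: eq_exist; apply/funext => x /=.
  have [[lf af] [lg ag]] := (svalP f, svalP g).
  rewrite -(qmap_comp _ (hopf_rmod_mor (tmap_hopf_mor (svalP f)))
    (hopf_rmod_mor (tmap_hopf_mor (svalP g)))).
  by rewrite /qmap tmap_comp.
Defined.

Lemma hrc_mor_inv (V W : hmod_rcomod A) (f : V -> W) g :
  hrc_mor f -> cancel f g -> cancel g f -> hrc_mor g.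
Proof.
move=> [lf af cf] fK gK.
have [lg cg] := @comod_mor_inv k H A (Rcomodule (hrc_coactP V))
  (Rcomodule (hrc_coactP W)) f g (conj lf cf) fK gK.
by split=> // h w; apply: (can_inj fK); rewrite af !gK.
Qed.

Lemma hrc_isoP (V W : HMod_Comod_r A) (f : hom V W) :
  isomorphism f <-> injective (sval f) /\ forall y, exists x, sval f x = y.
Proof.
apply: concrete_isomorphism => X Y {}f g; exact: hrc_mor_inv.
Qed.

Lemma induced_isoP (M N : Mod_r A) (f : hom M N) :
  isomorphism (fmap induced_functor f)
  <-> @aug_iso _ _ _ (diag_hopf M) (diag_hopf N) (tmap (sval f) (fun h => h)).
Proof.
rewrite hrc_isoP; apply: aug_isoP.
by apply: hopf_rmod_mor; apply: tmap_hopf_mor; exact: (svalP f).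
Qed.

Context (T : H -> H) (ST : cancel (@antipode k H) T) (TS : cancel T (@antipode k H)).
Let lT : linear T := antipode_inv_linear ST TS.

(** Under pi a right factor a_1 in A becomes eps(a_1), so pi(T(a)) = pi(T(a_2) a_1), and T(a_2) a_1
    contracts to eps(a). *)
Lemma pi_antipode_inv (a : A) : pi (T (val a)) = aug a *: pi 1.
Proof.
rewrite -(rcomul_counitl (F := fun h => pi (T h))); last by lin.
rewrite -(antipode_invl_tlift ST TS (F := pi)) // rcomul_tlift; last first.
  by split=> w; lin.
by apply: eq_tlift => a1 a2; rewrite pi_aug.
Qed.

Section Coinvariants.
Context (W : hmod_rcomod A).
Local Notation WC := (Rcomodule (hrc_coactP W)).

Definition twist_act (w : W) (a : A) : W := lact (T (val a)) w.

Fact twist_ract : is_ract twist_act.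
Proof.
rewrite /twist_act; split=> [|w|w a b].
- by split=> [a|w]; lin.
- rewrite (rmorph1 (val : A -> H)) (antipode_inv1 ST TS).
  exact: lact1m (lactP W) _.
- rewrite (rmorphM (val : A -> H)) (antipode_invM ST TS).
  exact: lactA (lactP W) _ _ _.
Qed.

Definition coinv_diff (w : W) : tens W C := wco w - w ⊗ (pi 1).

Lemma coinv_diff_linear : linear coinv_diff.
Proof. by rewrite /coinv_diff; lin. Qed.

Lemma coinv_wco w : coinv_diff w = 0 -> wco w = w ⊗ (pi 1).
Proof. by move/eqP; rewrite subr_eq0 => /eqP. Qed.

Lemma coinv_lact w h : coinv_diff w = 0 ->
  wco (lact h w) = \tsum_(h1, h2 <- hcomul h) lact h1 w ⊗ pi h2.
Proof.
move=> /coinv_wco w0; rewrite wco_lact w0; apply: eq_tlift => h1 h2.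
by rewrite tliftE ?qactE ?mulr1 //; lin.
Qed.

(** The coaction of T(a) w is T(a_2) w ⊗ pi(T(a_1)), and pi(T(a_1)) = eps(a_1) pi(1) because a_1
    lies in A. *)
Lemma coinv_twist w a : coinv_diff w = 0 -> coinv_diff (twist_act w a) = 0.
Proof.
move=> w0; apply/eqP; rewrite subr_eq0; apply/eqP.
rewrite /twist_act coinv_lact // (comul_antipode_inv ST TS) tlift_tlift; last by lin.
rewrite rcomul_tlift; last first.
  split=> x.
  - refine (linear_comp (f := fun y => T x ⊗ T y)
      (g := tlift (fun h1 h2 => lact h1 w ⊗ pi h2)) _ _); lin.
  - refine (linear_comp (f := fun y => T y ⊗ T x)
      (g := tlift (fun h1 h2 => lact h1 w ⊗ pi h2)) _ _); lin.
rewrite -(rcomul_counitl (F := fun h => lact (T h) w ⊗ (pi 1))); last by lin.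
apply: eq_tlift => a1 a2; rewrite tliftE; last by lin.
by rewrite pi_antipode_inv (linear_funZ _ _ ((tpure_bilinear _ _).2 _)).
Qed.

Lemma exists_coinvariants : exists (G : rmodule A) (i : G -> W),
  [/\ linear i, injective i, forall x a, i (ract x a) = twist_act (i x) a &
      forall w, coinv_diff w = 0 <-> exists x, i x = w].
Proof.
have [K [i [li iI ker]]] := exists_kernel coinv_diff_linear.
have [|act' [aP aE]] := sub_ract twist_ract li iI.
  by move=> x a; apply/ker/coinv_twist/ker; exists x.
by exists (Rmodule aP), i.
Qed.

(* Fundamental theorem of Hopf modules: [untwist] and [twist] are mutually
   inverse between W^{co C} ⊗ H and the cotensor product of W with H. *)
Definition twist (t : tens W H) : tens W H :=
  \tsum_(w, h <- t) \tsum_(h1, h2 <- hcomul h) lact (T h1) w ⊗ h2.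

Definition untwist (t : tens W H) : tens W H :=
  \tsum_(w, h <- t) \tsum_(h1, h2 <- hcomul h) lact h1 w ⊗ h2.

Lemma twist_linear : linear twist.
Proof. by rewrite /twist; lin. Qed.
Lemma untwist_linear : linear untwist.
Proof. by rewrite /untwist; lin. Qed.

Lemma twistE w h :
  twist (w ⊗ h) = \tsum_(h1, h2 <- hcomul h) lact (T h1) w ⊗ h2.
Proof. by rewrite /twist tliftE //; lin. Qed.
Lemma untwistE w h :
  untwist (w ⊗ h) = \tsum_(h1, h2 <- hcomul h) lact h1 w ⊗ h2.
Proof. by rewrite /untwist tliftE //; lin. Qed.

Lemma untwistK t : twist (untwist t) = t.
Proof.
have lt := twist_linear; have lu := untwist_linear.
move: t; apply: tens_ext => [||w h]; [lin | lin |].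
rewrite untwistE (linear_tlift _ _ lt).
transitivity (\tsum_(y, z <- hcomul h) \tsum_(z1, z2 <- hcomul z)
    (lact (T z1 * y) w ⊗ z2)).
  apply: eq_tlift => y z; rewrite twistE; apply: eq_tlift => z1 z2.
  by rewrite (lactA (lactP W)).
rewrite -(hcomulA_tlift (F := fun y z1 z2 => lact (T z1 * y) w ⊗ z2)); last by trilin.
rewrite -[RHS](hcounitl_tlift (F := fun z => w ⊗ z)); last by lin.
apply: eq_tlift => y z.
rewrite (antipode_invl_tlift ST TS (F := fun x => lact x w ⊗ z)); last by lin.
by rewrite (lact1m (lactP W)).
Qed.

(** T(h_1 a_1) w = T(a_1) T(h_1) w, so the first factor receives exactly the twisted action of
    a_1. *)
Lemma twist_act_triv t a :
  twist (@dact _ _ _ (triv A W) t a) = @dact _ _ _ (Rmodule twist_ract) (twist t) a.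
Proof.
have lt := twist_linear.
have [bl br] := @dact_bilinear _ _ _ (triv A W).
have [bl' br'] := @dact_bilinear _ _ _ (Rmodule twist_ract).
move: t; apply: tens_ext => [||w h].
- exact: linear_comp (bl a) lt.
- exact: linear_comp lt (bl' a).
rewrite triv_dactE !twistE (linear_tlift _ _ (bl' a)).
rewrite (hopf_comulM (hopfP H)) tlift_tlift; last by lin.
apply: eq_tlift => h1 h2; rewrite tlift_tlift; last by lin.
rewrite dactE rcomul_tlift; last by split=> w'; lin.
apply: eq_tlift => a1 a2; rewrite tliftE; last by lin.
by rewrite (antipode_invM ST TS) (lactA (lactP W)).
Qed.

(** [Theta] lets T(h_1) act on the factor W ⊗ C of v ⊗ h, leaving h_2. It sends [cot_left t] to the
    coaction applied to [twist t], and [cot_right t] to [twist t] with pi(1) inserted; the cotensor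
    condition equates the two. *)
Lemma coinv_diff_twist t : cot_diff (V := WC) t = 0 ->
  tmap coinv_diff (fun h => h) (twist t) = 0.
Proof.
have lt := twist_linear; have lk := coinv_diff_linear.
pose Theta (u : tens (tens W C) H) := \tsum_(v, h <- u) \tsum_(h1, h2 <- hcomul h)
  \tsum_(x1, x2 <- hcomul h1)
    ((\tsum_(w0, w1 <- v) lact (T x2) w0 ⊗ qact (T x1) w1) ⊗ h2).
have lTh : linear Theta by rewrite /Theta; lin.
move/eqP; rewrite subr_eq0 => /eqP /(congr1 Theta) E.
pose unit_map (w : W) : tens W C := w ⊗ (pi 1).
have lu : linear unit_map by rewrite /unit_map; lin.
have -> : tmap coinv_diff (fun h => h) (twist t)
  = tmap (@wco _ _ _ W) (fun h => h) (twist t) - tmap unit_map (fun h => h) (twist t).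
  move: {E} t; apply: tens_ext => [||w h]; [lin| |].
    refine (linear_add _ (linear_opp _)); lin.
  rewrite twistE (linear_tlift _ _ (tmap_linear lk (@linear_idfun _ H))).
  rewrite (linear_tlift _ _ (tmap_linear (@wco_linear _ _ _ W) (@linear_idfun _ H))).
  rewrite (linear_tlift _ _ (tmap_linear lu (@linear_idfun _ H))).
  rewrite -[X in _ = _ + X]scaleN1r -tliftZ -tliftD; apply: eq_tlift => h1 h2.
  rewrite !tmapE //; try by lin.
  by rewrite scaleN1r (linear_funB ((tpure_bilinear _ _).1 _)).
apply/eqP; rewrite subr_eq0; apply/eqP.
transitivity (Theta (cot_left (V := WC) t)).
  move: {E} t; apply: tens_ext => [||w h].
  - lin.
  - exact: linear_comp (@cot_left_linear _ _ _ WC) lTh.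
  rewrite twistE linear_tlift; last by lin.
  rewrite /cot_left tmapE /=; [|exact: wco_linear|by lin].
  rewrite /Theta tliftE; last by lin.
  apply: eq_tlift => h1 h2; rewrite tmapE; [|lin|lin].
  rewrite wco_lact (comul_antipode_inv ST TS) tlift_tlift; last by lin.
  rewrite (linear_tlift _ _ ((tpure_bilinear _ _).1 _)).
  by apply: eq_tlift => x1 x2; rewrite tliftE //; lin.
rewrite E; move: {E} t; apply: tens_ext => [||w h].
- exact: linear_comp (@cot_right_linear _ _ _ WC) lTh.
- lin.
rewrite cot_rightE (linear_tlift _ _ lTh) twistE linear_tlift; last by lin.
(* Coassociativity brings y next to x1, so that T(x1) y contracts and only pi(1) remains in the
   factor C. *)
pose G (y x1 x2 h2 : H) := (lact (T x2) w ⊗ pi (T x1 * y)) ⊗ h2.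
transitivity (\tsum_(y, z <- hcomul h) \tsum_(z1, z2 <- hcomul z)
    \tsum_(x1, x2 <- hcomul z1) G y x1 x2 z2).
  apply: eq_tlift => y z; rewrite /Theta tliftE; last by lin.
  apply: eq_tlift => z1 z2; apply: eq_tlift => x1 x2.
  by rewrite tliftE ?qactE //; lin.
transitivity (\tsum_(y, z <- hcomul h) \tsum_(z1, z2 <- hcomul z)
    \tsum_(x1, x2 <- hcomul z2) G y z1 x1 x2).
  apply: eq_tlift => y z; apply: (hcomulA_tlift (F := G y)).
  by rewrite /G; trilin.
rewrite -(hcomulA_tlift (F := fun y z1 z2 => \tsum_(x1, x2 <- hcomul z2) G y z1 x1 x2));
  last by rewrite /G; trilin.
rewrite -(hcounitl_tlift (F := fun z => \tsum_(h1, h2 <- hcomul z)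
  tmap unit_map (fun h => h) (lact (T h1) w ⊗ h2))); last by lin.
apply: eq_tlift => y z; rewrite -tliftZ tlift_swap; apply: eq_tlift => x1 x2.
rewrite tmapE; [|lin|lin].
by rewrite (antipode_invl_tlift ST TS (F := fun x => (lact (T x1) w ⊗ pi x) ⊗ x2)) //; lin.
Qed.

End Coinvariants.

Lemma induced_universal (W : HMod_Comod_r A) : aug_exact A ->
  exists (G : Mod_r A) (e : hom (induced_functor G) W),
    isomorphism e /\ universal_arrow e.
Proof.
move=> ex; have [G [i [li iI ai ker]]] := exists_coinvariants W.
have i0 x : coinv_diff (i x) = 0 by apply/ker; exists x.
have lk := @coinv_diff_linear W.
(* The evaluation g ⊗ h |-> h g factors through the quotient by A^+ because h a_2 T(a_1) g = eps(a)
   h g. *)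
pose e0 (t : diag_hopf G) : W := \tsum_(g, h <- t) lact h (i g).
have le0 : linear e0 by rewrite /e0; lin.
have e0E g h : e0 (g ⊗ h) = lact h (i g) by rewrite /e0 tliftE //; lin.
have e0a t a : e0 (ract t a) = aug a *: e0 t.
  have [bl br] := dact_bilinear G; move: t; apply: tens_ext => [||g h].
  - exact: linear_comp (bl a) le0.
  - exact: linear_scaled.
  rewrite /= dactE (linear_tlift _ _ le0) e0E.
  have := antipode_invr_tlift ST TS (F := fun x => lact (h * x) (i g)) (val a).
  rewrite mulr1 => <-; last by lin.
  rewrite rcomul_tlift; last by split=> x; lin.
  apply: eq_tlift => a1 a2; rewrite e0E ai /twist_act -(lactA (lactP W)).
  by rewrite mulrA.
have van t : maug (diag_hopf G) t -> e0 t = 0.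
  by move=> [s [a [a0 ->]]]; rewrite e0a a0 scale0r.
pose e (y : induced G) : W := e0 (qrepr y).
have eE t : e (qproj (maug (diag_hopf G)) t) = e0 t := qliftE le0 van t.
have le : linear e := qlift_linear le0 van.
have em : hrc_mor e.
  split=> // [h y|y]; rewrite -[y]qreprK; move: (qrepr y) => {y} t.
    have lm := @lmulH_linear G h.
    rewrite /= ind_actE !eE; move: t; apply: tens_ext => [||g x]; [lin|lin|].
    by rewrite lmulHE !e0E (lactA (lactP W)).
  rewrite eE -[hrc_coact (e0 t)]/(wco (e0 t)).
  rewrite -[RHS]/(tmap e (fun c => c) (rcoact (qproj _ t : quotient_comodule (diag_hopf G)))).
  rewrite quotient_coactE tmap_comp //.
  have lc := @hco_linear _ _ _ (diag_hopf G).
  have lt : linear (tmap (e \o qproj (maug (diag_hopf G))) ((fun c => c) \o pi)).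
    apply: tmap_linear; first exact: linear_comp (@qproj_linear_fun _ _ _ (diag_hopf G)) le.
    exact: lp.
  move: t; apply: tens_ext => [||g h].
  - exact: linear_comp le0 (@wco_linear _ _ _ W).
  - exact: linear_comp lc lt.
  rewrite e0E coinv_lact // hco_diag dcoE (linear_tlift _ _ lt).
  apply: eq_tlift => h1 h2; rewrite tmapE /= ?eE ?e0E //.
  exact: linear_comp (@qproj_linear_fun _ _ _ (diag_hopf G)) le.
have ltw := @twist_linear W; have lun := @untwist_linear W.
have lti := tmap_linear li (@linear_idfun _ H).
pose WC := Rcomodule (hrc_coactP W).
have dm := cot_diff_mor WC.
have im : @rmod_mor _ _ G (Rmodule (twist_ract W)) i by split.
have [K [j [jm jI jker]]] := exists_hopf_kernel dm.
exists G, (exist _ e em); split.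
  apply/hrc_isoP => /=; split; last first.
    move=> w; have [t [t0 tw]] := @cotensor_counit_surj _ _ _ WC w ex.
    (* A preimage t of w in the cotensor product of W and H is moved by [twist] into G ⊗ H; its
       evaluation is [cot_ev t], as h_2 T(h_1) contracts to eps(h). *)
    have [s sE] := tmap_exact li lk (fun w => proj1 (ker w)) (coinv_diff_twist t0).
    exists (qproj _ s); rewrite eE -tw.
    have -> : e0 s = \tsum_(w, h <- twist t) lact h w.
      by rewrite -sE tlift_tmap //; lin.
    have l1 : linear (fun t : tens W H => \tsum_(w, h <- twist t) lact h w) by lin.
    move: {t0 tw sE} t; apply: tens_ext => [||w' h]; [exact: l1|exact: cot_ev_linear|].
    rewrite twistE cot_evE tlift_tlift; last by lin.
    rewrite -[w' in RHS](lact1m (lactP W)).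
    rewrite -(antipode_invr_tlift ST TS (F := fun x => lact x w')); last by lin.
    apply: eq_tlift => h1 h2; rewrite tliftE; last by lin.
    by rewrite (lactA (lactP W)).
  move=> y y'; rewrite -[y]qreprK -[y']qreprK !eE => yy'; apply/qproj_eq.
  move: (qrepr y) (qrepr y') yy' => t t' /eqP.
  rewrite -subr_eq0 -(linear_funB le0) => /eqP; move: (_ - _) => {y y' t t'} s s0.
  (* For s in G ⊗ H with e0 s = 0, the element [untwist s] belongs to the cotensor product K and is
     killed by [cot_ev], hence lies in KA^+. It is then carried back to G ⊗ H. *)
  have ds : cot_diff (V := WC) (untwist (tmap i (fun h => h) s)) = 0.
    have ld := @cot_diff_linear _ _ _ WC.
    move: {s0} s; apply: tens_ext => [||g h].
    - exact: linear_comp lti (linear_comp lun ld).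
    - exact: linear_zero.
    rewrite tmapE // untwistE (linear_tlift _ _ ld) /cot_diff.
    under eq_tlift => h1 h2 do rewrite -[cot_right _]opprK -scaleN1r opprK.
    rewrite tliftD tliftZ scaleN1r; apply/eqP; rewrite subr_eq0; apply/eqP.
    transitivity (\tsum_(y, z <- hcomul h) \tsum_(y1, y2 <- hcomul y)
      ((lact y1 (i g) ⊗ pi y2) ⊗ z)).
      apply: eq_tlift => y z; rewrite /cot_left tmapE /=; [|exact: wco_linear|by lin].
      rewrite -[hrc_coact _]/(wco (lact y (i g))) coinv_lact //.
      by rewrite (linear_tlift _ _ ((tpure_bilinear _ _).1 _)).
    rewrite hcomulA_tlift; last by trilin.
    by apply: eq_tlift => y z; rewrite cot_rightE.
  have /jker[x xE] := ds.
  have xK : x \in span (maug K).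
    apply: (cotensor_counit_inj ex jm jI); rewrite xE // -s0.
    have lev := @cot_ev_linear _ _ _ WC.
    move: {ds xE s0} s; apply: tens_ext => [||g h].
    - exact: linear_comp lti (linear_comp lun lev).
    - exact: le0.
    rewrite tmapE // untwistE (linear_tlift _ _ lev) e0E.
    rewrite -[RHS](hcounitr_tlift (F := fun h => lact h (i g))); last by lin.
    by apply: eq_tlift => h1 h2; rewrite cot_evE.
  have tj y : exists t, tmap i (fun h => h) t = twist (j y).
    apply: (tmap_exact li lk (fun w => proj1 (ker w))).
    by apply: coinv_diff_twist; apply/jker; exists y.
  (* psi is [twist] regarded as a map K -> G ⊗ H. It is A-linear for the diagonal action, so it maps
     KA^+ into (G ⊗ H)A^+. *)
  have [psi psiE] := choice tj; have tiI := tmap_inj (W := H) li iI.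
  have [lj aj cj] := jm.
  have psim : @rmod_mor _ _ K (diag_hopf G) psi.
    split=> [c u v|u a]; apply: tiI.
      by rewrite lti !psiE lj ltw.
    rewrite psiE aj /= twist_act_triv -psiE.
    by have [_ -> _] := tmap_hopf_mor im.
  have := maug_map psim xK; suff -> : psi x = s by [].
  by apply: tiI; rewrite psiE xE untwistK.
move=> M [h [lh ah ch]].
pose q := qproj (maug (diag_hopf M)).
have lq : linear q := @qproj_linear_fun _ _ _ (diag_hopf M).
(* The transpose of h takes the value h[m ⊗ 1], which is coinvariant because Δ(1) = 1 ⊗ 1. *)
pose u0 (m : M) : W := h (q (m ⊗ 1)).
have lu0 : linear u0 by apply: linear_comp lh; lin.
have hq m x : h (q (m ⊗ x)) = lact x (u0 m).
  by rewrite /u0 -ah /= ind_actE lmulHE mulr1.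
have u0c m : coinv_diff (u0 m) = 0.
  apply/eqP; rewrite subr_eq0; apply/eqP; rewrite /wco /u0 ch.
  rewrite [hrc_coact _](quotient_coactE (M := diag_hopf M) (m ⊗ 1)).
  rewrite tlift_tmap; last by lin.
  rewrite hco_diag dcoE (hopf_comul1 (hopfP H)) tliftE; last by lin.
  by rewrite tliftE //; lin.
have /choice[u uE] m : exists x, i x = u0 m by apply/ker.
have um : rmod_mor u.
  split=> [c m n|m a]; apply: iI; rewrite ?li ?ai !uE ?lu0 //.
  (* A-linearity amounts to [m a ⊗ 1] = [m ⊗ T(a)]: writing m a ⊗ 1 as m a_1 ⊗ T(a_3) a_2, which is
     (m ⊗ T(a_2)) a_1, one replaces a_1 by eps(a_1). *)
  rewrite /twist_act -hq /u0; congr (h _).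
  rewrite -(rcomul_counitl (F := fun x => q (m ⊗ T x))); last by lin.
  transitivity (\tsum_(a1, a2 <- rcomul a) q (dact (m ⊗ T a2) a1)); last first.
    by apply: eq_tlift => a1 a2; exact: (@ract_aug _ _ _ (diag_hopf M)).
  rewrite -(linear_tlift _ _ lq); congr (q _).
  transitivity (\tsum_(a1, a2 <- rcomul a) \tsum_(b1, b2 <- rcomul a1)
     (ract m b1 ⊗ (T a2 * b2))); last first.
    by apply: eq_tlift => a1 a2; rewrite dactE.
  rewrite rcomulA_tlift; last by trilin.
  rewrite -(rcomul_counitr (F := fun b => ract m b ⊗ (1 : H))); last by lin.
  apply: eq_tlift => a1 a2.
  by rewrite (antipode_invl_tlift ST TS (F := fun x : H => ract m a1 ⊗ x)) //; lin.
have umt := hopf_rmod_mor (tmap_hopf_mor um).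
exists (exist _ u um); split.
  apply: eq_exist; apply/funext => y /=; rewrite -[y]qreprK (qmapE _ umt) eE.
  move: (qrepr y) => {y} t.
  have ltu := tmap_linear um.1 (@linear_idfun _ H).
  move: t; apply: tens_ext => [||m x].
  - exact: linear_comp ltu le0.
  - exact: linear_comp lq lh.
  by rewrite (tmapE _ _ um.1) // e0E uE -hq.
move=> [v vm] vE; apply: eq_exist; apply/funext => m; apply: iI; rewrite uE.
have := congr1 (fun f => sval f (q (m ⊗ 1))) vE.
rewrite /= (qmapE _ (hopf_rmod_mor (tmap_hopf_mor vm))) eE (tmapE _ _ vm.1) //.
by rewrite e0E (lact1m (lactP W)).
Qed.

End InducedModule.

(** * Localization at the kernel of X |-> T X/(T X)A^+ *)

Section HopfLocalization.
Context (k : fieldType) (H : hopf k) (A : rcoideal_subalg H) (ex : aug_exact A).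
Context (O : Type) (U : O -> lmodType k).
Context (P : forall X Y : O, (U X -> U Y) -> Prop).
Context (P1 : forall X, @P X X (fun x => x)).
Context (PM : forall X Y Z (f : U X -> U Y) (g : U Y -> U Z),
  P f -> P g -> @P X Z (fun x => g (f x))).
Local Notation CC := (@concrete_cat O (fun X => U X : Type) P P1 PM).
Context (T : O -> rhopfmod A) (Tm : forall X Y, (U X -> U Y) -> T X -> T Y).
Context (Tm_mor : forall X Y f, @P X Y f -> hopf_mor (Tm f)).
Context (Tm_inj : forall X Y f, @P X Y f -> injective f -> injective (Tm f)).
Context (Tm_surj : forall X Y f, @P X Y f -> (forall y, exists x, f x = y) ->
  forall y, exists x, Tm f x = y).
Context (Tm_exact : forall X Y Z f g, @P X Y f -> @P Y Z g ->
  (forall y, g y = 0 <-> exists x, f x = y) ->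
  forall y, Tm g y = 0 <-> exists x, Tm f x = y).
Context (CA : concrete_abelian P) (S : O -> Prop).
Context (S_aug : forall X, S X <-> forall t : T X, t \in span (maug (T X))).

Let rmor X Y (f : @hom CC X Y) : rmod_mor (Tm (sval f)) :=
  hopf_rmod_mor (Tm_mor (svalP f)).

(** Here T is an exact functor into Hopf modules, and S is the kernel of its composite with M |->
    M/MA^+. Subobjects are handled by left exactness, quotients by surjectivity, extensions by
    lifting elements modulo A^+. *)
Lemma aug_exact_serre (X' X X'' : CC) (f : hom X' X) (g : hom X X'') :
  kernel_map f g -> (forall y, exists x, sval g x = y) ->
  (S X <-> S X' /\ S X'').
Proof.
move=> [fI ker] gS; rewrite !S_aug.
have Tex := Tm_exact (svalP f) (svalP g) ker.
have [[lf _] [lg _]] := (rmor f, rmor g).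
split=> [SX|[SX' SX''] t].
  split=> t.
    exact: ex (Tm_mor (svalP f)) (Tm_inj (svalP f) fI) _ (SX _).
  by have [x <-] := Tm_surj (svalP g) gS t; apply: maug_map (rmor g) (SX x).
have [m [mN mE]] := maug_lift (rmor g) (Tm_surj (svalP g) gS) (SX'' (Tm (sval g) t)).
have /Tex[x xE] : Tm (sval g) (t - m) = 0 by rewrite (linear_funB lg) mE subrr.
by rewrite -(subrK m t) rpredD // -xE; exact: maug_map (rmor f) (SX' x).
Qed.

(** An exact functor inverts f if and only if it kills the kernel and the cokernel of f. As f need
    not be injective, left exactness is used in the form [aug_exact_image]. *)
Lemma aug_exact_iso (K X Y Q : CC) (i : hom K X) (f : hom X Y) (q : hom Y Q) :
  kernel_map i f -> cokernel_map q f ->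
  (S K /\ S Q <-> aug_iso (Tm (sval f))).
Proof.
move=> [iI iker] [qS qker]; rewrite !S_aug.
have Tk := Tm_exact (svalP i) (svalP f) iker.
have Tq := Tm_exact (svalP f) (svalP q) qker.
have TqS := Tm_surj (svalP q) qS.
have [[[li _] [lf _]] [lq _]] := (rmor i, rmor f, rmor q).
split=> [[SK SQ]|[fI fS]]; split.
- move=> m /(aug_exact_image ex (Tm_mor (svalP f)))[m' [m'N m'E]].
  have /Tk[x xE] : Tm (sval f) (m - m') = 0 by rewrite (linear_funB lf) m'E subrr.
  by rewrite -(subrK m' m) rpredD // -xE; exact: maug_map (rmor i) (SK x).
- move=> n; have [n' [n'N n'E]] := maug_lift (rmor q) TqS (SQ (Tm (sval q) n)).
  have /Tq[m mE] : Tm (sval q) (n - n') = 0 by rewrite (linear_funB lq) n'E subrr.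
  by exists m; rewrite mE opprB addrC subrK.
- move=> t; apply: (ex (Tm_mor (svalP i)) (Tm_inj (svalP i) iI)).
  apply: fI; have -> : Tm (sval f) (Tm (sval i) t) = 0 by apply/Tk; exists t.
  exact: rpred0.
- move=> t; have [n <-] := TqS t; have [m mN] := fS n.
  have := maug_map (rmor q) mN; rewrite (linear_funB lq).
  have -> : Tm (sval q) (Tm (sval f) m) = 0 by apply/Tq; exists m.
  by rewrite subr0.
Qed.

Theorem hopf_localizing (D : category) (F : functor CC D) :
  (forall Y, exists X (e : hom (F X) Y), isomorphism e /\ universal_arrow e) ->
  (forall (X Y : CC) (f : hom X Y), isomorphism (fmap F f) <-> aug_iso (Tm (sval f))) ->
  @localizing CC S /\ equivalent_cat (@serre_quotient CC S) D.
Proof.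
move=> univ isoP; apply: (concrete_localizing CA univ).
  exact: aug_exact_serre.
move=> K X Y Q i f q ki qi; rewrite isoP; exact: aug_exact_iso ki qi.
Qed.

End HopfLocalization.

(** * The right-handed equivalences *)

Section RightTheorem.
Context (k : fieldType) (H : hopf k) (A : rcoideal_subalg H).
Context (T : H -> H) (ST : cancel (@antipode k H) T) (TS : cancel T (@antipode k H)).
Context (ex : aug_exact A).

Lemma tmap_kernel (M N K : rmodule A) (f : M -> N) (g : N -> K) :
  rmod_mor f -> rmod_mor g -> (forall y, g y = 0 <-> exists x, f x = y) ->
  forall y : tens N H, tmap g (fun h => h) y = 0 <->
    exists x, tmap f (fun h => h) x = y.
Proof.
move=> [lf _] [lg _] ker y; split; first exact: tmap_exact lf lg (fun y => proj1 (ker y)) y.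
move=> [x <-]; rewrite tmap_comp // /tmap.
rewrite (eq_tlift (g := fun _ _ => 0)) ?tlift0 // => m h /=.
have -> : g (f m) = 0 by apply/ker; exists m.
exact: linear_fun0 ((tpure_bilinear _ _).1 h).
Qed.

Theorem right_hopf_quotient :
  localizing (@T_r_H k H A) /\
  equivalent_cat (serre_quotient (@T_r_H k H A)) (Comod_r (HA_coalg A)).
Proof.
apply: (hopf_localizing ex (T := fun M => M) (Tm := fun M N f => f) _ _ _ _
  (@hopf_abelian k H A) _ (F := quotient_comodule_functor A)) => //.
- by move=> M; exact: torsion_hopfP ST TS ex.
- by move=> V; exact: quotient_comodule_universal.
- exact: quotient_comodule_isoP.
Qed.

Theorem right_quotient :
  localizing (@T_r k H A) /\
  equivalent_cat (serre_quotient (@T_r k H A)) (HMod_Comod_r A).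
Proof.
apply: (hopf_localizing ex (T := @diag_hopf k H A)
  (Tm := fun M N f => tmap f (fun h => h)) _ _ _ _
  (@rmod_abelian k A) _ (F := induced_functor A)).
- exact: tmap_hopf_mor.
- by move=> M N f [lf _]; exact: tmap_inj.
- by move=> M N f [lf _]; exact: tmap_surj.
- exact: tmap_kernel.
- by move=> M; exact: torsion_diagP.
- by move=> W; exact: (induced_universal ST TS).
- exact: induced_isoP.
Qed.

End RightTheorem.

(** * The opposite Hopf algebra *)

Section ConverseAlgebra.
Context (k : fieldType) (H : algType k).
Local Notation Hc := (GRing.converse H).

HB.instance Definition _ := GRing.Lmodule.copy Hc H.

Fact converse_scalerAl (a : k) (u v : Hc) : a *: (u * v) = (a *: u : Hc) * v.
Proof. exact: (scalerAr a (v : H) (u : H)). Qed.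
HB.instance Definition _ :=
  GRing.Lmodule_isLalgebra.Build k Hc converse_scalerAl.

Fact converse_scalerAr (a : k) (u v : Hc) : a *: (u * v) = u * (a *: v : Hc).
Proof. exact: (scalerAl a (v : H) (u : H)). Qed.
HB.instance Definition _ :=
  GRing.Lalgebra_isAlgebra.Build k Hc converse_scalerAr.

End ConverseAlgebra.

(** A fresh name for the carrier, so that the opposite multiplication does not compete with that of
    A when structures are inferred. *)
Definition op_sub (k : fieldType) (H : algType k) (P : {pred H})
  (A : subAlgType P) : Type := A.
HB.instance Definition _ (k : fieldType) (H : algType k) (P : {pred H})
  (A : subAlgType P) := GRing.Algebra.copy (op_sub A) (GRing.converse A).

Section ConverseSubalgebra.
Context (k : fieldType) (H : algType k) (P : {pred H}) (A : subAlgType P).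
Local Notation Hc := (GRing.converse H).
Local Notation P' := (P : {pred Hc}).

Definition op_val (a : op_sub A) : Hc := val (a : A).
Definition op_Sub (x : Hc) (Px : P' x) : op_sub A := Sub (x : H) Px : A.

Fact op_Sub_rect K : (forall x Px, K (@op_Sub x Px)) -> forall u, K u.
Proof.
move=> KS u; have Pu : P' (op_val u) := valP (u : A).
have -> : u = op_Sub Pu by apply: (@val_inj _ _ A); rewrite SubK.
exact: KS.
Qed.

Fact op_SubK x Px : op_val (@op_Sub x Px) = x.
Proof. exact: (@SubK _ _ A). Qed.

HB.instance Definition _ := isSub.Build Hc P' (op_sub A) op_Sub_rect op_SubK.

Fact op_val_nmod : nmod_morphism (val : op_sub A -> Hc).
Proof.
split; first exact: (raddf0 (val : A -> H)).
exact: (raddfD (val : A -> H)).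
Qed.
HB.instance Definition _ :=
  Algebra.isSubBaseAddUMagma.Build Hc P' (op_sub A) op_val_nmod.

Fact op_val_monoid : monoid_morphism (val : op_sub A -> Hc).
Proof.
split=> [|x y]; first exact: (rmorph1 (val : A -> H)).
exact: (rmorphM (val : A -> H) y x).
Qed.
HB.instance Definition _ :=
  GRing.isSubPzSemiRing.Build Hc P' (op_sub A) op_val_monoid.

Fact op_val_scalable : scalable (val : op_sub A -> Hc).
Proof. exact: (linearZZ (val : A -> H)). Qed.
HB.instance Definition _ :=
  GRing.isSubLSemiModule.Build k Hc P' (op_sub A) op_val_scalable.

End ConverseSubalgebra.

Section OppositeHopf.
Context (k : fieldType) (H : hopf k).
Context (T : H -> H) (ST : cancel (@antipode k H) T) (TS : cancel T (@antipode k H)).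
Local Notation Hc := (GRing.converse H).

Fact op_hopfP : @is_hopf k Hc (@hcomul k H) (@hcounit k H) T.
Proof.
have HP := hopfP H; split.
- exact: hopf_coalgP HP.
- move=> x y; rewrite -[LHS]/(hcomul ((y : H) * (x : H))) (hopf_comulM HP).
  exact: tlift_swap.
- exact: hopf_comul1 HP.
- move=> x y; rewrite -[LHS]/(hcounit ((y : H) * (x : H))).
  by rewrite (hopf_counitM HP) mulrC.
- exact: hopf_counit1 HP.
- exact: antipode_inv_linear ST TS.
- exact: (antipode_invr ST TS).
- exact: (antipode_invl ST TS).
Qed.

Definition op_hopf : hopf k := Hopf op_hopfP.

Context (A : rcoideal_subalg H).

Local Notation Ac := (op_sub A : @GRing.SubAlgebra.type k Hc (rcs_pred A)).

Fact op_coideal (a : Ac) :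
  exists t : tens Ac op_hopf, tens_val t = @hcomul k op_hopf (val a).
Proof. exact: (rcs_coideal (a : A)). Qed.

Definition op_rcs : rcoideal_subalg op_hopf :=
  @RcoidealSubalg k op_hopf (rcs_pred A) Ac op_coideal.

(** Each side is a chosen preimage of the same tensor in H ⊗ H; the choices agree because A ⊗ H
    embeds there. *)
Lemma op_rcomul (a : A) : @rcomul k op_hopf op_rcs a = @rcomul k H A a.
Proof.
apply: (@tens_val_inj k op_hopf op_rcs); rewrite rcomulE.
by rewrite -[LHS]/(@hcomul k H (val a)) -rcomulE.
Qed.

End OppositeHopf.

(** Precomposition with an equivalence preserves universal arrows, so those for right modules over
    A^op serve left modules over A. *)
Lemma universal_arrow_comp (C C' D : category) (E : functor C C')
    (F : functor C' D) : fully_faithful E -> essentially_surjective E ->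
  (forall Y, exists X (e : hom (F X) Y), isomorphism e /\ universal_arrow e) ->
  forall Y, exists X (e : hom (functor_comp F E X) Y),
    isomorphism e /\ universal_arrow e.
Proof.
move=> ff es univ Y; have [G [e [[e' [e'e ee']] eU]]] := univ Y.
have [X [a [b [ba ab]]]] := es G.
exists X, (e ∘m fmap F a); split.
  exists (fmap F b ∘m e'); split.
    rewrite -compA [e' ∘m (_ ∘m _)]compA e'e comp1m.
    by rewrite /= -fmapM ba fmap1.
  rewrite -compA [fmap F a ∘m (_ ∘m _)]compA -fmapM ab fmap1 comp1m.
  exact: ee'.
move=> X' h; have [v [vh vU]] := eU _ h.
have [u [uE uU]] := ff _ _ (b ∘m v).
exists u; split=> [|u' u'h].
  by rewrite /= -compA -fmapM uE compA ab comp1m.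
apply: uU; rewrite (vU (a ∘m fmap E u')); first by rewrite compA ba comp1m.
by rewrite fmapM compA.
Qed.

Section OppositeModules.
Context (k : fieldType) (H : hopf k).
Context (T : H -> H) (ST : cancel (@antipode k H) T) (TS : cancel T (@antipode k H)).
Context (A : rcoideal_subalg H).
Local Notation opH := (op_hopf ST TS).
Local Notation opA := (op_rcs ST TS A).

Definition op_ract (M : lmodule A) (m : M) (a : opA) : M := lact (a : A) m.

Fact op_ractP (M : lmodule A) : @is_ract k opA M (@op_ract M).
Proof.
have [[b1 b2] m1 mA] := lactP M.
split; [|exact: m1|by move=> v a b; exact: mA].
by split=> [a|v]; [exact: b2 | exact: b1].
Qed.

Definition op_rmod (M : lmodule A) : rmodule opA := Rmodule (@op_ractP M).

Definition op_lact (M : rmodule opA) (a : A) (m : M) : M := ract m (a : opA).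

Fact op_lactP (M : rmodule opA) : @is_lact k A M (@op_lact M).
Proof.
have [[b1 b2] m1 mA] := ractP M.
split; [|exact: m1|by move=> v a b; exact: mA].
by split=> [v|a]; [exact: b2 | exact: b1].
Qed.

Definition op_lmod (M : rmodule opA) : lmodule A := Lmodule (@op_lactP M).

Lemma op_rcoact (V : lmodType k) (rho : V -> tens V H) :
  @is_rcoact k (hopf_coalg opH) V rho <-> @is_rcoact k (hopf_coalg H) V rho.
Proof. by split=> -[lr rA r1]; split. Qed.

Fact op_rhopf_compat (M : lhopfmod A) (m : op_rmod M) (a : opA) :
  (lhm_coact (ract m a) : tens (op_rmod M) opH) =
  \tsum_(m0, m1 <- (lhm_coact m : tens (op_rmod M) opH))
    \tsum_(a1, a2 <- rcomul a) ract m0 a1 ⊗ (m1 * a2).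
Proof.
rewrite op_rcomul; apply: (etrans (lhm_compat (a : A) m)).
exact: tlift_swap.
Qed.

Definition op_rhopf (M : lhopfmod A) : rhopfmod opA :=
  @Rhopfmod k opH opA (op_rmod M) _
    (proj2 (op_rcoact _) (lhm_coactP M)) (@op_rhopf_compat M).

Fact op_lhopf_compat (M : rhopfmod opA) (a : A) (m : op_lmod M) :
  (rhm_coact (lact a m) : tens (op_lmod M) H) =
  \tsum_(a1, a2 <- rcomul a)
    \tsum_(m0, m1 <- (rhm_coact m : tens (op_lmod M) H))
    lact a1 m0 ⊗ (a2 * m1).
Proof.
apply: (etrans (rhm_compat m (a : opA))); rewrite op_rcomul.
exact: tlift_swap.
Qed.

Definition op_lhopf (M : rhopfmod opA) : lhopfmod A :=
  @Lhopfmod k H A (op_lmod M) _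
    (proj1 (op_rcoact _) (rhm_coactP M)) (@op_lhopf_compat M).

Definition op_mod_functor : functor (Mod_l A) (Mod_r opA).
Proof.
refine (@Functor (Mod_l A) (Mod_r opA) op_rmod
  (fun M N f => exist _ (sval f : op_rmod M -> op_rmod N)
     (conj (proj1 (svalP f)) (fun v a => proj2 (svalP f) a v))) _ _).
- by move=> M; exact: eq_exist.
- by move=> M N K g f; exact: eq_exist.
Defined.

Fact op_hopf_mor (M N : HopfMod_l A) (f : hom M N) :
  @hopf_mor k opH opA (op_rhopf M) (op_rhopf N) (sval f).
Proof.
by case: f => f [lf af cf]; split=> // v a; exact: af.
Qed.

Definition op_hopf_functor : functor (HopfMod_l A) (HopfMod_r opA).
Proof.
refine (@Functor (HopfMod_l A) (HopfMod_r opA) op_rhopf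
  (fun M N f => exist _ (sval f : op_rhopf M -> op_rhopf N) (op_hopf_mor f)) _ _).
- by move=> M; exact: eq_exist.
- by move=> M N K g f; exact: eq_exist.
Defined.

Lemma op_mod_functor_ff : fully_faithful op_mod_functor.
Proof.
move=> M N [h [lh ah]].
exists (exist _ (h : M -> N) (conj lh (fun a v => ah v a)) : @hom (Mod_l A) M N).
split=> [|[f fP] fE]; first exact: eq_exist.
by apply: eq_exist; exact: esym (congr1 sval fE).
Qed.

Lemma op_mod_functor_es : essentially_surjective op_mod_functor.
Proof.
move=> Y; exists (op_lmod Y).
have P1 : @rmod_mor k opA (op_rmod (op_lmod Y)) Y (fun y => y) by [].
have P2 : @rmod_mor k opA Y (op_rmod (op_lmod Y)) (fun y => y) by [].
exists (exist _ _ P1), (exist _ _ P2); split; exact: eq_exist.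
Qed.

Lemma op_hopf_functor_ff : fully_faithful op_hopf_functor.
Proof.
move=> M N [h [lh ah ch]].
exists (exist _ (h : M -> N) (And3 lh (fun a v => ah v a) ch) : @hom (HopfMod_l A) M N).
split=> [|[f fP] fE]; first exact: eq_exist.
by apply: eq_exist; exact: esym (congr1 sval fE).
Qed.

Lemma op_hopf_iso (Y : rhopfmod opA) :
  @hopf_mor k opH opA (op_rhopf (op_lhopf Y)) Y (fun y => y) /\
  @hopf_mor k opH opA Y (op_rhopf (op_lhopf Y)) (fun y => y).
Proof. by split; split=> // v; rewrite /= tlift_id. Qed.

Lemma op_hopf_functor_es : essentially_surjective op_hopf_functor.
Proof.
move=> Y; exists (op_lhopf Y); have [P1 P2] := op_hopf_iso Y.
exists (exist _ _ P1), (exist _ _ P2); split; exact: eq_exist.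
Qed.

Lemma lmod_abelian : concrete_abelian (U := fun M : lmodule A => M : lmodType k)
  (fun M N f => linear f /\ lact_mor (@lact _ _ M) (@lact _ _ N) f).
Proof.
apply: (concrete_abelian_transport (E := op_rmod) _ _ _ (@rmod_abelian k opA)).
- move=> X Y Z f g [lf af] [lg ag]; split; first exact: linear_comp.
  by move=> v a; rewrite af ag.
- by move=> X Y f; split=> -[lf af]; split=> // a v; exact: af.
- by move=> Y; exists (op_lmod Y), (fun y => y), (fun y => y).
Qed.

Lemma lhopf_abelian : concrete_abelian (U := fun M : lhopfmod A => M : lmodType k)
  (fun M N f => [/\ linear f, lact_mor (@lact _ _ M) (@lact _ _ N) f &
     rcoact_mor (@lhm_coact _ _ _ M) (@lhm_coact _ _ _ N) f]).
Proof.
apply: (concrete_abelian_transport (E := op_rhopf) _ _ _ (@hopf_abelian k opH opA)).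
- move=> X Y Z f g [lf af cf] [lg ag cg]; split; first exact: linear_comp.
    by move=> v a; rewrite af ag.
  exact: rcoact_mor_comp cf cg.
- by move=> X Y f; split=> -[lf af cf]; split=> // a v; exact: af.
- by move=> Y; have [P1 P2] := op_hopf_iso Y; exists (op_lhopf Y), (fun y => y), (fun y => y).
Qed.

(** [tswap] identifies M ⊗_{A^op} H^op with H ⊗_A M, as it sends each defining relation to the
    negative of a defining relation. *)
Lemma right_flat_op : right_flat_over A -> left_flat_over opA.
Proof.
move=> flat M M' f fI.
pose N := op_lmod M; pose N' := op_lmod M'.
pose HR := Rmodule (right_regularP A); pose HL := Lmodule (left_regularP opA).
pose f' : @hom (Mod_l A) N N' :=
  exist _ (sval f : N -> N') (conj (proj1 (svalP f)) (fun a v => proj2 (svalP f) v a)).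
have lf : linear (sval f) := proj1 (svalP f).
have sw t : t \in span (tensA_rel (M := M') (N := HL)) ->
    (tswap t : tens HR N') \in span (tensA_rel (M := HR) (N := N')).
  apply: (span_linear (f := fun t => tswap t : tens HR N')).
    exact: (@tswap_linear k M' HL).
  move=> _ [m a h]; rewrite (linear_funB (@tswap_linear k M' HL)) !tswapE.
  rewrite -opprB rpredN; apply: mem_span.
  exact: (@TensA k A HR N' (h : H) (a : A) m).
have sw' t : t \in span (tensA_rel (M := HR) (N := N)) ->
    (tswap t : tens M HL) \in span (tensA_rel (M := M) (N := HL)).
  apply: (span_linear (f := fun t => tswap t : tens M HL)).
    exact: (@tswap_linear k HR N).
  move=> _ [h a m]; rewrite (linear_funB (@tswap_linear k HR N)) !tswapE.
  rewrite -opprB rpredN; apply: mem_span.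
  exact: (@TensA k opA M HL m (a : opA) (h : opH)).
move=> x y; rewrite -[x]qreprK -[y]qreprK !tensA_maplE.
move: (qrepr x) (qrepr y) => s t /qproj_eq.
have lt := tmap_linear lf (@linear_idfun k HL).
rewrite -[X in X - _]/(tmap (sval f) (fun h : HL => h) s).
rewrite -[X in _ - X]/(tmap (sval f) (fun h : HL => h) t).
rewrite -(linear_funB lt) => /sw st; apply/qproj_eq.
have {}st : tensA_mapr (M := HR) (sval f') (qproj _ (tswap (s - t) : tens HR N))
    = tensA_mapr (sval f') 0.
  rewrite -(linear0 (qproj (tensA_rel (M := HR) (N := N)))) !tensA_maprE.
  rewrite [X in _ = qproj _ X](_ : _ = 0); last first.
    exact: (linear_fun0 (tmap_linear (@linear_idfun k HR) lf)).
  apply/qproj_eq; rewrite subr0.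
  have := tmap_swap (s - t) lf (@linear_idfun k HL).
  by rewrite /tmap => E; rewrite [X in X \in _]E.
have := flat _ _ f' fI _ _ st.
move=> /qproj0P/sw'; rewrite [tswap _](@tswapK k M HL).
by [].
Qed.

Theorem left_hopf_quotient : aug_exact opA ->
  localizing (@T_l_H k H A) /\
  equivalent_cat (serre_quotient (@T_l_H k H A)) (Comod_r (HA_coalg opA)).
Proof.
move=> ex; apply: (hopf_localizing ex (T := op_rhopf) (Tm := fun M N f => f)
  _ _ _ _ lhopf_abelian _
  (F := functor_comp (quotient_comodule_functor opA) op_hopf_functor)) => //.
- by move=> M N f [lf af cf]; split=> // v a; exact: af.
- move=> M; exact: (torsion_hopfP (op_rhopf M) (T := @antipode k H) TS ST ex).
- apply: universal_arrow_comp op_hopf_functor_ff op_hopf_functor_es _ => V.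
  exact: quotient_comodule_universal.
- move=> M N f; exact: (quotient_comodule_isoP (fmap op_hopf_functor f)).
Qed.

Theorem left_quotient : aug_exact opA ->
  localizing (@T_l k H A) /\
  equivalent_cat (serre_quotient (@T_l k H A)) (HMod_Comod_r opA).
Proof.
move=> ex; apply: (hopf_localizing ex (T := fun M => @diag_hopf k opH opA (op_rmod M))
  (Tm := fun M N f => tmap f (fun h => h)) _ _ _ _ lmod_abelian _
  (F := functor_comp (induced_functor opA) op_mod_functor)).
- move=> M N f [lf af]; apply: (@tmap_hopf_mor k opH opA (op_rmod M) (op_rmod N)).
  by split=> // v a; exact: af.
- by move=> M N f [lf _]; exact: tmap_inj.
- by move=> M N f [lf _]; exact: tmap_surj.
- move=> M N K f g [lf af] [lg ag].
  by apply: (@tmap_kernel k opH opA (op_rmod M) (op_rmod N) (op_rmod K));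
    split=> // v a; [exact: af | exact: ag].
- move=> M; exact: (torsion_diagP (op_rmod M) ex).
- apply: universal_arrow_comp op_mod_functor_ff op_mod_functor_es _ => W.
  exact: (@induced_universal k opH opA (@antipode k H) TS ST W ex).
- move=> M N f; exact: (induced_isoP (fmap op_mod_functor f)).
Qed.

End OppositeModules.

(** * Exchanging left and right comodules along an anti-morphism of coalgebras *)

Section FlippedComodules.
Context (k : fieldType) (C D : coalgebra k) (s : C -> D).
Context (ls : linear s) (s_counit : forall c, counit (s c) = counit c).
Context (s_comul : forall c, comul (s c) = \tsum_(c1, c2 <- comul c) s c2 ⊗ s c1).
Implicit Types (V W : lmodType k).

Lemma lcoactA_tlift V (U : lmodType k) (lam : V -> tens C V) (F : C -> C -> V -> U) v :
  is_lcoact lam -> @trilinear_fun k _ _ _ U F ->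
  \tsum_(v1, v0 <- lam v) \tsum_(c, d <- comul v1) F c d v0
  = \tsum_(v1, v0 <- lam v) \tsum_(w1, w0 <- lam v0) F v1 w1 w0.
Proof.
move=> cD [F1 F2 F3]; pose G y t := tlift (F y) t.
have bG : bilinear_fun G by rewrite /G; lin.
have := congr1 (tlift G) (lcoactA cD v).
rewrite !tlift_tlift // => E; rewrite -[RHS]/(tlift (fun y z => G y (lam z)) _).
have -> : \tsum_(y, z <- lam v) G y (lam z)
  = \tsum_(y, z <- lam v) tlift G (y ⊗ lam z).
  by apply: eq_tlift => y z; rewrite tliftE.
rewrite -E; apply: eq_tlift => y z; rewrite tlift_tlift //.
apply: eq_tlift => y1 y2; rewrite tliftE // /G tliftE //; lin.
Qed.

Definition flip_r V (rho : V -> tens V C) (v : V) : tens D V :=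
  \tsum_(v0, v1 <- rho v) s v1 ⊗ v0.

Definition flip_l V (lam : V -> tens C V) (v : V) : tens V D :=
  \tsum_(v1, v0 <- lam v) v0 ⊗ s v1.

Fact flip_lcoact V (rho : V -> tens V C) : is_rcoact rho -> is_lcoact (flip_r rho).
Proof.
move=> rP; have lr := rcoact_linear rP.
have lD := comul_linear (coalgP D); have lC := comul_linear (coalgP C).
have eD := counit_linear (coalgP D).
have lf : linear (flip_r rho) by rewrite /flip_r; lin.
split=> // v.
  rewrite {1 2}/flip_r !tlift_tlift; try by lin.
  transitivity (\tsum_(v0, v1 <- rho v) \tsum_(c, d <- comul v1)
      (s d ⊗ (s c ⊗ v0))).
    apply: eq_tlift => v0 v1; rewrite tliftE; last by lin.
    rewrite s_comul tlift_tlift; last by lin.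
    by apply: eq_tlift => c d; rewrite tliftE //; lin.
  rewrite -(rcoactA_tlift v (F := fun w c d => s d ⊗ (s c ⊗ w)) rP); last by trilin.
  apply: eq_tlift => v0 v1; rewrite tliftE; last by lin.
  by rewrite /flip_r (linear_tlift _ _ ((tpure_bilinear _ _).2 _)).
rewrite /flip_r tlift_tlift; last by lin.
rewrite -[RHS](rcoact1 rP); apply: eq_tlift => v0 v1.
by rewrite tliftE ?s_counit //; lin.
Qed.

Fact flip_rcoact V (lam : V -> tens C V) : is_lcoact lam -> is_rcoact (flip_l lam).
Proof.
move=> lP; have ll := lcoact_linear lP.
have lD := comul_linear (coalgP D); have lC := comul_linear (coalgP C).
have eD := counit_linear (coalgP D).
have lf : linear (flip_l lam) by rewrite /flip_l; lin.
split=> // v.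
  rewrite {1 3}/flip_l !tlift_tlift; try by lin.
  transitivity (\tsum_(v1, v0 <- lam v) \tsum_(w1, w0 <- lam v0)
      (w0 ⊗ (s w1 ⊗ s v1))).
    apply: eq_tlift => v1 v0; rewrite tliftE; last by lin.
    rewrite /flip_l tlift_tlift; last by lin.
    by apply: eq_tlift => c d; rewrite tliftE //; lin.
  rewrite -(lcoactA_tlift v (F := fun c d w => w ⊗ (s d ⊗ s c)) lP); last by trilin.
  apply: eq_tlift => v1 v0; rewrite tliftE; last by lin.
  by rewrite s_comul (linear_tlift _ _ ((tpure_bilinear _ _).2 _)).
rewrite /flip_l tlift_tlift; last by lin.
rewrite -[RHS](lcoact1 lP); apply: eq_tlift => v1 v0.
by rewrite tliftE ?s_counit //; lin.
Qed.

Lemma flip_r_mor V W (rV : V -> tens V C) (rW : W -> tens W C) (f : V -> W) :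
  linear f -> @rcoact_mor k C V W rV rW f ->
  lcoact_mor (flip_r rV) (flip_r rW) f.
Proof.
move=> lf fm v; rewrite /flip_r fm !tlift_tlift; try by lin.
by apply: eq_tlift => v0 v1; rewrite !tliftE //; lin.
Qed.

Lemma flip_l_mor V W (lV : V -> tens C V) (lW : W -> tens C W) (f : V -> W) :
  linear f -> @lcoact_mor k C V W lV lW f ->
  rcoact_mor (flip_l lV) (flip_l lW) f.
Proof.
move=> lf fm v; rewrite /flip_l fm !tlift_tlift; try by lin.
by apply: eq_tlift => v0 v1; rewrite !tliftE //; lin.
Qed.

End FlippedComodules.

Lemma flip_rK (k : fieldType) (C D : coalgebra k) (s : C -> D) (s' : D -> C)
    (V : lmodType k) (rho : V -> tens V C) v :
  linear s -> linear s' -> cancel s s' -> flip_l s' (flip_r s rho) v = rho v.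
Proof.
move=> ls ls' sK; rewrite /flip_l /flip_r tlift_tlift; last by lin.
rewrite -[RHS]tlift_id; apply: eq_tlift => v0 v1.
by rewrite tliftE ?sK //; lin.
Qed.

Lemma flip_lK (k : fieldType) (C D : coalgebra k) (s : C -> D) (s' : D -> C)
    (V : lmodType k) (lam : V -> tens C V) v :
  linear s -> linear s' -> cancel s s' -> flip_r s' (flip_l s lam) v = lam v.
Proof.
move=> ls ls' sK; rewrite /flip_l /flip_r tlift_tlift; last by lin.
rewrite -[RHS]tlift_id; apply: eq_tlift => v0 v1.
by rewrite tliftE ?sK //; lin.
Qed.

(* h |-> S^-1(h) induces an anti-isomorphism between the coalgebras of A^op
   and A; it exchanges the left and right comodules. *)
Section OppositeCoalgebra.
Context (k : fieldType) (H : hopf k).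
Context (T : H -> H) (ST : cancel (@antipode k H) T) (TS : cancel T (@antipode k H)).
Context (A : rcoideal_subalg H).
Local Notation opH := (op_hopf ST TS).
Local Notation opA := (op_rcs ST TS A).
Local Notation S := (@antipode k H).
Local Notation C := (HA_coalg A).
Local Notation C' := (HA_coalg opA).
Local Notation pi := (qproj (@HAplus_gen k H A) : H -> HA_quot A).
Local Notation pi' := (qproj (@HAplus_gen k opH opA) : H -> HA_quot opA).
Let lp : linear pi := @pi_linear k H A.
Let lp' : linear pi' := @pi_linear k opH opA.
Let lT : linear T := antipode_inv_linear ST TS.
Let lS : linear S := @antipode_linear k H.

(** In H^op the generator is a h, and T(a h) = T(h) T(a); under pi this is T(h) acting on pi(T(a)) =
    eps(a) pi(1) = 0. *)
Let pi_vanish x : @HAplus_gen k opH opA x -> pi (T x) = 0.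
Proof.
case=> h a a0; rewrite -[h * _]/((val (a : A) : H) * (h : H)).
rewrite (antipode_invM ST TS) -qactE (pi_antipode_inv ST TS (a : A)).
by rewrite /aug a0 scale0r (linear_fun0 (@qact_linearr _ _ A _)).
Qed.

Let pi_vanish' x : HAplus_gen A x -> pi' (S x) = 0.
Proof.
case=> h a a0; rewrite antipodeM -[_ * _]/((S h : opH) * (S (val a) : opH)).
rewrite -(@qactE k opH opA) (@pi_antipode_inv k opH opA S TS ST (a : opA)).
by rewrite -[aug _]/(hcounit (val a)) a0 scale0r (linear_fun0 (@qact_linearr _ opH opA _)).
Qed.

Definition op_coalg (c : C') : C := pi (T (qrepr c)).
Definition op_coalg_inv (c : C) : C' := pi' (S (qrepr c)).

Lemma op_coalgE x : op_coalg (pi' x) = pi (T x).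
Proof. exact: (qliftE (linear_comp lT lp) pi_vanish x). Qed.
Lemma op_coalg_invE x : op_coalg_inv (pi x) = pi' (S x).
Proof. exact: (qliftE (linear_comp lS lp') pi_vanish' x). Qed.

Lemma op_coalg_linear : linear op_coalg.
Proof. exact: (qlift_linear (linear_comp lT lp) pi_vanish). Qed.
Lemma op_coalg_inv_linear : linear op_coalg_inv.
Proof. exact: (qlift_linear (linear_comp lS lp') pi_vanish'). Qed.

Lemma op_coalgK : cancel op_coalg op_coalg_inv.
Proof. by move=> c; rewrite -[c]qreprK op_coalgE op_coalg_invE TS. Qed.
Lemma op_coalg_invK : cancel op_coalg_inv op_coalg.
Proof. by move=> c; rewrite -[c]qreprK op_coalg_invE op_coalgE ST. Qed.

Lemma op_coalg_counit (c : C') : @counit _ C (op_coalg c) = counit c.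
Proof.
rewrite -[c]qreprK; move: (qrepr c) => x; rewrite op_coalgE.
apply: (etrans (qcounitE A (T x))); rewrite (counit_antipode_inv TS).
exact/esym/(@qcounitE k opH opA x).
Qed.
Lemma op_coalg_inv_counit (c : C) : @counit _ C' (op_coalg_inv c) = counit c.
Proof. by rewrite -[in RHS](op_coalg_invK c) op_coalg_counit. Qed.

Lemma op_coalg_comul (c : C') : @comul _ C (op_coalg c) =
  \tsum_(c1, c2 <- comul c) op_coalg c2 ⊗ op_coalg c1.
Proof.
have lo := op_coalg_linear; rewrite -[c]qreprK op_coalgE /= !qcomulE.
rewrite (comul_antipode_inv ST TS) !tlift_tlift; try by lin.
by apply: eq_tlift => x y; rewrite !tliftE ?op_coalgE //; lin.
Qed.
Lemma op_coalg_inv_comul (c : C) : @comul _ C' (op_coalg_inv c) =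
  \tsum_(c1, c2 <- comul c) op_coalg_inv c2 ⊗ op_coalg_inv c1.
Proof.
have lo := op_coalg_inv_linear; rewrite -[c]qreprK op_coalg_invE /= !qcomulE.
rewrite -[hcomul _]/(@hcomul k H (S _)) comul_antipode !tlift_tlift; try by lin.
by apply: eq_tlift => x y; rewrite !tliftE ?op_coalg_invE //; lin.
Qed.

Lemma op_coalg_act (h : H) (c : C') :
  op_coalg (@qact k opH opA (S h) c) = qact h (op_coalg c).
Proof.
rewrite -[c]qreprK (@qactE k opH opA) !op_coalgE qactE.
by rewrite -[_ * _]/((qrepr c : H) * S h) (antipode_invM ST TS) ST.
Qed.
Lemma op_coalg_inv_act (h : H) (c : C) :
  op_coalg_inv (qact (T h) c) = @qact k opH opA h (op_coalg_inv c).
Proof.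
rewrite -[c]qreprK qactE !op_coalg_invE (@qactE k opH opA).
by rewrite antipodeM TS.
Qed.

Definition flip_comodule (V : rcomodule C') : lcomodule C :=
  Lcomodule (flip_lcoact op_coalg_linear op_coalg_counit op_coalg_comul (rcoactP V)).

Definition unflip_comodule (V : lcomodule C) : rcomodule C' :=
  Rcomodule (flip_rcoact op_coalg_inv_linear op_coalg_inv_counit
    op_coalg_inv_comul (lcoactP V)).

Definition flip_comodule_functor : functor (Comod_r C') (Comod_l C).
Proof.
refine (@Functor (Comod_r C') (Comod_l C) flip_comodule
  (fun V W f => exist _ (sval f : flip_comodule V -> flip_comodule W)
     (conj (proj1 (svalP f)) (flip_r_mor op_coalg_linear (proj1 (svalP f)) (proj2 (svalP f)))))
  _ _).
- by move=> V; exact: eq_exist.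
- by move=> V W K g f; exact: eq_exist.
Defined.

Lemma unflip_mor (V W : lmodType k) (rV : V -> tens V C') (rW : W -> tens W C')
    (f : V -> W) : linear f ->
  lcoact_mor (flip_r op_coalg rV) (flip_r op_coalg rW) f -> rcoact_mor rV rW f.
Proof.
move=> lf fm v.
have := flip_l_mor op_coalg_inv_linear lf fm v.
by rewrite !(flip_rK _ _ op_coalg_linear op_coalg_inv_linear op_coalgK).
Qed.

Lemma flip_comodule_equiv : equivalent_cat (Comod_r C') (Comod_l C).
Proof.
apply: (@fully_faithful_equiv _ _ flip_comodule_functor) => [V W [h [lh ch]]|V].
  exists (exist _ (h : V -> W) (conj lh (unflip_mor lh ch)) : @hom (Comod_r C') V W).
  split=> [|[f fP] fE]; first exact: eq_exist.
  by apply: eq_exist; exact: esym (congr1 sval fE).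
exists (unflip_comodule V).
have E v : flip_r op_coalg (flip_l op_coalg_inv (@lcoact _ _ V)) v = lcoact v.
  exact: flip_lK op_coalg_inv_linear op_coalg_linear op_coalg_invK.
have P1 : linear (fun v : V => v) /\
    lcoact_mor (flip_r op_coalg (flip_l op_coalg_inv (@lcoact _ _ V))) (@lcoact _ _ V)
      (fun v => v).
  by split=> // v; rewrite E tlift_id.
have P2 : linear (fun v : V => v) /\
    lcoact_mor (@lcoact _ _ V) (flip_r op_coalg (flip_l op_coalg_inv (@lcoact _ _ V)))
      (fun v => v).
  by split=> // v; rewrite E tlift_id.
exists (exist _ _ P1 : @hom (Comod_l C) (flip_comodule (unflip_comodule V)) V).
exists (exist _ _ P2 : @hom (Comod_l C) V (flip_comodule (unflip_comodule V))).
by split; exact: eq_exist.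
Qed.

(** The antimultiplicative S turns an H^op-module into an H-module. It is matched with [op_coalg],
    which is induced by its inverse T: this gives the compatibility [op_coalg_act]. *)
Definition flip_act (V : lmodule opH) (h : H) (v : V) : V := lact (S h : opH) v.

Fact flip_actP (V : lmodule opH) : @is_lact k H V (@flip_act V).
Proof.
have [[b1 b2] m1 mA] := lactP V; split=> [|v|v a b].
- split=> [v|h]; last exact: b2.
  by move=> c g h; rewrite /flip_act lS; exact: b1.
- by rewrite /flip_act antipode1; exact: m1.
- by rewrite /flip_act antipodeM; exact: mA.
Qed.

Definition unflip_act (V : lmodule H) (h : opH) (v : V) : V := lact (T h) v.

Fact unflip_actP (V : lmodule H) : @is_lact k opH V (@unflip_act V).
Proof.
have [[b1 b2] m1 mA] := lactP V; split=> [|v|v a b].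
- split=> [v|h]; last exact: b2.
  by move=> c g h; rewrite /unflip_act -b1 -lT.
- rewrite /unflip_act -[RHS]m1; congr (lact _ _).
  exact: antipode_inv1 ST TS.
- rewrite /unflip_act -mA; congr (lact _ _).
  exact: (antipode_invM ST TS (b : H) (a : H)).
Qed.

Fact flip_compat (V : hmod_rcomod opA) (h : H) (v : Lmodule (@flip_actP V)) :
  flip_r op_coalg (@hrc_coact _ _ _ V) (lact h v) =
  \tsum_(h1, h2 <- hcomul h) \tsum_(v1, v0 <- flip_r op_coalg (@hrc_coact _ _ _ V) v)
    qact h1 v1 ⊗ lact h2 (v0 : Lmodule (@flip_actP V)).
Proof.
have lo := op_coalg_linear; have lw := @wco_linear k opH opA V.
have [bl br] := lact_bilinear (flip_actP V).
have lq := @qact_linearl k opH opA; have lq' := @qact_linearr k opH opA.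
have bl' := @lact_linearl k opH V; have br' := @lact_linearr k opH V.
rewrite /flip_r -[hrc_coact _]/(@wco k opH opA V (lact (S h : opH) v)) wco_lact.
rewrite -[hcomul _]/(@hcomul k H (S h)) comul_antipode !tlift_tlift; try by lin.
apply: eq_tlift => h1 h2; rewrite !tlift_tlift; try by lin.
rewrite tliftE; last by lin.
rewrite tlift_tlift; last by lin.
apply: eq_tlift => v0 v1; rewrite !tliftE; try by lin.
exact: (congr1 (fun c => c ⊗ lact (S h2 : opH) v0) (op_coalg_act h1 v1)).
Qed.

Definition flip_module (V : hmod_rcomod opA) : hmod_lcomod A :=
  @HmodLcomod k H A (Lmodule (@flip_actP V)) _
    (flip_lcoact op_coalg_linear op_coalg_counit op_coalg_comul (hrc_coactP V))
    (@flip_compat V).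

Fact unflip_compat (V : hmod_lcomod A) (h : opH) (v : Lmodule (@unflip_actP V)) :
  flip_l op_coalg_inv (@hlc_coact _ _ _ V) (lact h v) =
  \tsum_(h1, h2 <- hcomul h) \tsum_(v0, v1 <- flip_l op_coalg_inv (@hlc_coact _ _ _ V) v)
    lact h1 (v0 : Lmodule (@unflip_actP V)) ⊗ qact h2 v1.
Proof.
have lo := op_coalg_inv_linear.
have lw : linear (@hlc_coact _ _ _ V) := lcoact_linear (hlc_coactP V).
have [bl br] := lact_bilinear (unflip_actP V).
have lq := @qact_linearl k opH opA; have lq' := @qact_linearr k opH opA.
have bl' := @lact_linearl k H V; have br' := @lact_linearr k H V.
rewrite /flip_l -[lact h v]/(lact (T h) (v : V)) hlc_compat.
rewrite (comul_antipode_inv ST TS) !tlift_tlift; try by lin.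
apply: eq_tlift => h1 h2; rewrite !tlift_tlift; try by lin.
rewrite tliftE; last by lin.
rewrite tlift_tlift; last by lin.
apply: eq_tlift => v1 v0; rewrite !tliftE; try by lin.
exact: (congr1 (fun c => lact (T h1) v0 ⊗ c) (op_coalg_inv_act h2 v1)).
Qed.

Definition unflip_module (V : hmod_lcomod A) : hmod_rcomod opA :=
  @HmodRcomod k opH opA (Lmodule (@unflip_actP V)) _
    (flip_rcoact op_coalg_inv_linear op_coalg_inv_counit op_coalg_inv_comul (hlc_coactP V))
    (@unflip_compat V).

Fact flip_module_mor (V W : HMod_Comod_r opA) (f : hom V W) :
  [/\ linear (sval f),
      lact_mor (@lact _ _ (flip_module V)) (@lact _ _ (flip_module W)) (sval f) &
      lcoact_mor (@hlc_coact _ _ _ (flip_module V)) (@hlc_coact _ _ _ (flip_module W))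
        (sval f)].
Proof.
case: f => f [lf af cf]; split=> //; first by move=> h v; exact: af.
exact: (@flip_r_mor k C' C op_coalg op_coalg_linear V W _ _ f lf cf).
Qed.

Definition flip_module_functor : functor (HMod_Comod_r opA) (HMod_Comod_l A).
Proof.
refine (@Functor (HMod_Comod_r opA) (HMod_Comod_l A) flip_module
  (fun V W f => exist _ (sval f : flip_module V -> flip_module W)
     (flip_module_mor f)) _ _).
- by move=> V; exact: eq_exist.
- by move=> V W K g f; exact: eq_exist.
Defined.

Lemma flip_module_equiv : equivalent_cat (HMod_Comod_r opA) (HMod_Comod_l A).
Proof.
apply: (@fully_faithful_equiv _ _ flip_module_functor) => [V W [h [lh ah ch]]|V].
  have ah' : lact_mor (@lact _ _ V) (@lact _ _ W) h.
    move=> g v; have := ah (T g) v; rewrite /= /flip_act TS.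
    by [].
  exists (exist _ (h : V -> W) (And3 lh ah' (unflip_mor lh ch)) :
    @hom (HMod_Comod_r opA) V W).
  split=> [|[f fP] fE]; first exact: eq_exist.
  by apply: eq_exist; exact: esym (congr1 sval fE).
exists (unflip_module V); pose V' := flip_module (unflip_module V).
have E v : @hlc_coact _ _ _ V' v = hlc_coact (v : V).
  exact: flip_lK op_coalg_inv_linear op_coalg_linear op_coalg_invK.
have aE h v : @lact _ _ V' h v = lact h (v : V).
  by rewrite /= /flip_act /= /unflip_act ST.
have P1 : [/\ linear (fun v : V => v),
    lact_mor (@lact _ _ V') (@lact _ _ V) (fun v => v) &
    lcoact_mor (@hlc_coact _ _ _ V') (@hlc_coact _ _ _ V) (fun v => v)].
  by split=> // v; rewrite E tlift_id.
have P2 : [/\ linear (fun v : V => v),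
    lact_mor (@lact _ _ V) (@lact _ _ V') (fun v => v) &
    lcoact_mor (@hlc_coact _ _ _ V) (@hlc_coact _ _ _ V') (fun v => v)].
  by split=> // v; rewrite E tlift_id.
exists (exist _ _ P1 : @hom (HMod_Comod_l A) V' V).
exists (exist _ _ P2 : @hom (HMod_Comod_l A) V V').
by split; exact: eq_exist.
Qed.

End OppositeCoalgebra.

Theorem theorem10p2 (k : fieldType) (H : hopf k)
    (antipode_bij : bijective (antipode (h := H)))
    (A : rcoideal_subalg H) :
  (left_flat_over A ->
    (localizing (@T_r k H A) /\ localizing (@T_r_H k H A)) /\
    (equivalent_cat (serre_quotient (@T_r_H k H A)) (Comod_r (HA_coalg A)) /\
     equivalent_cat (serre_quotient (@T_r k H A)) (HMod_Comod_r A))) /\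
  (right_flat_over A ->
    (localizing (@T_l k H A) /\ localizing (@T_l_H k H A)) /\
    (equivalent_cat (serre_quotient (@T_l_H k H A)) (Comod_l (HA_coalg A)) /\
     equivalent_cat (serre_quotient (@T_l k H A)) (HMod_Comod_l A))).
Proof.
have [T ST TS] := antipode_bij; split=> flat.
  have ex := flat_aug_exact flat.
  have [l1 e1] := right_quotient ST TS ex.
  by have [l2 e2] := right_hopf_quotient ST TS ex.
have ex := flat_aug_exact (@right_flat_op k H T ST TS A flat).
have [l1 e1] := left_quotient ex; have [l2 e2] := left_hopf_quotient ex.
(* The targets reached so far are right comodules over the coalgebra of A^op; flipping along the
   anti-isomorphism makes them left C-comodules. *)
split=> //; split.
  exact: equivalent_cat_trans e2 (flip_comodule_equiv ST TS A).
exact: equivalent_cat_trans e1 (flip_module_equiv ST TS A).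
Qed.
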